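(* Let $u_0,v_0$ be LEFM initial data, let $b\in C^1([0,T];L^2_0(D;\mathbb{R}^d))$, and for $\epsilon_k=2^{-k}$, $k=1,2,\dots$, let $u^{\epsilon_k}$ be the cohesive evolution with horizon $\epsilon_k$, initial data $u^{\epsilon_k}(0)=u_0$, $u^{\epsilon_k}_t(0)=v_0$ and body force $b$. Fix $0<\overline\theta\le1$, $0<\underline k\le\overline r$, $1/2\le\alpha<1$ and put $\beta=2\alpha-1$, so $0\le\beta<1$. For $\delta>0$ let $$CPZ^\delta(\underline k,\alpha,\overline\theta,t)=\bigcup_{\epsilon_k<\delta}PZ^{\epsilon_k}(\underline k,\alpha,\overline\theta,t),\qquad CPZ^0(\underline k,\alpha,\overline\theta,t)=\bigcap_{\delta>0}CPZ^\delta(\underline k,\alpha,\overline\theta,t).$$ Then the collection $CPZ^\delta(\underline k,\alpha,\overline\theta,t)$ is decreasing with $\delta\to0$, and there is a positive constant $K$ independent of $t$ and $\delta$ for which $$\mathcal{L}^d\left(CPZ^\delta(\underline k,\alpha,\overline\theta,t)\right)\le K\delta^{1-\beta}\quad\text{for }0\le t\le T,$$ with $$\mathcal{L}^d\left(CPZ^0(\underline k,\alpha,\overline\theta,t)\right)=\lim_{\delta\to0}\mathcal{L}^d\left(CPZ^\delta(\underline k,\alpha,\overline\theta,t)\right)=0 .$$ Moreover, for any choice of $0<\overline\theta\le1$, $0<\underline k\le\overline r$ and $1/2\le\alpha<1$, the collection of centers $x\in D$ of neighborhoods for which there exists a positive $\delta$ such that $$P\left(\{y\in\mathcal{H}_{\epsilon_k}(x):|\mathcal{S}^{\epsilon_k}(t,y,x)|\le\underline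 k|y-x|^{\alpha-1}\}\right)\ge1-\overline\theta\quad\text{for all }\epsilon_k<\delta$$ is a set of full measure in $D$, i.e. $\mathcal{L}^d(D)=\mathcal{L}^d(D\setminus CPZ^0(\underline k,\alpha,\overline\theta,t))$.
   Context: Domain and spaces. $d\in\{2,3\}$; $D\subset\mathbb{R}^d$ is a bounded domain, split as $D=D_c\cup D_s$, where $D_c$ is a boundary layer of $D$ of thickness $a$ and $D_s$ is the interior. $L^2_0(D;\mathbb{R}^d)$ is the space of $u\in L^2(D;\mathbb{R}^d)$ that vanish on $D_c$; such $u$ are extended by $0$ outside $D$. Horizons $\epsilon>0$ satisfy $2\epsilon<a$ (only such $\epsilon_k$ are considered); $\mathcal{H}_\epsilon(x)=\{y\in\mathbb{R}^d:|y-x|<\epsilon\}$; $\omega_n$ is the volume of the unit ball of $\mathbb{R}^n$; $V_d=\epsilon^d\omega_d$; $\mathcal{L}^d$ is Lebesgue measure. Potential. $f:[0,\infty)\to\mathbb{R}$ is smooth, positive on $(0,\infty)$, concave, with $f(0)=0$, $\lim_{r\to0^+}f(r)/r=f'(0)>0$, $\lim_{r\to\infty}f(r)=f_\infty<\infty$, and $r\mapsto f(r^2)$ on $[0,\infty)$ is convex-concave with inflection point $\overline r>0$. $J$ is a nonnegative bounded function on $[0,\infty)$, vanishing on $[1,\infty)$ and not a.e. zero; $J^\epsilon(r)=J(r/\epsilon)$. For a displacement $u$ the strain is $\mathcal{S}=\mathcal{S}(y,x)=\frac{u(y)-u(x)}{|y-x|}\cdot\frac{y-x}{|y-x|}$,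 and $$\mathcal{W}^\epsilon(\mathcal{S},y-x)=\frac1\epsilon J^\epsilon(|y-x|)\frac{1}{|y-x|}f(|y-x|\mathcal{S}^2),\qquad PD^\epsilon(u)=\int_D\frac{1}{V_d}\int_{\mathcal{H}_\epsilon(x)}|y-x|\,\mathcal{W}^\epsilon(\mathcal{S},y-x)\,dy\,dx.$$ Cohesive evolution. $\rho>0$ and $T>0$ are constants. The cohesive evolution $u^\epsilon\in C^2([0,T];L^2_0(D;\mathbb{R}^d))$ is the unique solution of $\rho u^\epsilon_{tt}=-\nabla PD^\epsilon(u^\epsilon)+b$ on $D_s$, $u^\epsilon=0$ on $D_c$, with $u^\epsilon(0)=u_0$, $u^\epsilon_t(0)=v_0$, where for $x\in D_s$ $$\nabla PD^\epsilon(u)(x)=-\frac{2}{V_d}\int_{\mathcal{H}_\epsilon(x)}\partial_{\mathcal{S}}\mathcal{W}^\epsilon(\mathcal{S},y-x)\frac{y-x}{|y-x|}\,dy .$$ $\mathcal{S}^\epsilon(t,y,x)$ denotes the strain of $u^\epsilon(t)$. LEFM initial data. For $u$ in $SBD(D)$ (special functions of bounded deformation) with jump set $J_u$ and absolutely continuous part of the strain $\mathcal{E}u$, put $LEFM(u,D)=\int_D(2\mu|\mathcal{E}u|^2+\lambda|\mathrm{div}\,u|^2)dx+\mathcal{G}_c\mathcal{H}^{d-1}(J_u)$, where $\mu=\lambda=\frac14f'(0)\int_0^1r^2J(r)dr$ if $d=2$, $\mu=\lambda=\frac15f'(0)\int_0^1r^3J(r)dr$ if $d=3$, and $\mathcal{G}_c=\frac{2\omega_{d-1}}{\omega_d}f_\infty\int_0^1r^dJ(r)dr$.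 LEFM initial data are bounded $u_0,v_0\in L^2_0(D;\mathbb{R}^d)$ with $u_0\in SBD(D)$ and $LEFM(u_0,D)<\infty$. Process zone. For $B\subset\mathcal{H}_\epsilon(x)$ put $P(B)=\frac{1}{\epsilon^dm}\int_B\frac{|y-x|}{\epsilon}J(|y-x|/\epsilon)\,dy$, with $m=\int_{\mathcal{H}_1(0)}|\xi|J(|\xi|)\,d\xi$, so $P(\mathcal{H}_\epsilon(x))=1$. The process zone $PZ^\epsilon(\underline k,\alpha,\overline\theta,t)$ is the set of $x\in D$ such that $P(\{y\in\mathcal{H}_\epsilon(x):|\mathcal{S}^\epsilon(t,y,x)|>\underline k|y-x|^{\alpha-1}\})>\overline\theta$. *)

(* Defs.v *)
From HB Require Import structures.
From mathcomp Require Import all_boot all_order all_algebra.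
From mathcomp Require Import all_classical all_reals all_analysis.

Set Implicit Arguments.
Unset Strict Implicit.
Unset Printing Implicit Defensive.

Import Order.TTheory GRing.Theory Num.Theory.
Import numFieldNormedType.Exports.

Local Open Scope classical_set_scope.
Local Open Scope ring_scope.

Section rV_measurable.
Context {R : realType} {n : nat}.

Let coors (i : 'I_n) (x : 'rV[R]_n) : measurableTypeR R := x ord0 i.

Let rV_set0 : g_sigma_preimage coors set0.
Proof. exact: sigma_algebra0. Qed.

Let rV_setC A : g_sigma_preimage coors A -> g_sigma_preimage coors (~` A).
Proof. exact: sigma_algebraC. Qed.

Let rV_bigcup (F : (set 'rV[R]_n)^nat) :
  (forall i, g_sigma_preimage coors (F i)) ->
  g_sigma_preimage coors (\bigcup_i (F i)).
Proof. exact: sigma_algebra_bigcup. Qed.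

Definition rV_display : measure_display.
Proof. exact. Qed.

HB.instance Definition _ := @isMeasurable.Build rV_display
  'rV[R]_n (g_sigma_preimage coors) rV_set0 rV_setC rV_bigcup.

Lemma measurable_rV_coord (i : 'I_n) :
  measurable_fun [set: 'rV[R]_n] (fun x : 'rV[R]_n => x ord0 i).
Proof.
move=> _ Y mY; rewrite setTI; apply: sub_sigma_algebra => /=.
rewrite -bigcup_seq/=; exists i => /=; first by rewrite mem_index_enum.
by exists Y => //; rewrite setTI.
Qed.

Lemma measurable_fun_rVP d (T : measurableType d) (f : T -> 'rV[R]_n) :
  measurable_fun [set: T] f <->
  forall i, measurable_fun [set: T] (fun t => f t ord0 i).
Proof.
split=> [mf i|mf]; first exact: measurableT_comp (measurable_rV_coord i) mf.
have sub : g_sigma_preimage (fun i => coors i \o f) `<=` measurable.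
  apply: smallest_sub; first exact: sigma_algebra_measurable.
  by rewrite -bigcup_seq => A [i _ [B mB <-]]; exact: mf.
by move=> _ A mA; apply: sub; rewrite g_sigma_preimage_comp; exists A.
Qed.

End rV_measurable.

Section lebesgueD.
Context {R : realType}.

Definition vcons n (p : measurableTypeR R * 'rV[R]_n) : 'rV[R]_n.+1 :=
  \row_i oapp (p.2 ord0) p.1 (unlift ord0 i).

Definition vuncons n (v : 'rV[R]_n.+1) : measurableTypeR R * 'rV[R]_n :=
  (v ord0 ord0, \row_j v ord0 (lift ord0 j)).

Lemma vconsK n : cancel (@vcons n) (@vuncons n).
Proof.
move=> [x v]; rewrite /vcons /vuncons mxE unlift_none; congr pair.
by apply/rowP => j; rewrite !mxE liftK.
Qed.

Lemma measurable_vcons n : measurable_fun setT (@vcons n).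
Proof.
apply/measurable_fun_rVP => i.
under eq_fun do rewrite mxE; case: unliftP => [j _|_] /=.
  exact: measurableT_comp (measurable_rV_coord j) measurable_snd.
exact: measurable_fst.
Qed.

Lemma measurable_vuncons n : measurable_fun setT (@vuncons n).
Proof.
apply: measurable_fun_pair; first exact: measurable_rV_coord.
apply/measurable_fun_rVP => i.
by under eq_fun do rewrite mxE; exact: measurable_rV_coord.
Qed.

Section step.
Context n (m : {sigma_finite_measure set 'rV[R]_n -> \bar R}).

Let step_pushforward : {measure set 'rV[R]_n.+1 -> \bar R} :=
  measure_function_pushforward__canonical__measure_function_Measure
    (@lebesgue_measure R \x m)%E (@measurable_vcons n).

Definition lebesgue_step : set 'rV[R]_n.+1 -> \bar R :=
  pushforward (@lebesgue_measure R \x m)%E (@vcons n).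

HB.instance Definition _ := isMeasure.Build _ _ _ lebesgue_step
  (measure0 step_pushforward) (measure_ge0 step_pushforward)
  (@measure_semi_sigma_additive _ _ _ step_pushforward).

Let step_sigma_finite : sigma_finite [set: 'rV[R]_n.+1] lebesgue_step.
Proof.
have /sigma_finiteP[F [TF ndF Foo]] := sigma_finiteT (@lebesgue_measure R).
have /sigma_finiteP[G [TG ndG Goo]] := sigma_finiteT m.
exists (fun k => @vuncons n @^-1` (F k `*` G k)).
  rewrite -preimage_bigcup -(preimage_setT (@vuncons n)); congr preimage.
  rewrite -setXTT TF TG predeqE => -[x y]; split.
    move=> [/= [i _ Fix] [k _ Gky]]; exists (maxn i k) => //; split.
    - by move: x Fix; exact/subsetPset/ndF/leq_maxl.
    - by move: y Gky; exact/subsetPset/ndG/leq_maxr.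
  by move=> [i _ []/= ? ?]; split; exists i.
move=> k; have [mF Fk] := Foo k; have [mG Gk] := Goo k; split.
  rewrite -[X in measurable X]setTI; apply: measurable_vuncons => //.
  exact: measurableX.
rewrite /lebesgue_step /pushforward -comp_preimage.
rewrite (_ : _ \o _ = id); last by apply/funext => p; exact: vconsK.
by rewrite preimage_id product_measure1E// lte_mul_pinfty// ge0_fin_numE.
Qed.

HB.instance Definition _ :=
  Measure_isSigmaFinite.Build _ _ _ lebesgue_step step_sigma_finite.

End step.

(* Lebesgue measure on R^n, as the n-fold product of [lebesgue_measure]. *)
Fixpoint lebesgueD n : {sigma_finite_measure set 'rV[R]_n -> \bar R} :=
  if n is n'.+1 then lebesgue_step (lebesgueD n') else \d_(0 : 'rV[R]_0).

End lebesgueD.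

Section euclidean.
Context {R : realType} {n : nat}.
Implicit Types (x y : 'rV[R]_n) (r : R).

Definition dotv x y : R := \sum_(i < n) x ord0 i * y ord0 i.

(* The norm `|x| of 'rV[R]_n is the sup norm, hence this one. *)
Definition enorm x : R := Num.sqrt (dotv x x).

Definition eball x r : set 'rV[R]_n := [set y | enorm (y - x) < r].

Definition ediam (A : set 'rV[R]_n) : \bar R :=
  ereal_sup [set (enorm (x - y))%:E | x in A & y in A].

End euclidean.

Definition ball_volume (R : realType) (n : nat) : R :=
  fine (lebesgueD n (eball (0 : 'rV[R]_n) 1)).

Section hausdorff.
Local Open Scope ereal_scope.
Context {R : realType} {n : nat} (s : nat).
Implicit Types (A : set 'rV[R]_n) (e : R).

(* omega_s (diam A / 2)^s, so that H^n coincides with Lebesgue measure on R^n *)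
Definition hausdorff_gauge A : \bar R :=
  if A == set0 then 0
  else (ball_volume R s * (fine (ediam A) / 2) ^+ s)%:E.

Definition hausdorff_pre e A : \bar R :=
  ereal_inf [set \sum_(k <oo) hausdorff_gauge (F k) | F in
    [set F : (set 'rV[R]_n)^nat |
      A `<=` \bigcup_k F k /\ forall k, ediam (F k) <= e%:E]].

Definition hausdorff A : \bar R :=
  ereal_sup [set hausdorff_pre e A | e in [set e | (0 < e)%R]].

Let gauge_ge0 A : 0 <= hausdorff_gauge A.
Proof.
rewrite /hausdorff_gauge; case: eqP => // /eqP/set0P[x Ax].
rewrite lee_fin mulr_ge0//; first by rewrite fine_ge0.
rewrite exprn_ge0// divr_ge0// fine_ge0//.
by apply: ereal_sup_ubound; exists x => //; exists x => //; rewrite subrr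
  /enorm /dotv big1 ?sqrtr0// => i _; rewrite mxE mul0r.
Qed.

Let ediam0 : ediam (set0 : set 'rV[R]_n) = -oo.
Proof.
rewrite /ediam (_ : [set _ | _ in _ & _ in _] = set0) ?ereal_sup0//.
by apply/seteqP; split => // y [? []].
Qed.

Let pre_ge0 e A : 0 <= hausdorff_pre e A.
Proof.
by apply: le_ereal_inf_tmp => _ [F _ <-]; exact: nneseries_ge0.
Qed.

Let le_pre e : {homo hausdorff_pre e : A B / A `<=` B >-> A <= B}.
Proof.
move=> A B AB; apply/ereal_inf_le_tmp => _ [F [BF eF] <-].
by exists F => //; split => //; exact: subset_trans BF.
Qed.

Let pre0 e : hausdorff_pre e set0 = 0.
Proof.
apply/eqP; rewrite eq_le pre_ge0 andbT; apply: ereal_inf_lbound.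
exists (fun=> set0); first by split => // k; rewrite ediam0 leNye.
by rewrite eseries0// => k _ _; rewrite /hausdorff_gauge eqxx.
Qed.

Let pre_sigma_subadditive e : sigma_subadditive (hausdorff_pre e).
Proof.
move=> A; have [[i ioo]|] := pselect (exists i, hausdorff_pre e (A i) = +oo).
  rewrite (eseries_pinfty _ _ ioo) ?leey// => k _.
  by rewrite -ltNye (lt_le_trans _ (pre_ge0 _ _)).
rewrite -forallNE => Aoo.
suff add2e (c : {posnum R}) : hausdorff_pre e (\bigcup_k A k) <=
    \sum_(i <oo) hausdorff_pre e (A i) + c%:num%:E.
  by apply/lee_addgt0Pr => _/posnumP[].
rewrite (le_trans _ (epsilon_trick _ _ _))//.
pose P k (B : (set 'rV[R]_n)^nat) :=
  (A k `<=` \bigcup_j B j /\ forall j, ediam (B j) <= e%:E) /\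
  \sum_(j <oo) hausdorff_gauge (B j) <=
    hausdorff_pre e (A k) + (c%:num / (2 ^ k.+1)%:R)%:E.
have [G PG] : {G : ((set 'rV[R]_n)^nat)^nat & forall k, P k (G k)}.
  apply: (@choice _ _ P) => k; rewrite /P /hausdorff_pre.
  set S := (X in ereal_inf X); move infS : (ereal_inf S) => iS.
  case: iS infS => [r Sr|Soo|Soo].
  - have en1 : (0 < c%:num / (2 ^ k.+1)%:R)%R by [].
    have /(lb_ereal_inf_adherent en1) : ereal_inf S \is a fin_num by rewrite Sr.
    move=> [x [B mB muBx] xS].
    by exists B; split => //; rewrite muBx -Sr; exact/ltW.
  - by have := Aoo k; rewrite /hausdorff_pre Soo.
  - suff : lbound S 0 by move/le_ereal_inf_tmp; rewrite Soo.
    by move=> /= _ [B _ <-]; exact: nneseries_ge0.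
have muG_ge0 x : 0 <= (hausdorff_gauge \o uncurry G) x by exact: gauge_ge0.
apply: (@le_trans _ _ (\esum_(i in setT) (hausdorff_gauge \o uncurry G) i)).
  apply: ereal_inf_lbound => /=.
  have /card_esym/ppcard_eqP[f] := card_nat2.
  exists (uncurry G \o f).
    split => [|k] /=; last by case: (f k) => p q; exact: (PG p).1.2.
    move=> t [i _] /(PG i).1.1 [j _ Gijt].
    by exists (f^-1%FUN (i, j)) => //=; rewrite invK ?inE.
  rewrite -(esum_pred_image (hausdorff_gauge \o uncurry G) _ xpredT)
    ?[fun=> _]set_true//.
  by rewrite image_eq.
rewrite (_ : esum _ _ =
    \sum_(i <oo) \sum_(j <oo) hausdorff_gauge (G i j)); last first.
  pose J : nat -> set (nat * nat) := fun i => [set (i, j) | j in setT].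
  rewrite (_ : setT = \bigcup_k J k); last first.
    by rewrite predeqE => -[a b]; split => // _; exists a => //; exists b.
  rewrite esum_bigcupT /=; last 2 first.
    - apply/trivIsetP => i j _ _ ij.
      rewrite predeqE => -[p m] /=; split => //= -[] [_] _ [<-{p} _].
      by move=> [m' _] [] /esym/eqP; rewrite (negbTE ij).
    - by move=> /= [p m]; exact: gauge_ge0.
  rewrite -(image_id [set: nat]) -fun_true esum_pred_image//; last first.
    by move=> p _; exact: esum_ge0.
  apply: eq_eseriesr => /= j _.
  rewrite -(esum_pred_image (hausdorff_gauge \o uncurry G) (pair j) predT)//=;
    last by move=> ? ? _ _; exact: (@can_inj _ _ _ snd).
  by congr esum; rewrite predeqE => -[a b]; split; move=> [i _ <-]; exists i.
apply: lee_nneseries => k *; first exact: nneseries_ge0.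
exact: (PG k).2.
Qed.

Let hausdorff0 : hausdorff set0 = 0.
Proof.
apply/eqP; rewrite eq_le; apply/andP; split.
  by apply: ge_ereal_sup => _ [e _ <-]; rewrite pre0.
by apply: ereal_sup_ubound; exists 1%R; rewrite ?pre0//=.
Qed.

Let hausdorff_ge0 A : 0 <= hausdorff A.
Proof.
apply: le_trans (pre_ge0 1 A) _.
by apply: ereal_sup_ubound; exists 1%R => /=.
Qed.

Let le_hausdorff : {homo hausdorff : A B / A `<=` B >-> A <= B}.
Proof.
move=> A B AB; apply: ge_ereal_sup => _ [e e0 <-].
apply: le_trans (le_pre e AB) _.
by apply: ereal_sup_ubound; exists e.
Qed.

Let hausdorff_sigma_subadditive : sigma_subadditive hausdorff.
Proof.
move=> A; apply: ge_ereal_sup => _ [e e0 <-].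
apply: le_trans (pre_sigma_subadditive e A) _.
apply: lee_nneseries => k *; first exact: pre_ge0.
by apply: ereal_sup_ubound; exists e.
Qed.

HB.instance Definition _ := isOuterMeasure.Build R 'rV[R]_n hausdorff
  hausdorff0 hausdorff_ge0 le_hausdorff hausdorff_sigma_subadditive.

End hausdorff.

Definition hausdorff_outer (R : realType) (n s : nat) :
  {outer_measure set 'rV[R]_n -> \bar R} := @hausdorff R n s.

(* A copy of R^n carrying the Caratheodory sigma-algebra of H^s, on which
   H^s is a measure. *)
Definition hausdorff_type (R : realType) (n s : nat) :=
  caratheodory_type (hausdorff_outer R n s).

Definition hausdorff_measure (R : realType) (n s : nat) :
    {measure set (hausdorff_type R n s) -> \bar R} :=
  hausdorff_outer R n s : set (hausdorff_type R n s) -> \bar R.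

Section bounded_deformation.
Context {R : realType} {n : nat}.
Implicit Types (D : set 'rV[R]_n) (u : 'rV[R]_n -> 'rV[R]_n) (x : 'rV[R]_n).

(* [up] is the Lebesgue limit of u at x from the side pointed to by nu. *)
Definition one_sided_limit u x (nu up : 'rV[R]_n) : Prop :=
  (((r ^+ n)^-1)%:E *
    \int[lebesgueD n]_(y in eball x r `&` [set y | 0 < dotv (y - x) nu]%R)
      (enorm (u y - up))%:E)%E @[r --> 0^'+] --> 0%E.

Definition jump_at u x (up um nu : 'rV[R]_n) : Prop :=
  [/\ up != um, enorm nu = 1,
      one_sided_limit u x nu up & one_sided_limit u x (- nu) um].

Definition jump_set D u : set 'rV[R]_n :=
  [set x | D x /\ exists up um nu, jump_at u x up um nu].

Definition sym_tensor (p q : 'rV[R]_n) : 'M[R]_n :=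
  \matrix_(i, j) ((p ord0 i * q ord0 j + p ord0 j * q ord0 i) / 2).

Definition partial (i : 'I_n) (phi : 'rV[R]_n -> R) x : R :=
  'D_(delta_mx ord0 i) phi x.

Definition test_function D (phi : 'rV[R]_n -> R) : Prop :=
  [/\ forall x, differentiable phi x,
      forall i, continuous (partial i phi) &
      exists2 K, compact K /\ K `<=` D & forall x, ~ K x -> phi x = 0].

(* u is in SBD(D) and E is the density of the absolutely continuous part of its
   strain: the distributional symmetrized gradient of u on D is the measure
   E dx + (u^+ - u^-) (.) nu H^(n-1) restricted to J_u, of finite mass.
   The triple (u^+, u^-, nu) is unique on J_u up to (u^-, u^+, -nu), which
   leaves the jump term unchanged. *)
Definition SBD D u (E : 'rV[R]_n -> 'M[R]_n) : Prop :=
  [/\ forall i, (lebesgueD n).-integrable D (fun x => (u x ord0 i)%:E),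
      forall i j, (lebesgueD n).-integrable D (fun x => (E x i j)%:E) &
      exists up um nu : 'rV[R]_n -> 'rV[R]_n,
        let jump i j (x : hausdorff_type R n n.-1) :=
          sym_tensor (up x - um x) (nu x) i j in
        [/\ forall x, jump_set D u x -> jump_at u x (up x) (um x) (nu x),
            forall i j, (hausdorff_measure R n n.-1).-integrable (jump_set D u)
              (fun x => (jump i j x)%:E) &
            forall phi, test_function D phi -> forall i j,
              - (\int[lebesgueD n]_(x in D)
                   ((u x ord0 i * partial j phi x +
                     u x ord0 j * partial i phi x) / 2)) =
              (\int[lebesgueD n]_(x in D) (E x i j * phi x)) +
              (\int[hausdorff_measure R n n.-1]_(x in jump_set D u)
                 (jump i j x * phi x))]].

End bounded_deformation.

Section potential.
Context {R : realType}.
Implicit Types (f J : R -> R).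

(* C^oo on the closed half-line, with one-sided derivatives at 0 *)
Definition smooth_half_line f : Prop :=
  exists g : nat -> R -> R,
    (forall r : R, 0 <= r -> g 0%N r = f r) /\
    (forall (k : nat) (r : R), 0 <= r ->
      (s - r)^-1 * (g k s - g k r) @[s --> within `[0, +oo[ (r^')]
        --> g k.+1 r).

Definition concave_on (A : set R) f : Prop :=
  convex_function (A : set R) (fun r => - f r).

(* [f0'], [finf] and [rbar] stand for f'(0), f_oo and the inflection point;
   only the values of f on the closed half-line are constrained. *)
Record cohesive_potential f (f0' finf rbar : R) : Prop := {
  potential_smooth : smooth_half_line f ;
  potential_gt0 : forall r : R, 0 < r -> 0 < f r ;
  potential_concave : concave_on `[0, +oo[ f ;
  potential0 : f 0 = 0 ;
  potential_slope : f r / r @[r --> 0^'+] --> f0' ;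
  potential_slope_gt0 : 0 < f0' ;
  potential_lim : f r @[r --> +oo] --> finf ;
  potential_inflection_gt0 : 0 < rbar ;
  potential_convex_left :
    convex_function (`[0, rbar]%classic : set R) (fun r => f (r ^+ 2)) ;
  potential_concave_right :
    concave_on `[rbar, +oo[ (fun r => f (r ^+ 2)) }.

Record influence_function J : Prop := {
  influence_measurable : measurable_fun (`[0, +oo[%classic : set R) J ;
  influence_ge0 : forall r : R, 0 <= r -> 0 <= J r ;
  influence_bounded : exists M, forall r : R, 0 <= r -> J r <= M ;
  influence_support : forall r, 1 <= r -> J r = 0 ;
  influence_neq0 : ~ {ae lebesgue_measure, forall r : R, 0 <= r -> J r = 0} }.

End potential.

Definition moment (R : realType) (n : nat) (J : R -> R) : R :=
  \int[lebesgue_measure]_(r in `[0, 1]) (r ^+ n * J r).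

(* The two Lame constants are equal; only n = 2 and n = 3 are meant. *)
Definition lame (R : realType) (n : nat) (f0' : R) (J : R -> R) : R :=
  (if n == 2%N then 4^-1 else 5^-1) * f0' * moment n J.

Definition fracture_toughness (R : realType) (n : nat) (finf : R)
    (J : R -> R) : R :=
  2 * ball_volume R n.-1 / ball_volume R n * finf * moment n J.

Section model.
Context {R : realType} {n : nat}.
Local Notation V := 'rV[R]_n.
Local Notation leb := (lebesgueD n : {measure set V -> \bar R}).
Implicit Types (D : set V) (u v : V -> V) (x y : V) (f J : R -> R).

Definition bounded_domain D : Prop :=
  [/\ open D, connected D & bounded_set D].

Definition boundary_layer D (a : R) : set V :=
  [set x | D x /\ exists2 z, (closure D `\` interior D) z & enorm (x - z) < a].

Definition interior_part D (a : R) : set V := D `\` boundary_layer D a.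

Definition L2norm u : \bar R := Lnorm leb 2%:E (fun x => (enorm (u x))%:E).

(* L^2_0(D; R^n), extended by 0 to R^n; elements are represented by Borel
   functions. *)
Definition L20 D (a : R) u : Prop :=
  [/\ measurable_fun setT u, (L2norm u < +oo)%E &
      {ae leb, forall x, ~ interior_part D a x -> u x = 0}].

Definition L2_continuous (T : R) (w : R -> V -> V) : Prop :=
  forall t : R, 0 <= t <= T ->
    L2norm (fun x => w s x - w t x) @[s --> within `[0, T] (nbhs t)] --> 0%E.

Definition L2_derivative (T : R) (w w' : R -> V -> V) : Prop :=
  forall t : R, 0 <= t <= T ->
    L2norm (fun x => (s - t)^-1 *: (w s x - w t x) - w' t x)
      @[s --> within `[0, T] (t^')] --> 0%E.

Definition C1_L20 D (a T : R) (w : R -> V -> V) : Prop :=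
  exists w' : R -> V -> V,
    [/\ forall t : R, 0 <= t <= T -> L20 D a (w t) /\ L20 D a (w' t),
        L2_derivative T w w' & L2_continuous T w'].

Definition strain u y x : R :=
  dotv ((enorm (y - x))^-1 *: (u y - u x)) ((enorm (y - x))^-1 *: (y - x)).

Definition energy_density f J (eps S : R) (xi : V) : R :=
  eps^-1 * J (enorm xi / eps) * (enorm xi)^-1 * f (enorm xi * S ^+ 2).

Definition gradPD f J (eps : R) u x : V :=
  - (2 / (eps ^+ n * ball_volume R n)) *:
    \row_i \int[leb]_(y in eball x eps)
      (derive1 (fun S => energy_density f J eps S (y - x)) (strain u y x) *
       ((enorm (y - x))^-1 *: (y - x)) ord0 i).

(* The values on D_c are prescribed by [L20]; the equation holds in L^2(D_s). *)
Definition cohesive_evolution D (a : R) f J (rho T eps : R) u0 v0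
    (b u : R -> V -> V) : Prop :=
  exists ut utt : R -> V -> V,
    [/\ forall t : R, 0 <= t <= T ->
          [/\ L20 D a (u t), L20 D a (ut t) & L20 D a (utt t)],
        [/\ L2_derivative T u ut, L2_derivative T ut utt &
            L2_continuous T utt],
        {ae leb, forall x, u 0 x = u0 x},
        {ae leb, forall x, ut 0 x = v0 x} &
        forall t : R, 0 <= t <= T ->
          {ae leb, forall x, interior_part D a x ->
            rho *: utt t x = - gradPD f J eps (u t) x + b t x}].

Definition LEFM D (f0' finf : R) J u (E : V -> 'M[R]_n) : \bar R :=
  (\int[leb]_(x in D)
     (2 * lame n f0' J * (\sum_i \sum_j E x i j ^+ 2) +
      lame n f0' J * `|\tr (E x)| ^+ 2)%:E +
   (fracture_toughness n finf J)%:E * hausdorff n.-1 (jump_set D u))%E.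

Definition ess_bounded u : Prop :=
  exists M, {ae leb, forall x, enorm (u x) <= M}.

Definition LEFM_initial_data D (a f0' finf : R) J u0 v0 : Prop :=
  [/\ L20 D a u0 /\ L20 D a v0, ess_bounded u0 /\ ess_bounded v0 &
      exists2 E, SBD D u0 E & (LEFM D f0' finf J u0 E < +oo)%E].

(* B is meant to be a subset of [eball x eps]. *)
Definition nbhd_prob J (eps : R) x (B : set V) : R :=
  (eps ^+ n * \int[leb]_(xi in eball 0 1) (enorm xi * J (enorm xi)))^-1 *
  \int[leb]_(y in B) (enorm (y - x) / eps * J (enorm (y - x) / eps)).

Definition process_zone D J (eps : R) u (k alpha theta : R) : set V :=
  [set x | D x /\ theta < nbhd_prob J eps x
    [set y | eball x eps y /\
             k * enorm (y - x) `^ (alpha - 1) < `|strain u y x|]].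

End model.

Section centroid_process_zone.
Context {R : realType} {n : nat}.
Local Notation V := 'rV[R]_n.

Definition horizon (k : nat) : R := 2 ^- k.

(* Every horizon under consideration is smaller than half of the thickness a of
   the boundary layer. *)
Definition admissible (a : R) : set nat :=
  [set k | (1 <= k)%N /\ 2 * horizon k < a].

(* [u k] is the displacement with horizon [horizon k], at a fixed time. *)
Definition CPZ (D : set V) (a : R) J (u : nat -> V -> V) (kk alpha theta delta : R) :
    set V :=
  \bigcup_(k in admissible a `&` [set k | horizon k < delta])
    process_zone D J (horizon k) (u k) kk alpha theta.

Definition CPZ0 (D : set V) (a : R) J (u : nat -> V -> V) (kk alpha theta : R) :
    set V :=
  \bigcap_(delta in [set delta | 0 < delta]) CPZ D a J u kk alpha theta delta.

Definition stable_centers (D : set V) (a : R) J (u : nat -> V -> V)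
    (kk alpha theta : R) : set V :=
  [set x | D x /\ exists2 delta, 0 < delta &
    forall k, admissible a k -> horizon k < delta ->
      1 - theta <= nbhd_prob J (horizon k) x
        [set y | eball x (horizon k) y /\
          `|strain (u k) y x| <= kk * enorm (y - x) `^ (alpha - 1)]].

End centroid_process_zone.

(* Main.v *)
(* Initial energy. Testing the distributional strain of u_0 with averages of
   C^{1,1} functions along the segments [x, x + xi] shows that, off the set
   J - [0,1] xi swept by the jump set J, (u_0(x + xi) - u_0(x)).xi is the
   integral of xi.(E u_0)xi along the segment. The swept set is covered by
   countably many small cubes of total measure at most C |xi|; f is bounded on
   it, and f(r) <= f'(0) r elsewhere. Hence PD^eps(u_0) is bounded uniformly
   in eps.
   Energy. Concavity of f gives a one-sided tangent inequality for PD^eps, from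
   which kinetic plus peridynamic energy grows at most exponentially; real
   induction on [0,T] gives a bound independent of t and eps.
   Process zone. Where |S| > k h^(alpha-1), with h = |y - x| <= eps, the energy
   density is at least f(k^2) eps^beta times the density defining P. Chebyshev's
   inequality gives |PZ^eps| <= K eps^(1-beta), which sums geometrically over
   eps = 2^-k. *)
From HB Require Import structures.
Require Import Defs.
From mathcomp Require Import all_boot all_order all_algebra.
From mathcomp Require Import all_classical all_reals all_analysis.
From mathcomp Require Import measurable_realfun ring lra.
Import Order.TTheory GRing.Theory Num.Theory.
Import numFieldNormedType.Exports.
Local Open Scope classical_set_scope.
Local Open Scope ring_scope.

Set Implicit Arguments.
Unset Strict Implicit.
Unset Printing Implicit Defensive.

(** * Lebesgue measure on row vectors *)

Section rV_measure.
Context {R : realType}.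
Implicit Types (n : nat).

(** Write h = |xi|. Across a bond, f is applied to h S^2. The cover of the swept set has volume
    O(h); off it, h S^2 is at most h times a line average of the squared strain density. Both terms
    integrate to O(h), which the factor 1/eps of the energy balances. Test functions are C^1, so
    cubic C^{1,1} steps serve as cutoffs, and averaging them over a segment turns the derivative
    along xi into a finite difference. The jump density lives on a set whose measurability for the
    Hausdorff measure is not established; its integrals are controlled by a measurable minorant with
    the same lower integral, to which dominated convergence applies. The energy is never
    differentiated along the evolution. The tangent inequality leaves a quadratic remainder with a
    constant of order eps^-2; it is multiplied by the square of the time step, so it shortens the
    step but leaves the rate of growth alone. Hence a bound uniform in eps from steps that are not.
    Real induction asks for no lower bound on the steps; its closedness condition comes from
    quasi-subadditivity of the energy. *)

Lemma ball_rVE n (x : 'rV[R]_n) (r : R) : 0 < r ->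
  ball x r = [set y | forall i, `|x ord0 i - y ord0 i| < r].
Proof.
move=> r0; rewrite [LHS]/ball/= /mx_ball; apply/seteqP; split => [y [_ h] i|y h].
  exact: h.
by split => // i j; rewrite ord1; exact: h.
Qed.

Lemma measurable_rV_forall n (P : 'I_n -> set R) : (forall i, measurable (P i)) ->
  measurable [set x : 'rV[R]_n | forall i, P i (x ord0 i)].
Proof.
move=> mP; rewrite (_ : mkset _ =
   \bigcap_(i in [set: 'I_n]) ((fun x : 'rV[R]_n => x ord0 i) @^-1` P i)).
  apply: fin_bigcap_measurable => // i _; rewrite -[X in measurable X]setTI.
  exact: measurable_rV_coord.
by apply/seteqP; split => x /= h i; [move=> _|]; exact: h.
Qed.

Lemma measurable_ball_rV n (x : 'rV[R]_n) (r : R) : 0 < r -> measurable (ball x r).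
Proof.
move=> r0; rewrite ball_rVE//.
rewrite (_ : mkset _ = [set y | forall i, ball (x ord0 i) r (y ord0 i)])//.
apply: (@measurable_rV_forall n (fun i => ball (x ord0 i) r)) => i.
exact: measurable_ball.
Qed.

(** An open set is the union of the balls with rational centre and radius 1/(k+1) that it contains;
    a ball that it does not contain is replaced by [set0], which keeps the index set countable. *)
Lemma open_measurable_rV n (U : set 'rV[R]_n) : open U -> measurable U.
Proof.
move=> oU.
pose F (p : 'rV[rat]_n * nat) : set 'rV[R]_n :=
  let B := ball (\row_i ratr (p.1 ord0 i) : 'rV[R]_n) (p.2.+1%:R^-1) in
  if pselect (B `<=` U) then B else set0.
rewrite (_ : U = \bigcup_p F p).
  apply: countable_bigcupT_measurable; first exact: countableP.
  move=> p; rewrite /F; case: pselect => BU /=; last exact: measurable0.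
  by apply: measurable_ball_rV; rewrite invr_gt0.
apply/seteqP; split => [x Ux|x [p _]]; last first.
  by rewrite /F; case: pselect => //= BU Bx; exact: BU.
have /nbhs_ballP[e /= e0 eU] := open_nbhs_nbhs (conj oU Ux).
have [k ke] : exists k, k.+1%:R^-1 < e / 2.
  have /cvgr_lt := @cvg_harmonic R.
  by move=> /(_ (e / 2) ltac:(rewrite divr_gt0//)) [k _ /(_ k (leqnn k))]; exists k.
have k0 : 0 < k.+1%:R^-1 :> R by rewrite invr_gt0.
have [q qx] : {q : 'I_n -> rat & forall i, `|ratr (q i) - x ord0 i| < k.+1%:R^-1}.
  apply: (@choice _ _ (fun i q => `|ratr q - x ord0 i| < k.+1%:R^-1)) => i.
  have [q] := @rat_in_itvoo R (x ord0 i) (x ord0 i + k.+1%:R^-1) ltac:(rewrite ltrDl//).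
  by rewrite in_itv/= => /andP[? ?]; exists q; rewrite ger0_norm ?subr_ge0 ?ltW// ltrBlDl.
exists (\row_i q i, k) => //; rewrite /F; case: pselect => /=.
  by rewrite ball_rVE// => _ i; rewrite !mxE.
case; apply: subset_trans eU; rewrite !ball_rVE// => y /= h i.
have := h i; have := qx i; rewrite !mxE => h1 h2.
rewrite (_ : _ - _ = - (ratr (q i) - x ord0 i) + (ratr (q i) - y ord0 i)); last by ring.
by rewrite (le_lt_trans (ler_normD _ _))// normrN [ltRHS]splitr ltrD// (lt_trans _ ke).
Qed.

Lemma continuous_measurable_fun_rV n (f : 'rV[R]_n -> R) :
  continuous f -> measurable_fun setT f.
Proof.
move=> cf; apply: measurability; first exact: RGenOpens.measurableE.
move=> _ [A [x [y ->]] <-]; rewrite setTI; apply: open_measurable_rV.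
by apply: open_comp; [move=> z _; exact: cf|exact: interval_open].
Qed.

Lemma integral_lebesgueDS n (f : 'rV[R]_n.+1 -> \bar R) :
  measurable_fun setT f -> (forall x, 0 <= f x)%E ->
  (\int[lebesgueD n.+1]_x f x =
   \int[lebesgue_measure]_t \int[lebesgueD n]_v f (vcons (t, v)))%E.
Proof.
move=> mf f0.
rewrite [LHS](@ge0_integral_pushforward _ _ _ _ R _ (@measurable_vcons R n))//.
rewrite preimage_setT fubini_tonelli1//; last by move=> x; exact: f0.
exact: measurableT_comp mf (@measurable_vcons R n).
Qed.

(** Uniqueness of Lebesgue measure: r times the pushforward under the affine map gives every
    half-open interval its length. *)
Lemma lebesgue_measure_affine (r c : R) : 0 < r ->
  forall A : set R, measurable A ->
  lebesgue_measure ((fun t => r * t + c) @^-1` A) = (r^-1%:E * lebesgue_measure A)%E.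
Proof.
move=> r0.
have r1 : 0 <= r by exact: ltW.
have mphi : measurable_fun [set: measurableTypeR R] (fun t : measurableTypeR R => r * t + c : measurableTypeR R).
  by apply: measurable_funD => //; exact: measurable_funM.
pose mu : {measure set (measurableTypeR R) -> \bar R} :=
  measure_function_pushforward__canonical__measure_function_Measure
    (@lebesgue_measure R) mphi.
have E A : measurable A -> lebesgue_measure A = mscale (NngNum r1) mu A.
  apply: lebesgue_measure_unique => _ [[a b] _ <-]/=.
  rewrite /mscale/= /pushforward.
  rewrite (_ : (fun _ => _) @^-1` _ = `](a - c) / r, (b - c) / r]%classic).
    rewrite !lebesgue_measure_itv/= !lte_fin ltr_pM2r ?invr_gt0// ltrD2r.
    case: ifPn => _; last by rewrite mule0.
    by rewrite -!EFinB -EFinM; congr EFin; field; rewrite gt_eqF.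
  apply/seteqP; split => t /=; rewrite !in_itv/= ltr_pdivrMr// ler_pdivlMr//;
  by rewrite ltrBlDr lerBrDr mulrC.
move=> A mA; rewrite [in RHS]E// /mscale/= muleA -EFinM mulVf ?mul1e// gt_eqF//.
Qed.

Lemma ge0_integral_affine1 (r c : R) (f : R -> \bar R) : 0 < r ->
  measurable_fun setT f -> (forall x, 0 <= f x)%E ->
  (\int[lebesgue_measure]_t f (r * t + c)%R = r^-1%:E * \int[lebesgue_measure]_t f t)%E.
Proof.
move=> r0 mf f0.
have mphi : measurable_fun [set: measurableTypeR R] (fun t : measurableTypeR R => r * t + c : measurableTypeR R).
  by apply: measurable_funD => //; exact: measurable_funM.
have r1 : 0 <= r^-1 by rewrite invr_ge0 ltW.
have := @ge0_integral_pushforward _ _ _ _ R _ mphi (@lebesgue_measure R) setT f measurableT mf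
  (fun x _ => f0 x).
rewrite preimage_setT /comp => <-.
rewrite -(@ge0_integral_mscale _ _ _ (@lebesgue_measure R) setT measurableT (NngNum r1))//.
apply: eq_measure_integral => A mA _ /=.
exact: lebesgue_measure_affine.
Qed.

Lemma vcons_affine n (r : R) (c : 'rV[R]_n.+1) t (v : 'rV[R]_n) :
  r *: vcons (t, v) + c =
  vcons (r * t + (vuncons c).1, r *: v + (vuncons c).2).
Proof.
by apply/rowP => i; rewrite !mxE; case: unliftP => [j ->|->] /=; rewrite ?mxE ?mulr0 // .
Qed.

Lemma measurable_affine_rV n (r : R) (c : 'rV[R]_n) :
  measurable_fun setT (fun x : 'rV[R]_n => r *: x + c).
Proof.
apply/measurable_fun_rVP => i; under eq_fun do rewrite !mxE.
apply: measurable_funD => //; apply: measurable_funM => //; exact: measurable_rV_coord.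
Qed.

(** An affine map of this form acts coordinate by coordinate, so [vcons] splits it into the
    one-dimensional change of variable and the same statement one dimension lower. *)
Lemma ge0_integral_affine n (r : R) (c : 'rV[R]_n) (f : 'rV[R]_n -> \bar R) : 0 < r ->
  measurable_fun setT f -> (forall x, 0 <= f x)%E ->
  (\int[lebesgueD n]_x f (r *: x + c)%R = (r ^- n)%:E * \int[lebesgueD n]_x f x)%E.
Proof.
move=> r0; elim: n c f => [|n IH] c f mf f0.
  rewrite expr0 invr1 mul1e; apply: eq_integral => x _; congr f.
  by apply/rowP => -[].
have mfr : measurable_fun setT (fun x : 'rV[R]_n.+1 => f (r *: x + c)).
  exact: measurableT_comp mf (@measurable_affine_rV _ r c).
rewrite !integral_lebesgueDS//.
have mfv t : measurable_fun setT (fun v => f (vcons (t, v))).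
  apply: measurableT_comp mf _; apply: measurableT_comp (@measurable_vcons R n) _.
  exact: measurable_fun_pair.
under eq_integral => t _.
  under eq_integral => v _ do rewrite vcons_affine.
  rewrite (IH _ (fun v => f (vcons (r * t + (vuncons c).1, v))))//.
  over.
rewrite ge0_integralZl//=; last 3 first.
- apply: (@measurableT_comp _ _ _ _ _ _ (fun s => \int[lebesgueD n]_x f (vcons (s, x)))%E).
    apply: (@measurable_fun_fubini_tonelli_F _ _ _ _ R (lebesgueD n) (f \o @vcons R n)).
      exact: measurableT_comp mf (@measurable_vcons R n).
    by move=> x; exact: f0.
  by apply: measurable_funD => //; exact: measurable_funM.
- by move=> x _; exact: integral_ge0.
- by rewrite lee_fin invr_ge0 exprn_ge0// ltW.
rewrite (ge0_integral_affine1 _ (f := (fun s => \int[lebesgueD n]_x f (vcons (s, x)))%E))//.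
- by rewrite muleA -EFinM exprSr invfM.
- apply: (@measurable_fun_fubini_tonelli_F _ _ _ _ R (lebesgueD n) (f \o @vcons R n)).
    exact: measurableT_comp mf (@measurable_vcons R n).
  by move=> x; exact: f0.
- by move=> x; exact: integral_ge0.
Qed.

Lemma ge0_integral_shift n (c : 'rV[R]_n) (f : 'rV[R]_n -> \bar R) :
  measurable_fun setT f -> (forall x, 0 <= f x)%E ->
  (\int[lebesgueD n]_x f (x + c)%R = \int[lebesgueD n]_x f x)%E.
Proof.
move=> mf f0; have := @ge0_integral_affine n 1 c f ltr01 mf f0.
rewrite expr1n invr1 mul1e => <-; apply: eq_integral => x _.
by rewrite scale1r.
Qed.

Lemma lebesgueD_affine n (r : R) (c : 'rV[R]_n) (A : set 'rV[R]_n) : 0 < r ->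
  measurable A ->
  lebesgueD n ((fun x => r *: x + c) @^-1` A) = ((r ^- n)%:E * lebesgueD n A)%E.
Proof.
move=> r0 mA.
have := @ge0_integral_affine n r c (EFin \o \1_A) r0.
rewrite (_ : \int[lebesgueD n]_x (EFin \o \1_A) x = lebesgueD n A)%E; last first.
  by rewrite /comp integral_indic// setIT.
move=> <-//; last by move=> x; rewrite lee_fin.
  rewrite (_ : (fun x => _) = EFin \o \1_((fun x => r *: x + c) @^-1` A))// /comp integral_indic//.
    by rewrite setIT.
  by rewrite -[X in measurable X]setTI; exact: measurable_affine_rV.
by apply/measurable_EFinP.
Qed.

Lemma lebesgueD_box n (P : 'I_n -> set R) : (forall i, measurable (P i)) ->
  lebesgueD n [set x : 'rV[R]_n | forall i, P i (x ord0 i)] =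
  (\prod_(i < n) lebesgue_measure (P i))%E.
Proof.
elim: n P => [|n IH] P mP.
  rewrite big_ord0 /= diracE mem_set//= => -[]//.
rewrite big_ord_recl -IH//.
rewrite /= /lebesgue_step /= /pushforward.
rewrite -product_measure1E//; last by apply: (@measurable_rV_forall n (fun i => P (lift ord0 i))).
congr (_ _); apply/seteqP; split => -[t v] /=.
  move=> h; split => [|i]; first by have := h ord0; rewrite mxE unlift_none.
  by have := h (lift ord0 i); rewrite mxE liftK.
  by move=> [h1 h2] i; rewrite mxE; case: unliftP => [j ->|->]//=.
exact: mP.
Qed.

Lemma lebesgueD_cube n (x : 'rV[R]_n) (r : R) : 0 < r ->
  lebesgueD n (ball x r) = ((r *+ 2) ^+ n)%:E.
Proof.
move=> r0; rewrite ball_rVE//.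
rewrite (@lebesgueD_box _ (fun i => ball (x ord0 i) r)); last by move=> i; exact: measurable_ball.
under eq_bigr do rewrite lebesgue_measure_ball ?(ltW r0)//.
by rewrite prodEFin prodr_const card_ord.
Qed.

End rV_measure.

(** * Euclidean norm *)

Section euclidean_facts.
Context {R : realType} {n : nat}.
Implicit Types (x y z : 'rV[R]_n) (r : R).

Lemma dotvC x y : dotv x y = dotv y x.
Proof. by apply: eq_bigr => i _; rewrite mulrC. Qed.

Lemma dotvDl x y z : dotv (x + y) z = dotv x z + dotv y z.
Proof. by rewrite -big_split; apply: eq_bigr => i _; rewrite mxE mulrDl. Qed.

Lemma dotvZl r x z : dotv (r *: x) z = r * dotv x z.
Proof. by rewrite mulr_sumr; apply: eq_bigr => i _; rewrite mxE mulrA. Qed.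

Lemma dotvNl x z : dotv (- x) z = - dotv x z.
Proof. by rewrite -scaleN1r dotvZl mulN1r. Qed.

Lemma dotvBl x y z : dotv (x - y) z = dotv x z - dotv y z.
Proof. by rewrite dotvDl dotvNl. Qed.

Lemma dotv0l z : dotv 0 z = 0.
Proof. by rewrite -(scale0r 0) dotvZl mul0r. Qed.

Lemma dotvDr x y z : dotv z (x + y) = dotv z x + dotv z y.
Proof. by rewrite dotvC dotvDl !(dotvC z). Qed.

Lemma dotvZr r x z : dotv z (r *: x) = r * dotv z x.
Proof. by rewrite dotvC dotvZl dotvC. Qed.

Lemma dotvNr x z : dotv z (- x) = - dotv z x.
Proof. by rewrite dotvC dotvNl dotvC. Qed.

Lemma dotvBr x y z : dotv z (x - y) = dotv z x - dotv z y.
Proof. by rewrite dotvDr dotvNr. Qed.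

Lemma dotv0r z : dotv z 0 = 0.
Proof. by rewrite dotvC dotv0l. Qed.

Lemma dotv_ge0 x : 0 <= dotv x x.
Proof. by apply: sumr_ge0 => i _; rewrite -expr2 sqr_ge0. Qed.

Lemma enorm_ge0 x : 0 <= enorm x.
Proof. exact: sqrtr_ge0. Qed.

Lemma enorm_sqr x : enorm x ^+ 2 = dotv x x.
Proof. by rewrite sqr_sqrtr// dotv_ge0. Qed.

Lemma enormZ r x : enorm (r *: x) = `|r| * enorm x.
Proof. by rewrite /enorm dotvZl dotvZr mulrA -expr2 sqrtrM ?sqr_ge0// sqrtr_sqr. Qed.

Lemma enormN x : enorm (- x) = enorm x.
Proof. by rewrite -scaleN1r enormZ normrN1 mul1r. Qed.

Lemma enorm0 : enorm (0 : 'rV[R]_n) = 0.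
Proof. by rewrite /enorm dotv0l sqrtr0. Qed.

Lemma enormBC x y : enorm (x - y) = enorm (y - x).
Proof. by rewrite -enormN opprB. Qed.

Lemma norm_coord_enorm x i : `|x ord0 i| <= enorm x.
Proof.
rewrite -(@ler_pXn2r _ 2)// ?nnegrE ?enorm_ge0// enorm_sqr real_normK ?num_real//.
rewrite /dotv (bigD1 i)//= -expr2 lerDl; apply: sumr_ge0 => j _.
by rewrite -expr2 sqr_ge0.
Qed.

Lemma enorm0_eq0 x : enorm x = 0 -> x = 0.
Proof.
move=> x0; apply/rowP => i; rewrite mxE; apply/eqP; rewrite -normr_le0 -x0.
exact: norm_coord_enorm.
Qed.

Lemma enorm_eq0 x : (enorm x == 0) = (x == 0).
Proof.
by apply/eqP/eqP => [/enorm0_eq0//|->]; rewrite enorm0.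
Qed.

Lemma enorm_gt0 x : (0 < enorm x) = (x != 0).
Proof. by rewrite lt_def enorm_ge0 andbT enorm_eq0. Qed.

Lemma dotv_le_enorm x y : `|dotv x y| <= enorm x * enorm y.
Proof.
have [->|y0] := eqVneq y 0; first by rewrite dotv0r normr0 enorm0 mulr0.
have yy : 0 < dotv y y by rewrite -enorm_sqr exprn_gt0// enorm_gt0.
rewrite -(@ler_pXn2r _ 2)// ?nnegrE ?mulr_ge0 ?enorm_ge0// real_normK ?num_real//.
rewrite exprMn !enorm_sqr.
(* Squared length of the component of x orthogonal to y. *)
have := dotv_ge0 (x - (dotv x y / dotv y y) *: y).
rewrite dotvBl !dotvBr !dotvZl !dotvZr (dotvC y x) => h.
have : 0 <= dotv x x - (dotv x y) ^+ 2 / dotv y y.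
  by apply: le_trans h _; rewrite le_eqVlt; apply/orP; left; apply/eqP; field; rewrite gt_eqF.
by rewrite subr_ge0 ler_pdivrMr.
Qed.

Lemma ler_enormD x y : enorm (x + y) <= enorm x + enorm y.
Proof.
rewrite -(@ler_pXn2r _ 2)// ?nnegrE ?addr_ge0 ?enorm_ge0// sqrrD !enorm_sqr.
rewrite dotvDl !dotvDr (dotvC y x).
have := le_trans (ler_norm _) (dotv_le_enorm x y).
lra.
Qed.

Lemma lerB_enorm x y : `|enorm x - enorm y| <= enorm (x - y).
Proof.
have h (a b : 'rV[R]_n) : enorm a - enorm b <= enorm (a - b).
  by rewrite lerBlDr (le_trans _ (ler_enormD _ _))// subrK.
by rewrite ler_norml h andbT lerNl opprB enormBC h.
Qed.

Lemma enorm_le_sum x : enorm x <= \sum_i `|x ord0 i|.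
Proof.
have s0 : 0 <= \sum_i `|x ord0 i| by exact: sumr_ge0.
rewrite -(@ler_pXn2r _ 2)// ?nnegrE ?enorm_ge0// enorm_sqr expr2 mulr_sumr.
apply: ler_sum => i _; rewrite -expr2 -real_normK ?num_real// expr2.
rewrite ler_wpM2r// (bigD1 i)//= lerDl; exact: sumr_ge0.
Qed.

Lemma enorm_le_cube x r : (forall i, `|x ord0 i| <= r) -> enorm x <= n%:R * r.
Proof.
move=> h; apply: le_trans (enorm_le_sum x) _.
rewrite -[n in n%:R]card_ord -sum1_card natr_sum mulr_suml; apply: ler_sum => i _.
by rewrite mul1r.
Qed.

Lemma continuous_enorm : continuous (enorm : 'rV[R]_n -> R).
Proof.
move=> x U /nbhs_ballP[e /= e0 eU]; apply/nbhs_ballP.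
have e1 : 0 < e / n.+1%:R by rewrite divr_gt0.
exists (e / n.+1%:R) => //= y; rewrite ball_rVE// => /= h; apply: eU => /=.
rewrite /ball/=; apply: le_lt_trans (lerB_enorm _ _) _.
apply: (@le_lt_trans _ _ (n%:R * (e / n.+1%:R))).
  by apply: enorm_le_cube => i; rewrite !mxE ltW.
by rewrite mulrCA gtr_pMr// ltr_pdivrMr// mul1r ltr_nat.
Qed.

Lemma measurable_enorm : measurable_fun setT (enorm : 'rV[R]_n -> R).
Proof. by apply: continuous_measurable_fun_rV; exact: continuous_enorm. Qed.

Lemma measurable_dotv d (T : measurableType d) (f g : T -> 'rV[R]_n) :
  measurable_fun setT f -> measurable_fun setT g ->
  measurable_fun setT (fun t => dotv (f t) (g t)).
Proof.
move=> /measurable_fun_rVP mf /measurable_fun_rVP mg.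
by apply: measurable_sum => i; apply: measurable_funM.
Qed.

Lemma measurable_rVD d (T : measurableType d) (f g : T -> 'rV[R]_n) :
  measurable_fun setT f -> measurable_fun setT g ->
  measurable_fun setT (fun t => f t + g t).
Proof.
move=> /measurable_fun_rVP mf /measurable_fun_rVP mg.
apply/measurable_fun_rVP => i; under eq_fun do rewrite mxE.
exact: measurable_funD.
Qed.

Lemma measurable_rVZ d (T : measurableType d) (f : T -> R) (g : T -> 'rV[R]_n) :
  measurable_fun setT f -> measurable_fun setT g ->
  measurable_fun setT (fun t => f t *: g t).
Proof.
move=> mf /measurable_fun_rVP mg.
apply/measurable_fun_rVP => i; under eq_fun do rewrite mxE.
exact: measurable_funM.
Qed.

Lemma measurable_rVB d (T : measurableType d) (f g : T -> 'rV[R]_n) :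
  measurable_fun setT f -> measurable_fun setT g ->
  measurable_fun setT (fun t => f t - g t).
Proof.
move=> mf mg; apply: measurable_rVD => //.
under eq_fun do rewrite -scaleN1r.
exact: measurable_rVZ.
Qed.

Lemma measurable_eball x r : measurable (eball x r).
Proof.
have mf : measurable_fun setT (fun y => enorm (y - x)).
  apply: (measurableT_comp measurable_enorm); exact: measurable_rVB.
have := mf measurableT `]-oo, r[%classic (measurable_itv _).
by rewrite setTI; congr (measurable _).
Qed.

Lemma ball_sub_eball x r : 0 < r -> ball x r `<=` eball x (n.+1%:R * r).
Proof.
move=> r0 y; rewrite ball_rVE// => /= h; rewrite /eball/= enormBC.
apply: (@le_lt_trans _ _ (n%:R * r)); last by rewrite ltr_pM2r// ltr_nat.
by apply: enorm_le_cube => i; rewrite !mxE ltW.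
Qed.

Lemma eball_sub_ball x r : 0 < r -> eball x r `<=` ball x r.
Proof.
move=> r0 y yr; rewrite ball_rVE// => i /=.
have := norm_coord_enorm (x - y) i; rewrite !mxE => /le_lt_trans; apply.
by rewrite enormBC.
Qed.

Lemma lebesgueD_eball_fin x r : (lebesgueD n (eball x r) < +oo)%E.
Proof.
have [r0|r0] := ltP 0 r; last first.
  rewrite (_ : eball x r = set0) ?measure0// -subset0 => y /= h.
  by have := le_lt_trans (enorm_ge0 _) h; rewrite ltNge r0.
apply: (@le_lt_trans _ _ (lebesgueD n (ball x r))).
  apply: le_measure; rewrite ?inE; [exact: measurable_eball|exact: measurable_ball_rV|].
  exact: eball_sub_ball.
by rewrite lebesgueD_cube// ltry.
Qed.

Lemma ball_volumeE : (ball_volume R n)%:E = lebesgueD n (eball 0 1).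
Proof. by rewrite /ball_volume fineK// ge0_fin_numE// lebesgueD_eball_fin. Qed.

Lemma ball_volume_gt0 : 0 < ball_volume R n.
Proof.
rewrite -lte_fin ball_volumeE.
have r0 : 0 < (n.+1%:R)^-1 :> R by rewrite invr_gt0.
apply: (@lt_le_trans _ _ (lebesgueD n (ball (0 : 'rV[R]_n) n.+1%:R^-1))).
  by rewrite lebesgueD_cube// lte_fin exprn_gt0// mulrn_wgt0.
apply: le_measure; rewrite ?inE; [exact: measurable_ball_rV|exact: measurable_eball|].
apply: subset_trans (ball_sub_eball r0) _.
by rewrite divff.
Qed.

Lemma lebesgueD_eball x r : 0 < r ->
  lebesgueD n (eball x r) = (r ^+ n * ball_volume R n)%:E.
Proof.
move=> r0; rewrite (_ : eball x r = (fun y => r^-1 *: y + (- (r^-1 *: x))) @^-1` eball 0 1).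
  rewrite lebesgueD_affine ?invr_gt0//; last exact: measurable_eball.
  by rewrite EFinM ball_volumeE exprVn invrK.
apply/seteqP; split => y; rewrite /eball/= subr0 -scalerBr enormZ gtr0_norm ?invr_gt0//;
by rewrite mulrC ltr_pdivrMr// mul1r.
Qed.

End euclidean_facts.

(** * Radial integrals *)

Section radial.
Context {R : realType}.
Implicit Types (n : nat) (phi J : R -> R).

Lemma measurable_rV_set1 n (x : 'rV[R]_n) : measurable [set x].
Proof.
rewrite (_ : [set x] = [set y : 'rV[R]_n | forall i, [set x ord0 i] (y ord0 i)]).
  exact: (@measurable_rV_forall _ n (fun i => [set x ord0 i])).
apply/seteqP; split => y /=; first by move=> -> i.
by move=> h; apply/rowP => i; rewrite h.
Qed.

Lemma lebesgueD_set1 n (x : 'rV[R]_n) : (0 < n)%N -> lebesgueD n [set x] = 0%E.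
Proof.
move=> n0; rewrite (_ : [set x] = [set y : 'rV[R]_n | forall i, [set x ord0 i] (y ord0 i)]).
  rewrite (@lebesgueD_box _ n (fun i => [set x ord0 i]))//.
  case: n n0 x => // n _ x; rewrite big_ord_recl.
  by rewrite lebesgue_measure_set1 mul0e.
apply/seteqP; split => y /=; first by move=> -> i.
by move=> h; apply/rowP => i; rewrite h.
Qed.

(** A substitute for polar coordinates. The function phi(t |v|) of (t, v), with t > 0, is integrated
    in both orders: over v each slice is t^-n times the given zero integral, over t it is the
    one-dimensional integral divided by |v|. Tonelli's theorem forces the latter to vanish. *)
Lemma ge0_integral_radial_eq0 n phi : (0 < n)%N -> measurable_fun setT phi ->
  (forall r, 0 <= phi r) -> (forall r, r <= 0 -> phi r = 0) ->
  (\int[lebesgueD n]_x (phi (enorm x))%:E = 0)%E ->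
  (\int[lebesgue_measure]_r (phi r)%:E = 0)%E.
Proof.
move=> n0 mphi phi0 phiN int0.
pose f (p : measurableTypeR R * 'rV[R]_n) : \bar R :=
  ((if 0 < p.1 then phi (p.1 * enorm p.2) else 0)%:E).
have mf : measurable_fun setT f.
  apply/measurable_EFinP; apply: measurable_fun_ifT => //.
    by apply: measurable_fun_ltr => //; exact: measurable_fst.
  apply: measurableT_comp mphi _; apply: measurable_funM; first exact: measurable_fst.
  exact: measurableT_comp measurable_enorm measurable_snd.
have f0 x : (0 <= f x)%E by rewrite lee_fin /=; case: ifP.
have menorm : measurable_fun setT (fun x : 'rV[R]_n => (phi (enorm x))%:E).
  apply/measurable_EFinP; exact: measurableT_comp mphi measurable_enorm.
have E1 : (\int[lebesgue_measure]_t \int[lebesgueD n]_v f (t, v) = 0)%E.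
  apply: integral0_eq => t _; rewrite /f/=; case: (ltP 0 t) => t0; last by rewrite integral0_eq.
  have := @ge0_integral_affine R n t 0 (fun x => (phi (enorm x))%:E) t0 menorm.
  rewrite int0 mule0 => <-//; last by move=> x; rewrite lee_fin.
  by apply: eq_integral => v _; rewrite addr0 enormZ gtr0_norm.
rewrite (@fubini_tonelli _ _ _ _ R lebesgue_measure (lebesgueD n) f mf f0) in E1.
pose c : \bar R := (\int[lebesgue_measure]_r (phi r)%:E)%E; rewrite -/c.
have c0 : (0 <= c)%E by apply: integral_ge0 => ? _; rewrite lee_fin.
apply/eqP/negPn/negP => cn0.
have mphiE : measurable_fun setT (fun r : R => (phi r)%:E) by exact/measurable_EFinP.
have E2 (v : 'rV[R]_n) : v != 0 ->
    (\int[lebesgue_measure]_t f (t, v) = (enorm v)^-1%:E * c)%E.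
  move=> v0; have ev : 0 < enorm v by rewrite enorm_gt0.
  rewrite -(ge0_integral_affine1 0 ev mphiE).
    apply: eq_integral => t _; rewrite /f/= addr0 mulrC; case: ltP => // t0.
    by rewrite phiN// mulr_ge0_le0// ltW.
  by move=> r; rewrite lee_fin.
have mB : measurable (eball (0 : 'rV[R]_n) 1 `\ 0).
  by apply: measurableD; [exact: measurable_eball|exact: measurable_rV_set1].
(* On the punctured unit ball 1/|v| >= 1, so the double integral is at least c times a positive
   volume. *)
have : (0 < \int[lebesgueD n]_v \int[lebesgue_measure]_t f (t, v))%E.
  have h1 : (0 < \int[lebesgueD n]_(v in eball 0%R 1 `\ 0%R) c)%E.
    rewrite integral_cst//; apply: mule_gt0; first by rewrite lt0e cn0.
    have : (0 < lebesgueD n (eball (0 : 'rV[R]_n) 1))%E.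
      by rewrite -ball_volumeE lte_fin ball_volume_gt0.
    move/lt_le_trans; apply; rewrite -[leRHS]adde0 -(lebesgueD_set1 0 n0).
    apply: le_trans (measureU2 _ mB (measurable_rV_set1 0)).
    apply: le_measure; rewrite ?inE; first exact: measurable_eball.
      by apply: measurableU => //; exact: measurable_rV_set1.
    by move=> v v1; have [->|v0] := eqVneq v 0; [right|left; split => //; exact/eqP].
  apply: (lt_le_trans h1).
  apply: (@le_trans _ _ (\int[lebesgueD n]_(v in eball 0%R 1 `\ 0%R) \int[lebesgue_measure]_t f (t, v))%E).
    apply: ge0_le_integral => //.
    - by apply: measurable_funS (@measurable_fun_fubini_tonelli_G _ _ _ _ R lebesgue_measure f mf f0).
    - move=> v [v1 /eqP v0]; rewrite E2// -[leLHS]mul1e; apply: lee_wpmul2r => //.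
      rewrite lee_fin -invr1 lef_pV2 ?posrE ?enorm_gt0 ?ltr01//.
      by move: v1; rewrite /eball/= subr0 => /ltW.
  apply: ge0_subset_integral => //.
  - exact: (@measurable_fun_fubini_tonelli_G _ _ _ _ R lebesgue_measure f mf f0).
  - by move=> v _; exact: integral_ge0.
by rewrite E1 ltxx.
Qed.


Lemma nneseries_geometric (a z : R) : 0 <= a -> 0 <= z < 1 ->
  (\sum_(k <oo) (a * z ^+ k)%:E = (a / (1 - z))%:E)%E.
Proof.
move=> a0 /andP[z0 z1]; apply/cvg_lim => //.
under eq_fun do rewrite sumEFin.
apply: cvg_EFin; first exact: nearW.
by apply: cvg_geometric_series; rewrite ger0_norm.
Qed.

(** On the shell where |x| lies between e/2^(k+1) and e/2^k, the value 1/|x| is at most 2^(k+1)/e.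
    The balls of radius e/2^k have volume proportional to 2^(-kn), so for n >= 2 the majorant sums
    like a geometric series of ratio 1/2. *)
Lemma integral_inv_enorm_fin n (e : R) : (1 < n)%N -> 0 < e ->
  (\int[lebesgueD n]_(x in eball 0%R e) ((enorm x)^-1)%:E < +oo)%E.
Proof.
move=> n1 e0.
pose g k (x : 'rV[R]_n) : \bar R :=
  ((2 ^+ k.+1 / e) * \1_(eball 0 (e / 2 ^+ k)) x)%:E.
have mg k : measurable_fun setT (g k).
  by apply/measurable_EFinP; apply: measurable_funM => //; apply: measurable_indic; exact: measurable_eball.
have g0 k x : (0 <= g k x)%E.
  by rewrite lee_fin mulr_ge0// divr_ge0// ltW.
have mS : measurable_fun setT (fun x => \sum_(k <oo) g k x)%E.
  by apply: ge0_emeasurable_sum.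
apply: (@le_lt_trans _ _ (\int[lebesgueD n]_x \sum_(k <oo) g k x)%E); last first.
  rewrite integral_nneseries//.
  have ek (k : nat) : 0 < e / 2 ^+ k by rewrite divr_gt0// exprn_gt0.
  apply: (@le_lt_trans _ _ (\sum_(k <oo) (2 * e ^+ n.-1 * ball_volume R n * (1/2) ^+ k)%:E)%E).
    apply: lee_nneseries => [k _ _|k _]; first exact: integral_ge0.
    rewrite /g; under eq_integral do rewrite EFinM.
    rewrite ge0_integralZl//; last 2 first.
    - by apply/measurable_EFinP; apply: measurable_indic; exact: measurable_eball.
    - by rewrite lee_fin divr_ge0// ltW.
    rewrite integral_indic//; last exact: measurable_eball.
    rewrite setIT [X in (_ * X)%E]lebesgueD_eball// -EFinM lee_fin.
    have v0 : 0 <= ball_volume R n by rewrite ltW// ball_volume_gt0.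
    rewrite mulrA [leRHS]mulrAC ler_wpM2r//.
    have -> : (e / 2 ^+ k) ^+ n = e / 2 ^+ k * (e / 2 ^+ k) ^+ n.-1.
      by rewrite -exprS prednK// ltnW.
    rewrite mulrA (_ : 2 ^+ k.+1 / e * (e / 2 ^+ k) = 2); last first.
      by rewrite exprS; field; rewrite gt_eqF//= ?gt_eqF// exprn_gt0.
    rewrite exprMn mulrA ler_wpM2l// ?mulr_ge0// ?exprn_ge0 ?(ltW e0)//.
    rewrite mul1r -[X in X ^+ n.-1]exprVn -exprM; apply: ler_wiXn2l; rewrite ?invr_ge0// ?invf_le1// ?ler1n//.
    by rewrite leq_pmulr// -ltnS prednK// ltnW.
  by rewrite nneseries_geometric ?ltry ?mulr_ge0 ?exprn_ge0 ?ltW ?ball_volume_gt0//; lra.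
rewrite [leLHS]integral_mkcond; apply: ge0_le_integral => //.
- by move=> x _; rewrite erestrict_ge0// => y _; rewrite lee_fin invr_ge0 enorm_ge0.
- apply/(measurable_restrictT _ _).1; first exact: measurable_eball.
  apply: measurable_funTS; apply/measurable_EFinP.
  under eq_fun do rewrite -powR_inv1 ?enorm_ge0//.
  exact: measurableT_comp (measurable_powR _) measurable_enorm.
- move=> x _; rewrite patchE; case: ifPn => [|_]; last exact: nneseries_ge0.
  rewrite inE /eball/= subr0 => xe.
  have [->|x0] := eqVneq x 0; first by rewrite enorm0 invr0 nneseries_ge0.
  have ex0 : 0 < enorm x by rewrite enorm_gt0.
  have exk : exists k, e / 2 ^+ k.+1 <= enorm x.
    have [k] : exists k : nat, e / enorm x < k%:R.
      by exists (Num.bound (e / enorm x)); apply: archi_boundP; rewrite divr_ge0// ltW.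
    rewrite ltr_pdivrMr// => ke; exists k.
    rewrite ler_pdivrMr ?exprn_gt0// (le_trans (ltW ke))// mulrC ler_wpM2l ?ltW//.
    by rewrite -natrX ltr_nat (leq_trans (ltn_expl k (isT : (1 < 2)%N)))// leq_exp2l.
  have [k ke kmin] := ex_minnP exk.
  have xk : enorm x < e / 2 ^+ k.
    case: k ke kmin => [|k] ke kmin; first by rewrite expr0 divr1.
    by rewrite ltNge; apply/negP => /kmin; rewrite ltnn.
  apply: (@le_trans _ _ (g k x)); last first.
    rewrite (@nneseriesD1 _ (g ^~ x) k xpredT)//.
    by rewrite leeDl// nneseries_ge0.
  rewrite /g indicE mem_set/=; last by rewrite /eball/= subr0.
  rewrite mulr1 lee_fin -[leRHS]invrK lef_pV2 ?posrE ?invr_gt0 ?divr_gt0 ?exprn_gt0//.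
  by rewrite invf_div.
Qed.

End radial.

(** * Lower integrals *)

Section kernel_of_lower_integral.
Local Open Scope ereal_scope.
Context d (T : measurableType d) (R : realType).
Variable mu : {measure set T -> \bar R}.
Import HBNNSimple.

(* No measurability is assumed: for nonmeasurable functions the integral is
   the lower integral. *)
Lemma le_lower_integral (f g : T -> \bar R) :
  (forall x, 0 <= f x) -> (forall x, f x <= g x) ->
  \int[mu]_x f x <= \int[mu]_x g x.
Proof.
move=> f0 fg; have g0 x : 0 <= g x by exact: le_trans (fg x).
rewrite !ge0_integralTE//; apply: le_ereal_sup => _ [h hf <-].
by exists h => // x; exact: le_trans (fg x).
Qed.

Lemma integral_nnsfunT (h : {nnsfun T >-> R}) : \int[mu]_x (h x)%:E = sintegral mu h.
Proof. by rewrite integral_nnsfun// patch_setT. Qed.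

(** Meant for the jump density on [jump_set], where only a finite integral is at hand. The lower
    integral of |f| on D is a supremum over simple functions; the pointwise supremum m of a
    maximizing sequence is measurable, lies below |f| and has the same integral. Such an m also
    controls the integral of |f| against any measurable weight with values in [0, 1]. *)
Lemma lower_integral_kernel (D : set T) (f : T -> R) :
  \int[mu]_(x in D) `|(f x)%:E| < +oo ->
  exists m : T -> R, [/\ measurable_fun setT m, (forall x, 0 <= m x)%R,
    (forall x, ~ D x -> m x = 0%R), \int[mu]_x (m x)%:E < +oo &
    forall phi : T -> R, measurable_fun setT phi -> (forall x, `|phi x| <= 1)%R ->
      `|fine (\int[mu]_(x in D) (f x * phi x)%:E)|%:E <=
        \int[mu]_x (m x * `|phi x|)%:E].
Proof.
move=> foo.
pose G x : R := if x \in D then `|f x|%R else 0%R.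
have G0 x : (0 <= G x)%R by rewrite /G; case: ifP.
have GE : \int[mu]_(x in D) `|(f x)%:E| = \int[mu]_x (G x)%:E.
  rewrite integral_mkcond; apply: eq_integral => x _.
  by rewrite patchE /G; case: ifP.
have Ifin : \int[mu]_x (G x)%:E \is a fin_num.
  by rewrite -GE ge0_fin_numE// integral_ge0.
have [h hP] : {h : nat -> {nnsfun T >-> R} & forall k, (forall x, (h k x <= G x)%R) /\
    \int[mu]_x (G x)%:E - (k.+1%:R^-1)%:E <= sintegral mu (h k)}.
  apply: (@choice _ _ (fun k (h : {nnsfun T >-> R}) => (forall x, (h x <= G x)%R) /\
    \int[mu]_x (G x)%:E - (k.+1%:R^-1)%:E <= sintegral mu h)) => k.
  have k0 : (0 < k.+1%:R^-1 :> R)%R by rewrite invr_gt0.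
  move: (Ifin); rewrite ge0_integralTE//.
  move=> Ifin'; have [_ [h hG <-] hk] := ub_ereal_sup_adherent k0 Ifin'.
  by exists h; split; [move=> x; rewrite -lee_fin; exact: hG|exact: ltW].
pose M x : \bar R := ereal_sup (range (fun k => (h k x)%:E)).
have MG x : M x <= (G x)%:E.
  by apply: ge_ereal_sup => _ [k _ <-]; rewrite lee_fin; exact: (hP k).1.
have hM k x : (h k x)%:E <= M x by apply: ereal_sup_ubound; exists k.
have M0 x : 0 <= M x by apply: le_trans (hM 0%N x); rewrite lee_fin.
have Mfin x : M x \is a fin_num.
  by rewrite ge0_fin_numE// (le_lt_trans (MG x))// ltry.
have mM : measurable_fun setT M.
  rewrite (_ : M = (fun x => esups (fun k => (h k x)%:E) 0%N)).
    by apply: measurable_fun_esups => k; apply/measurable_EFinP.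
  by apply/funext => x; rewrite /M /esups /sdrop; congr ereal_sup;
    apply/seteqP; split => [_ [k _ <-]|_ [k _ <-]]; exists k.
pose m x := fine (M x).
have mE x : (m x)%:E = M x by rewrite fineK.
have m0 x : (0 <= m x)%R by rewrite fine_ge0.
have mm : measurable_fun setT m by exact: measurableT_comp.
have mG x : (m x <= G x)%R by rewrite -lee_fin mE.
have IM : \int[mu]_x (m x)%:E = \int[mu]_x (G x)%:E.
  apply/eqP; rewrite eq_le; apply/andP; split.
    by apply: le_lower_integral => x; rewrite lee_fin.
  apply/lee_addgt0Pr => e e0.
  have [k ke] : exists k, (k.+1%:R^-1 < e :> R)%R.
    have /cvgr_lt := @cvg_harmonic R.
    by move=> /(_ e e0) [k _ /(_ k (leqnn k))]; exists k.
  rewrite -leeBlDr//.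
  apply: le_trans (_ : \int[mu]_x (G x)%:E - (k.+1%:R^-1)%:E <= _).
    by rewrite leeD2l// leeN2 lee_fin ltW.
  apply: le_trans (hP k).2 _; rewrite -integral_nnsfunT.
  by apply: le_lower_integral => x; rewrite ?mE// lee_fin.
have mphiM (psi : T -> R) : measurable_fun setT psi -> (forall x, 0 <= psi x <= 1)%R ->
    \int[mu]_x (G x * psi x)%:E <= \int[mu]_x (m x * psi x)%:E.
  move=> mpsi psi01.
  have psi0 x : (0 <= psi x)%R by case/andP: (psi01 x).
  have psi1 x : (0 <= 1 - psi x)%R by rewrite subr_ge0; case/andP: (psi01 x).
  have mm1 : measurable_fun setT (fun x => (m x * (1 - psi x))%:E).
    apply/measurable_EFinP; apply: measurable_funM => //; exact: measurable_funB.
  have mm2 : measurable_fun setT (fun x => (m x * psi x)%:E).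
    by apply/measurable_EFinP; apply: measurable_funM.
  have Isplit : \int[mu]_x (G x)%:E =
      \int[mu]_x (m x * psi x)%:E + \int[mu]_x (m x * (1 - psi x))%:E.
    rewrite -IM -ge0_integralD//; last 2 first.
    - by move=> x _; rewrite lee_fin mulr_ge0.
    - by move=> x _; rewrite lee_fin mulr_ge0.
    by apply: eq_integral => x _; rewrite -EFinD -mulrDr subrKC mulr1.
  have fin1 : \int[mu]_x (m x * (1 - psi x))%:E \is a fin_num.
    rewrite ge0_fin_numE; last by apply: integral_ge0 => x _; rewrite lee_fin mulr_ge0.
    apply: (@le_lt_trans _ _ (\int[mu]_x (m x)%:E)).
      apply: le_lower_integral => x; rewrite lee_fin ?mulr_ge0//.
      by rewrite ler_piMr// gerBl.
    by rewrite IM -GE.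
  rewrite ge0_integralTE; last by move=> x; rewrite lee_fin mulr_ge0.
  (* If s is simple and s <= G psi, then s + m (1 - psi) <= G. Integrating and cancelling the finite
     integral of m (1 - psi) leaves the integral of s below that of m psi. *)
  apply: ge_ereal_sup => _ [s sG <-]; rewrite -integral_nnsfunT.
  rewrite -(leeD2rE _ _ fin1) -Isplit -ge0_integralD//; last 3 first.
  - by move=> x _; rewrite lee_fin.
  - by apply/measurable_EFinP.
  - by move=> x _; rewrite lee_fin mulr_ge0.
  apply: le_lower_integral => x; rewrite -EFinD lee_fin ?addr_ge0 ?mulr_ge0//.
  have := sG x; rewrite lee_fin => h1.
  have h2 : (m x * (1 - psi x) <= G x * (1 - psi x))%R by rewrite ler_wpM2r.
  lra.
exists m; split => //.
- move=> x Dx; apply/eqP; rewrite eq_le m0 andbT (le_trans (mG x))// /G.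
  by rewrite memNset.
- by rewrite IM -GE.
- move=> phi mphi phi1.
  have mabs : measurable_fun setT (fun x => `|phi x|%R) by exact: measurableT_comp.
  set B := \int[mu]_x _.
  have B0 : 0 <= B by apply: integral_ge0 => x _; rewrite lee_fin mulr_ge0.
  have Bfin : B \is a fin_num.
    rewrite ge0_fin_numE//; apply: (@le_lt_trans _ _ (\int[mu]_x (m x)%:E)).
      apply: le_lower_integral => x; rewrite lee_fin ?mulr_ge0//.
      by rewrite ler_piMr.
    by rewrite IM -GE.
  have PB : \int[mu]_x (G x * `|phi x|)%:E <= B by apply: mphiM => // x; rewrite normr_ge0 phi1.
  rewrite integral_mkcond integralE.
  set g := (_ \_ D).
  have gG x : `|g x| <= (G x * `|phi x|)%:E.
    rewrite /g patchE /G; case: ifP => _; first by rewrite abse_EFin normrM.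
    by rewrite -[point]/(0%E) abse0 mul0r.
  have gp : \int[mu]_x (g^\+ x) <= B.
    apply: le_trans PB; apply: le_lower_integral => x; first exact: funepos_ge0.
    by apply: le_trans (gG x); rewrite funepos.unlock ge_max lee_abs abse_ge0.
  have gn : \int[mu]_x (g^\- x) <= B.
    apply: le_trans PB; apply: le_lower_integral => x; first exact: funeneg_ge0.
    by apply: le_trans (gG x); rewrite funeneg.unlock ge_max -{1}abseN lee_abs abse_ge0.
  have gp0 : 0 <= \int[mu]_x (g^\+ x) by apply: integral_ge0.
  have gn0 : 0 <= \int[mu]_x (g^\- x) by apply: integral_ge0.
  move: gp gn gp0 gn0 B0 Bfin; clear PB.
  move: (\int[mu]_x (g^\+ x)) (\int[mu]_x (g^\- x)) B => [a| |] [b| |] [c| |]//.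
  rewrite !lee_fin/= => ac bc a0 b0 _ _.
  by rewrite ler_norml; apply/andP; split; lra.
Qed.

End kernel_of_lower_integral.

(** * Hausdorff measure *)

Lemma cvge0_near (R : realType) (T : Type) (F : set_system T) (u : T -> \bar R) :
  u @ F --> 0%E -> forall e : R, 0 < e -> \forall x \near F, (u x < e%:E)%E.
Proof.
move=> uF e e0; apply: (uF [set y | (y < e%:E)%E]).
by apply: open_nbhs_nbhs; split; [exact: open_ereal_lt_ereal|rewrite /= lte_fin].
Qed.

Section hausdorff_metric.
Local Open Scope ereal_scope.
Context {R : realType} {n : nat} (s : nat).
Implicit Types (A B X : set 'rV[R]_n) (e : R).
Local Notation H := (@hausdorff R n s).

Lemma ediam_ub A x y : A x -> A y -> (enorm (x - y))%:E <= ediam A.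
Proof. by move=> Ax Ay; apply: ereal_sup_ubound; exists x => //; exists y. Qed.

Lemma hausdorff_gauge_ge0 A : 0 <= hausdorff_gauge s A.
Proof.
rewrite /hausdorff_gauge; case: eqP => // /eqP/set0P[x Ax].
rewrite lee_fin mulr_ge0//; first exact/ltW/ball_volume_gt0.
rewrite exprn_ge0// divr_ge0// fine_ge0//.
by apply: le_trans (ediam_ub Ax Ax); rewrite lee_fin enorm_ge0.
Qed.

Lemma hausdorff_gauge0 : hausdorff_gauge s (set0 : set 'rV[R]_n) = 0.
Proof. by rewrite /hausdorff_gauge eqxx. Qed.

Lemma hausdorff_pre_anti e1 e2 A : (e1 <= e2)%R ->
  hausdorff_pre s e2 A <= hausdorff_pre s e1 A.
Proof.
move=> e12; apply: ereal_inf_le_tmp => _ [F [AF Fe] <-]; exists F => //; split => // k.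
by apply: le_trans (Fe k) _; rewrite lee_fin.
Qed.

Lemma hausdorff_pre_le e A : (0 < e)%R -> hausdorff_pre s e A <= H A.
Proof. by move=> e0; apply: ereal_sup_ubound; exists e. Qed.

Lemma ediam_set0 : ediam (set0 : set 'rV[R]_n) = -oo.
Proof.
rewrite /ediam (_ : [set _ | _ in _ & _ in _] = set0) ?ereal_sup0//.
by apply/seteqP; split => // y [? []].
Qed.

(** No set of diameter at most e meets both A and B. A covering of the union therefore splits into
    the members that meet A and those that meet B, the others being emptied. *)
Lemma hausdorff_pre_metric e A B : (forall x y, A x -> B y -> (e < enorm (x - y))%R) ->
  hausdorff_pre s e A + hausdorff_pre s e B <= hausdorff_pre s e (A `|` B).
Proof.
move=> AB; apply: le_ereal_inf_tmp => _ [F [ABF Fe] <-].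
pose FF C k := if pselect (F k `&` C !=set0) then F k else set0.
have FFe C k : ediam (FF C k) <= e%:E.
  by rewrite /FF; case: pselect => _ //=; rewrite ediam_set0 leNye.
have CFF C : C `<=` A `|` B -> C `<=` \bigcup_k FF C k.
  move=> CAB x Cx; have [k _ Fx] := ABF x (CAB x Cx).
  by exists k => //; rewrite /FF; case: pselect => //=; case; exists x.
apply: (@le_trans _ _ (\sum_(k <oo) hausdorff_gauge s (FF A k) + \sum_(k <oo) hausdorff_gauge s (FF B k))).
  apply: leeD; apply: ereal_inf_lbound.
    by exists (FF A) => //; split => //; apply: CFF => x; left.
  by exists (FF B) => //; split => //; apply: CFF => x; right.
rewrite -nneseriesD//; last 2 first.
- by move=> k _ _; exact: hausdorff_gauge_ge0.
- by move=> k _ _; exact: hausdorff_gauge_ge0.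
apply: lee_nneseries => [k _ _|k _]; first by rewrite adde_ge0// hausdorff_gauge_ge0.
rewrite /FF; case: pselect => [[x [Fx Ax]]|_]/=; case: pselect => [[y [Fy By]]|_]/=.
- have := AB _ _ Ax By; rewrite ltNge -lee_fin.
  by rewrite (le_trans (ediam_ub Fx Fy) (Fe k)).
- by rewrite hausdorff_gauge0 adde0.
- by rewrite hausdorff_gauge0 add0e.
- by rewrite hausdorff_gauge0 add0e hausdorff_gauge_ge0.
Qed.

(** The metric property of the outer measure. The scales of the two suprema are lowered to a common
    one; halving e there gives the strict separation that the premeasure asks for. *)
Lemma hausdorff_metric e A B : (0 < e)%R ->
  (forall x y, A x -> B y -> (e <= enorm (x - y))%R) ->
  H A + H B <= H (A `|` B).
Proof.
move=> e0 AB.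
have [HABoo|HABfin] := eqVneq (H (A `|` B)) +oo; first by rewrite HABoo leey.
have H0 X : 0 <= H X by exact: (outer_measure_ge0 (hausdorff_outer R n s)).
have Hle X Y : X `<=` Y -> H X <= H Y by exact: (le_outer_measure (hausdorff_outer R n s)).
have fin X : X `<=` A `|` B -> H X \is a fin_num.
  by move=> XAB; rewrite ge0_fin_numE// (le_lt_trans (Hle _ _ XAB))// ltey.
have pre e1 e2 : (0 < e1)%R -> (0 < e2)%R ->
    hausdorff_pre s e1 A + hausdorff_pre s e2 B <= H (A `|` B).
  move=> e10 e20; pose e3 := Order.min (e / 2)%R (Order.min e1 e2).
  have e30 : (0 < e3)%R by rewrite !lt_min e10 e20 divr_gt0.
  apply: le_trans (hausdorff_pre_le _ e30).
  apply: le_trans (@hausdorff_pre_metric e3 A B _); last first.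
    move=> x y Ax By; apply: lt_le_trans (AB _ _ Ax By).
    by rewrite gt_min ltr_pdivrMr// ltr_pMr// ltr1n.
  by apply: leeD; apply: hausdorff_pre_anti; rewrite !ge_min lexx ?orbT.
rewrite -leeBrDr; last by apply: fin => x; right.
apply: ge_ereal_sup => _ [e1 /= e10 <-].
rewrite leeBrDr; last by apply: fin => x; right.
have pfin : hausdorff_pre s e1 A \is a fin_num.
  rewrite ge0_fin_numE.
    by rewrite (le_lt_trans (hausdorff_pre_le _ e10))// -ge0_fin_numE// fin// => x; left.
  by apply: le_ereal_inf_tmp => _ [F _ <-]; apply: nneseries_ge0 => *; exact: hausdorff_gauge_ge0.
rewrite addeC -leeBrDr//; apply: ge_ereal_sup => _ [e2 /= e20 <-].
by rewrite leeBrDr// addeC pre.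
Qed.

(** Caratheodory's criterion for a metric outer measure, on a half-space L. The complement is cut
    into the shells P k that accumulate at the boundary hyperplane. Shells with indices of equal
    parity are separated, so the shells in X have summable measure and the tails are negligible;
    what lies beyond the tail is at positive distance from L. *)
Lemma caratheodory_le_coord (i : 'I_n) (c : R) :
  (hausdorff_outer R n s).-caratheodory [set x : 'rV[R]_n | (x ord0 i <= c)%R].
Proof.
pose L : set 'rV[R]_n := [set x : 'rV[R]_n | (x ord0 i <= c)%R].
rewrite -/L; apply: le_caratheodory_measurable => X.
suff : H (X `&` L) + H (X `&` ~` L) <= H X by [].
have H0 Y : 0 <= H Y by exact: (outer_measure_ge0 (hausdorff_outer R n s)).
have Hle Y Z : Y `<=` Z -> H Y <= H Z by exact: (le_outer_measure (hausdorff_outer R n s)).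
have [->|HXfin] := eqVneq (H X) +oo; first by rewrite leey.
have Xfin : H X \is a fin_num by rewrite ge0_fin_numE// ltey.
pose a k : R := (c + k.+1%:R^-1)%R.
have aS j k : (j < k)%N -> (a k < a j)%R.
  by move=> jk; rewrite /a ltrD2l ltf_pV2 ?posrE// ltr_nat.
have ac k : (c < a k)%R by rewrite ltrDl invr_gt0.
pose A k := X `&` [set x : 'rV[R]_n | (a k <= x ord0 i)%R].
pose P k := X `&` [set x : 'rV[R]_n | (a k.+1 <= x ord0 i < a k)%R].
have sep j k (Y Z : set 'rV[R]_n) : (j < k)%N -> Y `<=` [set x : 'rV[R]_n | (a j <= x ord0 i)%R] ->
    Z `<=` [set x : 'rV[R]_n | (x ord0 i < a k)%R] -> H Y + H Z <= H (Y `|` Z).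
  move=> jk Yj Zk; apply: (@hausdorff_metric (a j - a k)%R).
    by rewrite subr_gt0 aS.
  move=> x y /Yj/= xj /Zk/= yk; apply: le_trans (norm_coord_enorm _ i).
  rewrite !mxE; apply: le_trans (ler_norm _); lra.
(* The offset q = 0 or 1 selects the parity: between two consecutive shells of the sum lies one that
   is skipped, and its width separates them. *)
have sums q N : \sum_(j < N) H (P (j.*2 + q).+1) <= H (A (N.*2 + q)%N).
  elim: N => [|N IH]; first by rewrite big_ord0.
  rewrite big_ord_recr/=; apply: le_trans (leeD2r _ IH) _.
  apply: le_trans (@sep (N.*2 + q)%N (N.*2 + q).+1 _ _ _ _ _) _ => //.
  - by move=> x [].
  - by move=> x [_ /andP[]].
  - apply: Hle => x [[Xx /= xa]|[Xx /= /andP[xa _]]]; split => //=.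
    by rewrite doubleS !addSn (le_trans _ xa)// ltW// aS// ltnW.
have sumD N : \sum_(j < N.*2) H (P j.+1) =
    \sum_(j < N) H (P (j.*2 + 0).+1) + \sum_(j < N) H (P (j.*2 + 1).+1).
  elim: N => [|N IH]; first by rewrite !big_ord0 adde0.
  rewrite doubleS !big_ord_recr/= IH addn0 addn1.
  by rewrite -!addeA; congr (_ + _); rewrite addeC -!addeA; congr (_ + _); rewrite addeC.
have Sfin : \sum_(j <oo) H (P j.+1) < +oo.
  apply: (@le_lt_trans _ _ (H X + H X)); last first.
    by rewrite -ge0_fin_numE ?adde_ge0// fin_numD Xfin.
  apply: lime_le; first exact: is_cvg_nneseries.
  apply: nearW => N; apply: (@le_trans _ _ (\sum_(0 <= j < N.*2) H (P j.+1))).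
    by apply: lee_sum_nneg_natr => //; rewrite -addnn leq_addr.
  by rewrite big_mkord sumD; apply: leeD; apply: le_trans (sums _ _) _; apply: Hle => x [].
have := @nneseries_tail_cvg _ _ _ Sfin (fun k _ => H0 _).
move=> tail0.
apply/lee_addgt0Pr => e e0.
have [N _ HN] : \forall N \near \oo, \sum_(N <= j <oo) H (P j.+1) < e%:E.
  exact: cvge0_near tail0 _ e0.
have {}HN := HN N (leqnn N).
have cover : X `&` ~` L `<=` A N.+1 `|` \bigcup_j (if (N <= j)%N then P j.+1 else set0).
  move=> x [Xx /= /negP]; rewrite -ltNge => cx.
  have [xa|xa] := leP (a N.+1) (x ord0 i); first by left.
  right.
  have exk : exists k, (a k <= x ord0 i)%R.
    have /cvgr_lt := @cvg_harmonic R.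
    move=> /(_ (x ord0 i - c)%R); rewrite subr_gt0 => /(_ cx)[k _ /(_ k (leqnn k))] /= kx.
    by exists k; rewrite /a; move: kx; rewrite /harmonic/= ltrBrDl => /ltW.
  have [k kx kmin] := ex_minnP exk.
  have Nk : (N.+1 < k)%N.
    rewrite ltnNge; apply/negP => kN; move: xa; rewrite ltNge => /negP; apply.
    by apply: le_trans kx; move: kN; rewrite leq_eqVlt => /predU1P[->//|/aS/ltW].
  (* By minimality of k, x lies between [a k] and [a k.-1], that is in the shell of index k - 1,
     which the union numbers by j = k - 2. *)
  exists k.-2 => //; rewrite ifT; last by case: k Nk {kx kmin} => [|[|k]].
  split => //=; case: k Nk kx kmin => [|[|k]]// Nk kx kmin.
  rewrite kx/= ltNge; apply/negP => /kmin; by rewrite ltnn.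
have HL : H (X `&` ~` L) <= H (A N.+1) + \sum_(N <= j <oo) H (P j.+1).
  apply: le_trans (Hle _ _ cover) _.
  apply: le_trans (outer_measureU2 (hausdorff_outer R n s) _ _) _.
  apply: leeD2l.
  apply: le_trans (outer_measure_sigma_subadditive (hausdorff_outer R n s) _) _.
  rewrite (nneseries_split 0 N)//= add0n big_mkord big1 ?add0e; last first.
    by move=> j _; rewrite leqNgt ltn_ord/= (outer_measure0 (hausdorff_outer R n s)).
  apply: lee_nneseries => // j _; case: ifPn => _ //.
  by rewrite (outer_measure0 (hausdorff_outer R n s)) H0.
apply: (@le_trans _ _ (H (X `&` L) + (H (A N.+1) + e%:E))).
  by apply: leeD2l; apply: le_trans HL _; apply: leeD2l; exact: ltW.
rewrite addeA; apply: leeD2r; rewrite addeC.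
apply: le_trans (@sep N.+1 N.+2 _ _ _ _ _) _ => //.
- by move=> x [].
- by move=> x [_ /= xc]; apply: le_lt_trans xc (ac _).
- by apply: Hle => x [[]|[]].
Qed.

End hausdorff_metric.

Section hausdorff_borel.
Context {R : realType} {n : nat} (s : nat).

Lemma measurable_hausdorff_coord (i : 'I_n) :
  measurable_fun [set: hausdorff_type R n s] (fun x : 'rV[R]_n => x ord0 i).
Proof.
apply: measurability; first exact: RGenOInfty.measurableE.
move=> _ [A [c ->] <-]; rewrite setTI.
rewrite (_ : _ @^-1` _ = ~` [set x : 'rV[R]_n | (x ord0 i <= c)%R]).
  by apply: measurableC; exact: caratheodory_le_coord.
by apply/seteqP; split => x /=; rewrite in_itv/= andbT ltNge => /negP.
Qed.

Lemma measurable_hausdorff_borel (A : set 'rV[R]_n) :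
  measurable A -> measurable (A : set (hausdorff_type R n s)).
Proof.
apply: smallest_sub; first exact: (@sigma_algebra_measurable _ (hausdorff_type R n s)).
rewrite -bigcup_seq => B [i _ [C mC <-]].
exact: measurable_hausdorff_coord.
Qed.

Lemma measurable_fun_hausdorff (f : 'rV[R]_n -> R) :
  measurable_fun setT f -> measurable_fun [set: hausdorff_type R n s] f.
Proof.
by move=> mf _ Y mY; apply: measurable_hausdorff_borel; exact: mf.
Qed.

End hausdorff_borel.

(** * C^{1,1} functions *)

Section quadratic_expansion.
Context {R : realType} {n : nat}.
Implicit Types (phi psi : 'rV[R]_n -> R) (G H : 'rV[R]_n -> 'rV[R]_n).

(* C^{1,1} functions, bounded together with their gradient G. *)
Definition C11 phi G := exists L : R, [/\
  forall z v, `|phi (z + v) - phi z - dotv (G z) v| <= L * enorm v ^+ 2,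
  forall z v, enorm (G (z + v) - G z) <= L * enorm v,
  forall z, `|phi z| <= L & forall z, enorm (G z) <= L].

(** The Taylor estimate handles increments of length at most one, the bound on phi the longer ones;
    each costs 2 L. *)
Lemma C11_lipschitz phi G : C11 phi G -> exists2 L : R, 0 <= L &
  forall z v, `|phi (z + v) - phi z| <= L * enorm v.
Proof.
move=> [L [h1 _ h3 h4]]; have L0 : 0 <= L by apply: le_trans (h3 0).
exists (L *+ 2); first by rewrite mulrn_wge0.
move=> z v; rewrite mulrnAl.
have v0 := enorm_ge0 v.
have [v1|v1] := leP (enorm v) 1.
  have -> : phi (z + v) - phi z = (phi (z + v) - phi z - dotv (G z) v) + dotv (G z) v by ring.
  rewrite (le_trans (ler_normD _ _))// mulr2n lerD//.
    by rewrite (le_trans (h1 _ _))// ler_wpM2l// expr2 ler_piMl.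
  by rewrite (le_trans (dotv_le_enorm _ _))// ler_wpM2r.
rewrite (le_trans (ler_normB _ _))// mulr2n lerD//.
  by rewrite (le_trans (h3 _))// ler_peMr// ltW.
by rewrite (le_trans (h3 _))// ler_peMr// ltW.
Qed.

Lemma C11_continuous phi G : C11 phi G -> continuous phi.
Proof.
move=> /C11_lipschitz[L L0 h] x U /nbhs_ballP[e /= e0 eU]; apply/nbhs_ballP.
have L1 : 0 < L + 1 by rewrite ltr_wpDl.
have d0 : 0 < e / (L + 1) / n.+1%:R by rewrite !divr_gt0.
exists (e / (L + 1) / n.+1%:R) => //= y yx; apply: eU.
have := ball_sub_eball d0 yx; rewrite /eball/= mulrC divfK ?gt_eqF// => exy.
rewrite /ball/= distrC -{1}(subrKC x y); apply: le_lt_trans (h _ _) _.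
apply: (@le_lt_trans _ _ ((L + 1) * enorm (y - x))); first by rewrite ler_wpM2r ?enorm_ge0// lerDl.
by rewrite mulrC -ltr_pdivlMr.
Qed.

Lemma C11_cst (c : R) : C11 (fun=> c) (fun=> 0).
Proof.
exists `|c|; split => [z v|z v|z|z]; rewrite ?dotv0l ?subrr ?subr0 ?normr0 ?enorm0//;
by rewrite mulr_ge0 ?enorm_ge0 ?exprn_ge0 ?enorm_ge0.
Qed.

(** Product rule: besides the two first-order remainders there is the product of the two increments,
    which the Lipschitz constants K and K' make quadratic. *)
Lemma C11M phi psi G H : C11 phi G -> C11 psi H ->
  C11 (fun z => phi z * psi z) (fun z => psi z *: G z + phi z *: H z).
Proof.
move=> cphi cpsi; have [K K0 kphi] := C11_lipschitz cphi; have [K' K'0 kpsi] := C11_lipschitz cpsi.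
case: cphi => L [p1 p2 p3 p4]; case: cpsi => M [q1 q2 q3 q4].
have L0 : 0 <= L by apply: le_trans (p3 0).
have M0 : 0 <= M by apply: le_trans (q3 0).
exists (2 * L * M + K * K' + L * M + L * K' + M * K + L * M).
have LM0 : 0 <= L * M by rewrite mulr_ge0.
have KK0 : 0 <= K * K' by rewrite mulr_ge0.
have LK0 : 0 <= L * K' by rewrite mulr_ge0.
have MK0 : 0 <= M * K by rewrite mulr_ge0.
split => [z v|z v|z|z].
- have := p1 z v; have := q1 z v; have := kphi z v; have := kpsi z v.
  have v0 := enorm_ge0 v.
  have -> : phi (z + v) * psi (z + v) - phi z * psi z - dotv (psi z *: G z + phi z *: H z) v =
    psi z * (phi (z + v) - phi z - dotv (G z) v) + phi z * (psi (z + v) - psi z - dotv (H z) v) +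
    (phi (z + v) - phi z) * (psi (z + v) - psi z).
    by rewrite dotvDl !dotvZl; ring.
  move=> h1 h2 h3 h4.
  apply: le_trans (ler_normD _ _) _.
  apply: le_trans (lerD (ler_normD _ _) (lexx _)) _.
  rewrite !normrM.
  apply: (@le_trans _ _ (M * (L * enorm v ^+ 2) + L * (M * enorm v ^+ 2) +
      (K * enorm v) * (K' * enorm v))).
    apply: lerD; [apply: lerD|]; apply: ler_pM => //.
  have : 0 <= enorm v ^+ 2 by exact: exprn_ge0.
  have : 0 <= (L * M + L * K' + M * K + L * M) * enorm v ^+ 2.
    by rewrite mulr_ge0 ?exprn_ge0// !addr_ge0.
  by rewrite expr2; lra.
- have v0 := enorm_ge0 v.
  have -> : psi (z + v) *: G (z + v) + phi (z + v) *: H (z + v) - (psi z *: G z + phi z *: H z) =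
     (psi (z + v) *: (G (z + v) - G z) + phi (z + v) *: (H (z + v) - H z)) +
     ((psi (z + v) - psi z) *: G z + (phi (z + v) - phi z) *: H z).
    by apply/rowP => i; rewrite !mxE; ring.
  apply: le_trans (ler_enormD _ _) _.
  apply: le_trans (lerD (ler_enormD _ _) (ler_enormD _ _)) _.
  rewrite !enormZ.
  apply: (@le_trans _ _ (M * (L * enorm v) + L * (M * enorm v) + ((K' * enorm v) * L + (K * enorm v) * M))).
    by apply: lerD; apply: lerD; apply: ler_pM => //; rewrite ?enorm_ge0.
  have : 0 <= (K * K' + L * M + L * M) * enorm v by rewrite mulr_ge0 ?addr_ge0.
  by lra.
- rewrite normrM; apply: le_trans (ler_pM _ _ (p3 z) (q3 z)) _ => //.
  lra.
- apply: le_trans (ler_enormD _ _) _; rewrite !enormZ.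
  apply: le_trans (lerD (ler_pM _ _ (q3 z) (p4 z)) (ler_pM _ _ (p3 z) (q4 z))) _; rewrite ?enorm_ge0//.
  lra.
Qed.

Lemma C11_prod (I : Type) (r : seq I) (f : I -> 'rV[R]_n -> R) :
  (forall i, exists G, C11 (f i) G) -> exists G, C11 (fun z => \prod_(i <- r) f i z) G.
Proof.
move=> h; elim: r => [|i r [G IH]].
  by exists (fun=> 0); under eq_fun do rewrite big_nil; exact: C11_cst.
have [Gi hi] := h i; exists (fun z => (\prod_(j <- r) f j z) *: Gi z + f i z *: G z).
by under eq_fun do rewrite big_cons; exact: C11M.
Qed.

Lemma C11_onem phi G : C11 phi G -> C11 (fun z => 1 - phi z) (fun z => - G z).
Proof.
move=> [L [h1 h2 h3 h4]]; exists (L + 1); split => [z v|z v|z|z].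
- rewrite dotvNl (_ : _ - _ = - (phi (z + v) - phi z - dotv (G z) v)); last by ring.
  by rewrite normrN (le_trans (h1 _ _))// ler_wpM2r ?exprn_ge0 ?enorm_ge0// lerDl.
- rewrite -opprD enormN (le_trans (h2 _ _))// ler_wpM2r ?enorm_ge0// lerDl//.
- by rewrite (le_trans (ler_normB _ _))// normr1 addrC lerD2r.
- by rewrite enormN (le_trans (h4 _))// lerDl.
Qed.

Lemma C11_comp_coord (b b' : R -> R) (L : R) (i : 'I_n) (c e : R) :
  (forall t s, `|b (t + s) - b t - b' t * s| <= L * s ^+ 2) ->
  (forall t s, `|b' (t + s) - b' t| <= L * `|s|) ->
  (forall t, `|b t| <= L) -> (forall t, `|b' t| <= L) ->
  exists G, C11 (fun z => b (c * z ord0 i + e)) G.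
Proof.
move=> h1 h2 h3 h4.
have L0 : 0 <= L by apply: le_trans (h3 0).
exists (fun z => (b' (c * z ord0 i + e) * c) *: delta_mx ord0 i).
have dd (v : 'rV[R]_n) : dotv (delta_mx ord0 i) v = v ord0 i.
  rewrite /dotv (bigD1 i)//= mxE !eqxx mul1r big1 ?addr0// => j ji.
  by rewrite mxE (negbTE ji) andbF mul0r.
have ed : enorm (delta_mx ord0 i : 'rV[R]_n) = 1 by rewrite /enorm dd mxE !eqxx sqrtr1.
exists (L * (1 + `|c| + c ^+ 2)).
have c0 : 0 <= `|c| by [].
have cc : 0 <= c ^+ 2 by exact: sqr_ge0.
split => [z v|z v|z|z].
- rewrite !mxE dotvZl dd -(mulrA (b' _)).
  rewrite (_ : c * (z ord0 i + v ord0 i) + e = (c * z ord0 i + e) + c * v ord0 i); last by ring.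
  apply: le_trans (h1 _ _) _; rewrite exprMn -mulrA ler_wpM2l//.
  have vi : v ord0 i ^+ 2 <= enorm v ^+ 2.
    rewrite -[leLHS]real_normK ?num_real// lerXn2r ?nnegrE ?enorm_ge0//.
    exact: norm_coord_enorm.
  apply: ler_pM => //; rewrite ?sqr_ge0//; lra.
- rewrite -scalerBl enormZ ed mulr1 -mulrBl normrM !mxE.
  rewrite (_ : c * (z ord0 i + v ord0 i) + e = (c * z ord0 i + e) + c * v ord0 i); last by ring.
  apply: le_trans (ler_wpM2r c0 (h2 _ _)) _; rewrite normrM.
  have vi := norm_coord_enorm v i.
  rewrite (_ : L * (`|c| * `|v ord0 i|) * `|c| = L * (`|c| ^+ 2 * `|v ord0 i|)); last by ring.
  by rewrite real_normK ?num_real// -mulrA ler_wpM2l// ler_pM//; lra.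
- by rewrite (le_trans (h3 _))// ler_peMr//; lra.
- rewrite enormZ ed mulr1 normrM; apply: le_trans (ler_wpM2r c0 (h4 _)) _.
  by rewrite ler_wpM2l//; lra.
Qed.

End quadratic_expansion.

(** * A C^{1,1} step function on the line *)

Section smoothstep.
Context {R : realType}.
Implicit Types t s : R.

Let clamp t : R := if t <= 0 then 0 else if 1 <= t then 1 else t.

(** The cubic from 0 to 1 with derivative 6c(1-c). That derivative vanishes at both ends, so
    freezing the argument outside [0, 1] keeps it Lipschitz. *)
Definition smoothstep t : R := 3 * clamp t ^+ 2 - 2 * clamp t ^+ 3.

Definition smoothstep' t : R := 6 * clamp t * (1 - clamp t).

Let clamp01 t : 0 <= clamp t <= 1.
Proof.
rewrite /clamp; case: (leP t 0) => [_|t0]; first by rewrite lexx ler01.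
by case: (leP 1 t) => [_|t1]; [rewrite ler01 lexx|rewrite !ltW].
Qed.

Let clamp_lip t s : `|clamp (t + s) - clamp t| <= `|s|.
Proof.
by rewrite /clamp; case: (leP (t + s)) => h1; case: (leP t) => h2; try case: (leP 1 (t + s)) => h3;
  try case: (leP 1 t) => h4; rewrite ler_norml; case: (ger0P s) => h5; apply/andP; split; lra.
Qed.

Lemma smoothstep_le0 t : t <= 0 -> smoothstep t = 0.
Proof. by move=> t0; rewrite /smoothstep /clamp t0; ring. Qed.

Lemma smoothstep_ge1 t : 1 <= t -> smoothstep t = 1.
Proof.
move=> t1; rewrite /smoothstep /clamp ifF; last by apply/negbTE; rewrite -ltNge; lra.
by rewrite t1; ring.
Qed.

Lemma smoothstep01 t : 0 <= smoothstep t <= 1.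
Proof.
rewrite /smoothstep; have /andP[] := clamp01 t; move: (clamp t) => c c0 c1.
rewrite (_ : 3 * c ^+ 2 - 2 * c ^+ 3 = c ^+ 2 * (3 - 2 * c)); last by ring.
rewrite mulr_ge0 ?sqr_ge0//=; last by lra.
rewrite -subr_ge0 (_ : _ - _ = (1 - c) ^+ 2 * (1 + 2 * c)); last by ring.
by rewrite mulr_ge0 ?sqr_ge0//; lra.
Qed.

(** The expansion is exact up to a quadratic factor when written in the increment of [clamp].
    Replacing that increment by s matters only if [clamp] cuts between t and t + s. *)
Lemma smoothstep_taylor t s :
  `|smoothstep (t + s) - smoothstep t - smoothstep' t * s| <= 20 * s ^+ 2.
Proof.
have h : `|smoothstep (t + s) - smoothstep t - smoothstep' t * (clamp (t + s) - clamp t)| <= 5 * s ^+ 2.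
  rewrite /smoothstep /smoothstep'.
  have := clamp_lip t s; have /andP[] := clamp01 t; have /andP[] := clamp01 (t + s).
  move: (clamp t) (clamp (t + s)) => c c' c'0 c'1 c0 c1 cs.
  have d2 : (c' - c) ^+ 2 <= s ^+ 2.
    by rewrite -[leLHS]real_normK ?num_real// -[leRHS]real_normK ?num_real// lerXn2r ?nnegrE.
  have -> : 3 * c' ^+ 2 - 2 * c' ^+ 3 - (3 * c ^+ 2 - 2 * c ^+ 3) - 6 * c * (1 - c) * (c' - c) =
    (c' - c) ^+ 2 * (3 - 4 * c - 2 * c') by ring.
  rewrite normrM ger0_norm ?sqr_ge0// mulrC ler_pM// ?sqr_ge0// ler_norml.
  by apply/andP; split; lra.
(* When the cut occurs, t is within |s| of 0 or 1, so the factor t (1 - t) of the derivative is at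
   most |s| and the error is again quadratic. *)
have h2 : `|smoothstep' t * (clamp (t + s) - clamp t - s)| <= 6 * s ^+ 2.
  rewrite /smoothstep' /clamp.
  case: (leP t 0) => t0; first by rewrite mulr0 !mul0r normr0 mulr_ge0// sqr_ge0.
  case: (leP 1 t) => t1; first by rewrite subrr mulr0 !mul0r normr0 mulr_ge0// sqr_ge0.
  have prod r : t * (1 - t) <= `|s| -> `|r| <= `|s| -> `|6 * t * (1 - t) * r| <= 6 * s ^+ 2.
    move=> h1 h2; rewrite -!mulrA normrM ger0_norm// ler_wpM2l// mulrA normrM.
    rewrite -[leRHS]real_normK ?num_real// expr2 ler_pM// ger0_norm// mulr_ge0//; lra.
  case: (leP (t + s) 0) => h0.
    have s0 : s <= 0 by lra.
    rewrite (ler0_norm s0) in prod; apply: prod; first by nra.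
    by rewrite ler_norml; apply/andP; split; lra.
  case: (leP 1 (t + s)) => h1.
    have s0 : 0 <= s by lra.
    rewrite (ger0_norm s0) in prod; apply: prod; first by nra.
    by rewrite ler_norml; apply/andP; split; lra.
  have -> : t + s - t - s = 0 by ring.
  by rewrite mulr0 normr0 mulr_ge0 ?sqr_ge0.
have -> : smoothstep (t + s) - smoothstep t - smoothstep' t * s =
  (smoothstep (t + s) - smoothstep t - smoothstep' t * (clamp (t + s) - clamp t)) +
  smoothstep' t * (clamp (t + s) - clamp t - s) by ring.
apply: le_trans (ler_normD _ _) _.
have : 0 <= s ^+ 2 by exact: sqr_ge0.
lra.
Qed.

Lemma smoothstep'_lip t s : `|smoothstep' (t + s) - smoothstep' t| <= 20 * `|s|.
Proof.
rewrite /smoothstep'.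
have := clamp_lip t s; have /andP[] := clamp01 t; have /andP[] := clamp01 (t + s).
move: (clamp t) (clamp (t + s)) => c c' c'0 c'1 c0 c1 cs.
have -> : 6 * c' * (1 - c') - 6 * c * (1 - c) = (6 - 6 * c - 6 * c') * (c' - c) by ring.
rewrite normrM; apply: ler_pM => //; rewrite ler_norml; apply/andP; split; lra.
Qed.

Lemma smoothstep'_bound t : `|smoothstep' t| <= 20.
Proof.
rewrite /smoothstep'; have /andP[] := clamp01 t; move: (clamp t) => c c0 c1.
rewrite ler_norml; apply/andP; split; nra.
Qed.

Lemma C11_smoothstep n (i : 'I_n) (c e : R) :
  exists G, C11 (fun z : 'rV[R]_n => smoothstep (c * z ord0 i + e)) G.
Proof.
apply: (C11_comp_coord (L := 20) (b' := smoothstep')).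
- exact: smoothstep_taylor.
- exact: smoothstep'_lip.
- move=> t; have /andP[h0 h1] := smoothstep01 t.
  by rewrite ger0_norm//; lra.
- exact: smoothstep'_bound.
Qed.

Lemma smoothstep_gt0 t : 0 < t -> 0 < smoothstep t.
Proof.
move=> t0; have : 0 < clamp t.
  by rewrite /clamp leNgt t0/=; case: ifP.
rewrite /smoothstep; have /andP[_] := clamp01 t; move: (clamp t) => c c1 c0.
rewrite (_ : 3 * c ^+ 2 - 2 * c ^+ 3 = c ^+ 2 * (3 - 2 * c)); last by ring.
by rewrite mulr_gt0 ?exprn_gt0//; lra.
Qed.

Lemma near_smoothstep t : \forall k \near \oo, smoothstep (k%:R * t) = (0 < t)%R%:R.
Proof.
have [t0|t0] := ltP 0 t; last by near=> k; rewrite smoothstep_le0 ?mulr_ge0_le0.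
near=> k; apply: smoothstep_ge1; rewrite -ler_pdivrMr//; near: k.
exact: nbhs_infty_ger.
Unshelve. all: by end_near.
Qed.

End smoothstep.

(** * Differentiability from quadratic remainder estimates *)

Lemma is_derive_quadratic (R : realType) (V : normedModType R) (F : V -> R) (x v : V) (l C : R) :
  (forall h : R, `|F (x + h *: v) - F x - l * h| <= C * h ^+ 2) -> is_derive x v F l.
Proof.
move=> FC.
have C0 : 0 <= C by move: (le_trans (normr_ge0 _) (FC 1)); rewrite expr1n mulr1.
have lF : (fun h => h^-1 *: ((F \o shift x) (h *: v) - F x)) @ (0 : R)^' --> l.
  apply/cvgrPdist_le => e e0; near=> h.
  have h0 : h != 0 by near: h; exact: nbhs_dnbhs_neq.
  have hn : 0 < `|h| by rewrite normr_gt0.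
  rewrite /= -(ler_pM2l hn) -normrM mulrBr mulrC /GRing.scale/= mulrA divff// mul1r.
  rewrite distrC (addrC (h *: v)) mulrC; apply: le_trans (_ : C * h ^+ 2 <= _).
    by rewrite [X in _ - X]mulrC.
  rewrite -[X in C * X]real_normK ?num_real// expr2 mulrCA ler_wpM2l//.
  apply: (@le_trans _ _ ((C + 1) * `|h|)); first by rewrite ler_wpM2r// lerDl.
  rewrite mulrC -ler_pdivlMr ?ltr_wpDl//; near: h.
  apply: dnbhs0_le; rewrite divr_gt0// ltr_wpDl//.
split; first by apply/cvg_ex; exists l.
exact/cvg_lim.
Unshelve. all: by end_near.
Qed.

Lemma lipschitz_continuous (R : realType) (f : R -> R) (L : R) :
  (forall s h, `|f (s + h) - f s| <= L * `|h|) -> continuous f.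
Proof.
move=> fL s U /nbhs_ballP[e /= e0 eU]; apply/nbhs_ballP.
have L1 : 0 < `|L| + 1 by rewrite ltr_wpDl.
exists (e / (`|L| + 1)); first by rewrite /= divr_gt0.
move=> t; rewrite /ball/= ltr_pdivlMr// => st; apply: eU.
rewrite /ball/= distrC -{1}(subrKC s t); apply: le_lt_trans (fL _ _) _.
apply: le_lt_trans st; rewrite distrC mulrC ler_wpM2l//.
by rewrite (le_trans (ler_norm _))// lerDl.
Qed.

Section C11_calculus.
Context {R : realType} {n : nat}.
Implicit Types (phi : 'rV[R]_n -> R) (G : 'rV[R]_n -> 'rV[R]_n) (xi : 'rV[R]_n).

Lemma C11_is_derive phi G x v : C11 phi G -> is_derive x v phi (dotv (G x) v).
Proof.
move=> [L [h1 _ _ _]]; apply: (@is_derive_quadratic _ _ _ _ _ _ (L * enorm v ^+ 2)) => h.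
have := h1 x (h *: v); rewrite dotvZr enormZ exprMn real_normK ?num_real//.
by rewrite [h * _]mulrC mulrA mulrAC.
Qed.

(** A name for the partial application, to carry the linear structure required of a differential. *)
Definition dotv_linear (g x : 'rV[R]_n) : R := dotv g x.

Lemma dotv_linear_is_linear g : linear_for *%R (dotv_linear g).
Proof. by move=> a x y; rewrite /dotv_linear dotvDr dotvZr. Qed.

HB.instance Definition _ g := GRing.isLinear.Build R 'rV[R]_n R *%R (dotv_linear g)
  (dotv_linear_is_linear g).

Lemma dotv_continuous (g : 'rV[R]_n) : continuous (dotv_linear g).
Proof.
move=> x U /nbhs_ballP[e /= e0 eU]; apply/nbhs_ballP.
have L1 : 0 < enorm g + 1 by rewrite ltr_wpDl ?enorm_ge0.
have d0 : 0 < e / (enorm g + 1) / n.+1%:R by rewrite !divr_gt0.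
exists (e / (enorm g + 1) / n.+1%:R) => //= y yx; apply: eU.
have := ball_sub_eball d0 yx; rewrite /eball/= mulrC divfK ?gt_eqF// => exy.
rewrite /ball/= /dotv_linear -dotvBr; apply: le_lt_trans (dotv_le_enorm _ _) _.
apply: (@le_lt_trans _ _ ((enorm g + 1) * enorm (y - x))).
  by rewrite enormBC ler_wpM2r ?enorm_ge0// lerDl.
by rewrite mulrC -ltr_pdivlMr.
Qed.

Lemma C11_differentiable phi G x : C11 phi G -> differentiable phi x.
Proof.
move=> [L [h1 _ h3 _]].
have L0 : 0 <= L by apply: le_trans (h3 0).
have h : phi \o shift x = cst (phi x) + dotv_linear (G x) +o_ (0 : 'rV[R]_n) id.
  apply/eqaddoP => e e0; have C0 : 0 < L * n%:R ^+ 2 + 1 by rewrite ltr_wpDl// mulr_ge0.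
  have nb : \forall v \near (0 : 'rV[R]_n), `|v| <= e / (L * n%:R ^+ 2 + 1).
    by apply: nbhs0_le; rewrite divr_gt0.
  near=> v.
  rewrite /= -[X in `|X|]/(phi (v + x) - (phi x + dotv (G x) v)) opprD addrA addrC.
  rewrite addrA [_ + phi _]addrC (addrC v) addrAC; apply: le_trans (h1 _ _) _.
  have vn : enorm v <= n%:R * `|v|.
    apply: enorm_le_cube => i; rewrite [leRHS]/Num.norm/= mx_normrE.
    exact: (le_bigmax _ (fun ij => `|v ij.1 ij.2|) (ord0, i)).
  apply: (@le_trans _ _ (L * (n%:R * `|v|) ^+ 2)).
    by rewrite ler_wpM2l// lerXn2r ?nnegrE ?mulr_ge0 ?enorm_ge0.
  rewrite exprMn expr2 [in leLHS]expr2 !mulrA ler_wpM2r//.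
  apply: (@le_trans _ _ ((L * n%:R ^+ 2 + 1) * `|v|)).
    by rewrite ler_wpM2r// -mulrA lerDl.
  rewrite mulrC -ler_pdivlMr//; near: v.
  exact: nb.
apply/diff_locallyP.
have E := @diff_unique R _ _ phi (dotv_linear (G x)) x (@dotv_continuous _) h.
by split; rewrite ?E//; exact: dotv_continuous.
Unshelve. all: by end_near.
Qed.

End C11_calculus.

(** * Averages over segments *)

Section average.
Context {R : realType} {n : nat}.
Implicit Types (phi : 'rV[R]_n -> R) (G : 'rV[R]_n -> 'rV[R]_n) (xi : 'rV[R]_n).
Local Notation I01 h := (\int[lebesgue_measure]_(s in `[0%R, 1%R]) h s)%R.

Lemma integrable01 (h : R -> R) (C : R) : measurable_fun setT h -> (forall s, `|h s| <= C) ->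
  lebesgue_measure.-integrable `[0, 1] (EFin \o h).
Proof.
move=> mh hC; apply: measurable_bounded_integrable => //.
- by rewrite /= lebesgue_measure_itv/= lte_fin ltr01 oppr0 adde0 ltry.
- exact: measurable_funS mh.
- exists C; split; first exact: num_real.
  by move=> c Cc s _; exact: le_trans (hC s) (ltW Cc).
Qed.

Lemma I01_bound (h : R -> R) (C : R) : measurable_fun setT h -> (forall s, `|h s| <= C) ->
  `|I01 h| <= C.
Proof.
move=> mh hC.
have ih := integrable01 mh hC.
apply: le_trans (le_normr_Rintegral _ ih) _ => //.
apply: (@le_trans _ _ (I01 (fun=> C))).
  apply: le_Rintegral => //.
  - exact: integrable_norm.
  - by apply: (@integrable01 _ `|C|) => // s.
rewrite Rintegral_cst//= lebesgue_measure_itv/= lte_fin ltr01 oppr0 adde0/= mulr1//.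
Qed.

Lemma I01_sum (I : Type) (r : seq I) (h : I -> R -> R) (C : R) :
  (forall i, measurable_fun setT (h i)) -> (forall i s, `|h i s| <= C) ->
  I01 (fun s => \sum_(i <- r) h i s) = \sum_(i <- r) I01 (h i).
Proof.
move=> mh hC; elim: r => [|i r IH].
  under eq_Rintegral do rewrite big_nil; rewrite big_nil Rintegral_cst//= mul0r//.
under eq_Rintegral do rewrite big_cons.
rewrite big_cons RintegralD//; first by rewrite IH.
- exact: integrable01 (hC i).
- apply: (@integrable01 _ (\sum_(i <- r) C)); first exact: measurable_sum.
  by move=> s; apply: le_trans (ler_norm_sum _ _ _) _; apply: ler_sum.
Qed.

Definition avg phi xi z : R := I01 (fun s : R => phi (z - s *: xi)).

Lemma measurable_line (z xi : 'rV[R]_n) : measurable_fun setT (fun s : R => z - s *: xi).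
Proof. by apply: measurable_rVB => //; exact: measurable_rVZ. Qed.

Lemma measurable_C11 phi G : C11 phi G -> measurable_fun setT phi.
Proof. by move=> /C11_continuous; exact: continuous_measurable_fun_rV. Qed.

Lemma C11_grad_continuous phi G i : C11 phi G -> continuous (fun z => G z ord0 i).
Proof.
move=> [L [_ h _ hb]].
have L0 : 0 <= L by apply: le_trans (hb 0); exact: enorm_ge0.
move=> x U /nbhs_ballP[e /= e0 eU]; apply/nbhs_ballP.
have L1 : 0 < L + 1 by rewrite ltr_wpDl.
have d0 : 0 < e / (L + 1) / n.+1%:R by rewrite !divr_gt0.
exists (e / (L + 1) / n.+1%:R) => //= y yx; apply: eU.
have := ball_sub_eball d0 yx; rewrite /eball/= mulrC divfK ?gt_eqF// => exy.
rewrite /ball/= distrC.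
have := norm_coord_enorm (G (x + (y - x)) - G x) i; rewrite subrKC !mxE => /le_lt_trans; apply.
apply: le_lt_trans (_ : L * enorm (y - x) < _); first by rewrite -{1}(subrKC x y); exact: h.
apply: (@le_lt_trans _ _ ((L + 1) * enorm (y - x))); first by rewrite ler_wpM2r ?enorm_ge0// lerDl.
by rewrite mulrC -ltr_pdivlMr.
Qed.

Lemma measurable_C11_grad phi G i : C11 phi G -> measurable_fun setT (fun z => G z ord0 i).
Proof. by move=> cphi; apply: continuous_measurable_fun_rV; exact: C11_grad_continuous cphi. Qed.

Definition avg_grad G xi z : 'rV[R]_n := \row_i I01 (fun s : R => G (z - s *: xi) ord0 i).

Lemma avg_grad_dotv phi G xi z v : C11 phi G ->
  dotv (avg_grad G xi z) v = I01 (fun s : R => dotv (G (z - s *: xi)) v).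
Proof.
move=> cphi; have [L [_ _ _ hb]] := cphi.
rewrite /dotv (@I01_sum _ _ (fun i s => G (z - s *: xi) ord0 i * v ord0 i) (L * enorm v)).
- apply: eq_bigr => i _; rewrite mxE RintegralZr//.
  apply: (@integrable01 _ L).
    exact: measurableT_comp (measurable_C11_grad i cphi) (measurable_line _ _).
  by move=> s; apply: le_trans (hb _); exact: norm_coord_enorm.
- move=> i; apply: measurable_funM => //.
  exact: measurableT_comp (measurable_C11_grad i cphi) (measurable_line _ _).
- move=> i s; rewrite normrM ler_pM//; last exact: norm_coord_enorm.
  by apply: le_trans (hb _); exact: norm_coord_enorm.
Qed.

Lemma C11_avg phi G xi : C11 phi G -> C11 (avg phi xi) (avg_grad G xi).
Proof.
move=> cphi; have [L [h1 h2 h3 h4]] := cphi.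
have L0 : 0 <= L by apply: le_trans (h3 0).
have mphi z : measurable_fun setT (fun s : R => phi (z - s *: xi)).
  exact: measurableT_comp (measurable_C11 cphi) (measurable_line _ _).
have mG z i : measurable_fun setT (fun s : R => G (z - s *: xi) ord0 i).
  exact: measurableT_comp (measurable_C11_grad i cphi) (measurable_line _ _).
have iphi z := integrable01 (mphi z) (fun s => h3 _).
have mGv z v : measurable_fun setT (fun s : R => dotv (G (z - s *: xi)) v).
  by apply: measurable_sum => i; apply: measurable_funM.
have iGv z v : lebesgue_measure.-integrable `[0, 1] (EFin \o (fun s : R => dotv (G (z - s *: xi)) v)).
  apply: (@integrable01 _ (L * enorm v)) => // s.
  by apply: le_trans (dotv_le_enorm _ _) _; rewrite ler_wpM2r ?enorm_ge0.
have iG z i : lebesgue_measure.-integrable `[0, 1] (EFin \o (fun s : R => G (z - s *: xi) ord0 i)).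
  apply: (@integrable01 _ L) => // s.
  by apply: le_trans (h4 _); exact: norm_coord_enorm.
have n0 : 0 <= n%:R :> R by [].
(* The summand n pays for bounding the norm of the averaged gradient by its coordinates. *)
exists (L * (1 + n%:R)); split => [z v|z v|z|z].
- rewrite (avg_grad_dotv _ _ _ cphi) /avg -RintegralB//.
  rewrite -RintegralB//; last first.
    apply: (@integrable01 _ (L + L)); first exact: measurable_funB.
    by move=> s; rewrite (le_trans (ler_normB _ _))// lerD.
  apply: I01_bound.
    by apply: measurable_funB => //; exact: measurable_funB.
  move=> s; rewrite [z + v - _]addrAC; apply: le_trans (h1 _ _) _.
  by rewrite ler_wpM2r ?exprn_ge0 ?enorm_ge0// ler_peMr//; lra.
- apply: (@le_trans _ _ (n%:R * (L * enorm v))).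
    apply: enorm_le_cube => i; rewrite !mxE -RintegralB//.
    apply: I01_bound; first exact: measurable_funB.
    move=> s; rewrite [z + v - _]addrAC; apply: le_trans (h2 (z - s *: xi) v).
    by have := norm_coord_enorm (G (z - s *: xi + v) - G (z - s *: xi)) i; rewrite !mxE.
  by rewrite mulrA ler_wpM2r ?enorm_ge0// mulrC ler_wpM2l//; lra.
- by apply: le_trans (I01_bound (mphi z) (fun s => h3 _)) _; rewrite ler_peMr//; lra.
- apply: (@le_trans _ _ (n%:R * L)).
    apply: enorm_le_cube => i; rewrite !mxE; apply: I01_bound => // s.
    by apply: le_trans (h4 _); exact: norm_coord_enorm.
  by rewrite mulrC ler_wpM2l//; lra.
Qed.

(** The fundamental theorem of calculus along the segment. This is the purpose of [avg]: a
    distributional derivative along xi, tested with an average, becomes a finite difference. *)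
Lemma avg_grad_direction phi G xi z : C11 phi G ->
  dotv (avg_grad G xi z) xi = phi z - phi (z - xi).
Proof.
move=> cphi; rewrite (avg_grad_dotv _ _ _ cphi) /Rintegral.
have [L [h1 h2 h3 h4]] := cphi.
have dF (s : R) : is_derive s 1 (fun s => - phi (z - s *: xi)) (dotv (G (z - s *: xi)) xi).
  apply: (@is_derive_quadratic _ _ _ _ _ _ (L * enorm xi ^+ 2)) => h.
  have := h1 (z - s *: xi) (- (h *: xi)).
  rewrite enormN enormZ exprMn real_normK ?num_real// dotvNr dotvZr.
  rewrite (_ : z - s *: xi - h *: xi = z - (s + h *: 1) *: xi); last first.
    by rewrite [h%:A]mulr1 scalerDl opprD addrA.
  rewrite -normrN (_ : L * (h ^+ 2 * _) = L * enorm xi ^+ 2 * h ^+ 2); last by ring.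
  by congr (`| _ | <= _); ring.
have cF : continuous (fun s : R => - phi (z - s *: xi)).
  by move=> s; apply: differentiable_continuous; apply/derivable1_diffP; case: (dF s).
rewrite (@continuous_FTC2 R _ (fun s => - phi (z - s *: xi)) 0 1 ltr01).
- by rewrite scale0r scale1r subr0 /= opprK addrC.
- apply: continuous_subspaceT; apply: (@lipschitz_continuous _ _ (L * enorm xi * enorm xi)) => s h.
  rewrite -dotvBl (_ : z - (s + h) *: xi = z - s *: xi + (- (h *: xi))); last first.
    by rewrite scalerDl opprD addrA.
  apply: le_trans (dotv_le_enorm _ _) _.
  apply: le_trans (ler_wpM2r (enorm_ge0 _) (h2 _ _)) _.
  rewrite enormN enormZ le_eqVlt; apply/orP; left; apply/eqP; ring.
- split => [s _||].
  + by case: (dF s).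
  + by apply: cvg_at_right_filter; exact: cF.
  + by apply: cvg_at_left_filter; exact: cF.
- by move=> s _; rewrite derive1E; case: (dF s).
Qed.

End average.

(** * The potential *)

Lemma within_dnbhsP (R : realType) (D P : set R) (r : R) :
  (\forall x \near within D (r^'), P x) ->
  exists2 e : R, 0 < e & forall x, D x -> x != r -> `|x - r| < e -> P x.
Proof.
move=> /nbhs_ballP[e /= e0 eP]; exists e => // x Dx xr xe.
by apply: eP => //; rewrite /ball/= distrC.
Qed.

Section potential_facts.
Variables (R : realType) (f : R -> R) (f0' finf rbar : R).
Hypothesis hf : cohesive_potential f f0' finf rbar.
Implicit Types r s : R.

Lemma potential_ge0 r : 0 <= r -> 0 <= f r.
Proof.
rewrite le_eqVlt => /predU1P[<-|/(potential_gt0 hf)/ltW//].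
by rewrite (potential0 hf).
Qed.

Lemma potential_concaveE (t r s : R) : 0 <= t <= 1 -> 0 <= r -> 0 <= s ->
  t * f r + (1 - t) * f s <= f (t * r + (1 - t) * s).
Proof.
move=> /andP[t0 t1] r0 s0.
have := potential_concave hf (Itv01 t0 t1) (x := r) (y := s).
rewrite !inE/= !in_itv/= !andbT => /(_ r0 s0).
rewrite !convRE/= /unstable.onem !mulrN -opprD lerN2.
exact.
Qed.

(** A concave function that decreases somewhere lies under a falling chord and would become
    negative, against positivity. *)
Lemma potential_mono r s : 0 <= r -> r <= s -> f r <= f s.
Proof.
move=> r0; rewrite le_eqVlt => /predU1P[->//|rs].
have [//|fsr] := leP (f r) (f s).
(* The quotient is the zero of the line through (r, f r) and (s, f s); t lies strictly beyond it and
   beyond s. *)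
pose t := (s * f r - r * f s) / (f r - f s) + s + 1.
have d0 : 0 < f r - f s by rewrite subr_gt0.
have fr0 : 0 <= f r by exact: potential_ge0.
have fs0 : 0 <= f s by apply: potential_ge0; lra.
have N0 : 0 <= s * f r - r * f s by nra.
have q0 : 0 <= (s * f r - r * f s) / (f r - f s) by rewrite divr_ge0// ltW.
have ts : s < t by rewrite /t; lra.
have tr : 0 < t - r by lra.
have := @potential_concaveE ((t - s) / (t - r)) r t.
have -> : (t - s) / (t - r) * r + (1 - (t - s) / (t - r)) * t = s by field; rewrite gt_eqF.
have l01 : 0 <= (t - s) / (t - r) <= 1.
  have h0 : 0 <= (t - s) / (t - r) by apply: divr_ge0; lra.
  by rewrite h0/= ler_pdivrMr// mul1r; lra.
have t0 : 0 <= t by lra.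
move=> /(_ l01 r0 t0) h.
have ft0 : 0 <= f t by apply: potential_ge0; lra.
have l0 : 0 <= 1 - (t - s) / (t - r).
  by rewrite subr_ge0 ler_pdivrMr// mul1r; lra.
have {}h : (t - s) / (t - r) * f r <= f s by apply: le_trans h; rewrite lerDl mulr_ge0.
move: h; rewrite mulrAC ler_pdivrMr// => h.
have : t * (f r - f s) <= s * f r - r * f s by nra.
by rewrite -ler_pdivlMr// /t leNgt => /negP; case; lra.
Qed.

Lemma potential_le_finf r : 0 <= r -> f r <= finf.
Proof.
move=> r0; apply: (cvgr_to_ge (potential_lim hf)).
by near=> s; apply: potential_mono => //; near: s; exact: nbhs_pinfty_ge (num_real r).
Unshelve. all: by end_near.
Qed.

Lemma finf_gt0 : 0 < finf.
Proof. by apply: lt_le_trans (potential_le_finf ler01); exact: (potential_gt0 hf). Qed.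

Lemma potential_star (t r : R) : 0 <= t <= 1 -> 0 <= r -> t * f r <= f (t * r).
Proof.
move=> t01 r0; have := potential_concaveE t01 r0 (lexx 0).
by rewrite (potential0 hf) !mulr0 !addr0.
Qed.

Lemma potential_star_ge1 (k r : R) : 1 <= k -> 0 <= r -> f (k * r) <= k * f r.
Proof.
move=> k1 r0; have k0 : 0 < k by exact: lt_le_trans k1.
rewrite -ler_pdivrMl//; have := @potential_star k^-1 (k * r); rewrite mulKf ?gt_eqF//.
by apply; rewrite ?mulr_ge0 ?(ltW k0)// invr_ge0 (ltW k0) invf_le1.
Qed.

Lemma potential_subadditive (r s : R) : 0 <= r -> 0 <= s -> f (r + s) <= f r + f s.
Proof.
move=> r0 s0; have [rs0|rs0] := leP (r + s) 0.
  have -> : r = 0 by lra.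
  by rewrite add0r (potential0 hf) add0r.
have rs : 0 <= r + s by lra.
have h1 : 0 <= r / (r + s) <= 1 by rewrite divr_ge0//= ler_pdivrMr//; lra.
have h2 : 0 <= s / (r + s) <= 1 by rewrite divr_ge0//= ler_pdivrMr//; lra.
have := potential_star h1 rs; have := potential_star h2 rs.
rewrite !divfK ?gt_eqF// => k1 k2; apply: le_trans (lerD k2 k1).
by rewrite -mulrDl -mulrDl divff ?mul1r// gt_eqF.
Qed.

(** Concavity and f 0 = 0 make f s / s nonincreasing in s, so f r / r is at most the limit at 0. *)
Lemma potential_le_linear r : 0 <= r -> f r <= f0' * r.
Proof.
rewrite le_eqVlt => /predU1P[<-|r0]; first by rewrite (potential0 hf) mulr0.
rewrite -ler_pdivrMr//; apply: (cvgr_to_ge (potential_slope hf)).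
near=> s; have s0 : 0 < s by [].
have sr : s <= r by near: s; exact: nbhs_right_le.
rewrite ler_pdivlMr// mulrAC -mulrA [leLHS]mulrC.
have := @potential_star (s / r) r; rewrite divfK ?gt_eqF//; apply; last exact: ltW.
have h0 : 0 <= s / r by apply: divr_ge0; apply: ltW.
by rewrite h0/= ler_pdivrMr// mul1r.
Unshelve. all: by end_near.
Qed.

Variable f' : R -> R.
Hypothesis hf' : forall r, 0 <= r ->
  (s - r)^-1 * (f s - f r) @[s --> within `[0, +oo[ (r^')] --> f' r.

Lemma potential_slope_near r : 0 <= r -> forall e, 0 < e ->
  exists2 d : R, 0 < d & forall s, 0 <= s -> s != r -> `|s - r| < d ->
    `|f s - f r - f' r * (s - r)| <= e * `|s - r|.
Proof.
move=> r0 e e0; have := hf' r0 => /cvgrPdist_le/(_ e e0)/within_dnbhsP[d d0 dP].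
exists d => // s s0 sr sd.
have := dP s; rewrite /= in_itv/= andbT => /(_ s0 sr sd).
have sn : s - r != 0 by rewrite subr_eq0.
have sn0 : 0 < `|s - r| by rewrite normr_gt0.
rewrite -(ler_pM2r sn0) -normrM => h; apply: le_trans h; rewrite le_eqVlt; apply/orP; left; apply/eqP.
by rewrite -normrN; congr (`|_|); field.
Qed.

(** For small t, concavity bounds t (f s - f r) by the increment of f from r to r + t (s - r), which
    is t f'(r) (s - r) up to t e. Division by t leaves an error e. *)
Lemma potential_tangent r s : 0 <= r -> 0 <= s -> f s <= f r + f' r * (s - r).
Proof.
move=> r0 s0; have [->|sr] := eqVneq s r; first by rewrite subrr mulr0 addr0.
have sr0 : 0 < `|s - r| by rewrite normr_gt0 subr_eq0.
apply/ler_addgt0Pr => e e0.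
have [d d0 dP] := potential_slope_near r0 (divr_gt0 e0 sr0).
pose t := Num.min 1 (d / 2 / `|s - r|).
have t0 : 0 < t by rewrite lt_min ltr01 !divr_gt0.
have t1 : t <= 1 by rewrite ge_min lexx.
have td : t * `|s - r| < d.
  apply: (@le_lt_trans _ _ (d / 2)); last by lra.
  by rewrite -ler_pdivlMr// ge_min lexx orbT.
have := dP (t * s + (1 - t) * r).
have -> : t * s + (1 - t) * r - r = t * (s - r) by ring.
rewrite normrM (gtr0_norm t0) => h.
have t01 : 0 <= t <= 1 by rewrite ltW.
have := potential_concaveE t01 s0 r0.
have {}h := h _ _ td.
have : `|f (t * s + (1 - t) * r) - f r - f' r * (t * (s - r))| <= t * e.
  have -> : t * e = e / `|s - r| * (t * `|s - r|) by field; rewrite gt_eqF.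
  apply: h.
  - by rewrite addr_ge0// mulr_ge0//; lra.
  - rewrite -subr_eq0 (_ : _ - _ = t * (s - r)); last by ring.
    by rewrite mulf_neq0 ?subr_eq0// gt_eqF.
move=> /(le_trans (ler_norm _)) h1 h2.
rewrite -(ler_pM2l t0); lra.
Qed.

Lemma potential_deriv_ge0 r : 0 <= r -> 0 <= f' r.
Proof.
move=> r0; have := @potential_tangent r (r + 1) r0; have := @potential_mono r (r + 1) r0.
by move=> /(_ ltac:(lra)) h /(_ ltac:(lra)); lra.
Qed.

Lemma potential_deriv_star r : 0 <= r -> r * f' r <= f r.
Proof. by move=> r0; have := potential_tangent r0 (lexx 0); rewrite (potential0 hf); lra. Qed.

Lemma potential_deriv_le r : 0 <= r -> f' r <= f0'.
Proof.
rewrite le_eqVlt => /predU1P[<-|r0]; last first.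
  rewrite -(ler_pM2l r0) (le_trans (potential_deriv_star (ltW r0)))// mulrC.
  by apply: potential_le_linear; exact: ltW.
apply/ler_addgt0Pr => e e0.
have [d d0 dP] := potential_slope_near (lexx 0) e0.
have d2 : 0 < d / 2 by rewrite divr_gt0.
have := dP (d / 2) (ltW d2); rewrite !subr0 (gtr0_norm d2) (potential0 hf) subr0 => h.
have {}h := h (lt0r_neq0 d2) ltac:(lra).
have := potential_le_linear (ltW d2); move: h; rewrite ler_norml => /andP[h1 h2] h3.
rewrite -(ler_pM2r d2); lra.
Qed.

Lemma potential_deriv_anti r s : 0 <= r -> r <= s -> f' s <= f' r.
Proof.
move=> r0; rewrite le_eqVlt => /predU1P[->//|rs].
have s0 : 0 <= s by lra.
have := potential_tangent r0 s0; have := potential_tangent s0 r0 => h1 h2.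
have h : 0 < s - r by lra.
rewrite -(ler_pM2r h); lra.
Qed.

(** At S = 0 the argument of f sits at the endpoint of the half-line, where only a one-sided
    derivative is given. Since h S^2 never leaves the half-line, the chain rule still holds, with
    explicit estimates. *)
Lemma is_derive_potential_sqr (h S : R) : 0 <= h ->
  is_derive S 1 (fun S => f (h * S ^+ 2)) (2 * h * S * f' (h * S ^+ 2)).
Proof.
rewrite le_eqVlt => /predU1P[<-|h0].
  rewrite mulr0 !mul0r; under eq_fun do rewrite mul0r; exact: is_derive_cst.
set r := h * S ^+ 2; have r0 : 0 <= r by rewrite mulr_ge0 ?sqr_ge0// ltW.
have lF : (fun k => k^-1 *: (((fun S => f (h * S ^+ 2)) \o shift S) (k *: (1:R)) - f r)) @ (0 : R)^'
    --> 2 * h * S * f' r.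
  apply/cvgrPdist_le => e e0.
  (* Lipschitz constant at S of the map to h S^2, for increments |k| <= 1. *)
  pose A := h * (2 * `|S| + 1).
  have A0 : 0 < A by rewrite mulr_gt0// ltr_wpDl// mulr_ge0.
  have eA : 0 < e / 2 / A by rewrite !divr_gt0.
  have [d d0 dP] := potential_slope_near r0 eA.
  have fr := potential_deriv_ge0 r0.
  pose B := h * f' r + 1.
  have B0 : 0 < B by rewrite ltr_wpDl// mulr_ge0// ltW.
  near=> k.
  have k0 : k != 0 by near: k; exact: nbhs_dnbhs_neq.
  have kn : 0 < `|k| by rewrite normr_gt0.
  have k1 : `|k| <= 1 by near: k; apply: dnbhs0_le.
  have kd : `|k| < d / A by near: k; apply: dnbhs0_lt; rewrite divr_gt0.
  have ke : `|k| <= e / 2 / B by near: k; apply: dnbhs0_le; rewrite !divr_gt0.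
  rewrite /= [k *: 1]mulr1 /GRing.scale/=.
  set x := h * (k + S) ^+ 2.
  have x0 : 0 <= x by rewrite mulr_ge0 ?sqr_ge0// ltW.
  have xr : x - r = k * (h * (2 * S + k)) by rewrite /x /r; ring.
  have S2 : `|2 * S + k| <= 2 * `|S| + 1.
    by rewrite (le_trans (ler_normD _ _))// normrM ger0_norm// lerD2l.
  have xA : `|x - r| <= `|k| * A.
    by rewrite xr normrM ler_wpM2l// normrM gtr0_norm// ler_wpM2l// ltW.
  have xd : `|x - r| < d by apply: le_lt_trans xA _; rewrite -ltr_pdivlMr.
  have key : `|f x - f r - f' r * (x - r)| <= e / 2 * `|k|.
    have [->|xner] := eqVneq x r.
      by rewrite !subrr mulr0 subr0 normr0 mulr_ge0// divr_ge0// ltW.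
    apply: le_trans (dP x x0 xner xd) _.
    apply: le_trans (ler_wpM2l (ltW eA) xA) _.
    by rewrite mulrCA divfK ?gt_eqF// mulrC.
  rewrite -(ler_pM2l kn) -normrM mulrBr mulVKf//.
  have -> : k * (2 * h * S * f' r) - (f x - f r) =
     - (f x - f r - f' r * (x - r)) - k * (k * (h * f' r)) by rewrite xr; ring.
  apply: le_trans (ler_normB _ _) _; rewrite normrN.
  have : `|k * (k * (h * f' r))| <= `|k| * (e / 2).
    rewrite normrM ler_wpM2l// normrM [X in _ * X]ger0_norm ?mulr_ge0// ?(ltW h0)//.
    apply: (@le_trans _ _ (`|k| * B)); first by rewrite ler_wpM2l// /B lerDl.
    by rewrite -ler_pdivlMr.
  lra.
split; first by apply/cvg_ex; exists (2 * h * S * f' r).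
exact/cvg_lim.
Unshelve. all: by end_near.
Qed.

End potential_facts.

(** * Covering a swept set *)

Section sweep_cover.
Context {R : realType} {n : nat}.
Implicit Types (J : set 'rV[R]_n) (xi c z : 'rV[R]_n).

(* Unlike [ball], this is empty when r <= 0. *)
Definition cube c (r : R) : set 'rV[R]_n := [set x : 'rV[R]_n | forall i, `|x ord0 i - c ord0 i| < r].

Lemma cube_ball c r : 0 < r -> cube c r = ball c r.
Proof.
move=> r0; rewrite ball_rVE//; apply/seteqP.
by split => x /= h i; [rewrite distrC|rewrite distrC]; exact: h.
Qed.

Lemma cube_open c r : open (cube c r).
Proof.
have [r0|r0] := ltP 0 r.
  by rewrite cube_ball//; exact: ball_open.
have [n0|n0] := posnP n.
  rewrite (_ : cube c r = setT); first exact: openT.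
  apply/seteqP; split => // x _ i.
  by have : (i < 0)%N by rewrite -n0; exact: ltn_ord.
rewrite (_ : cube c r = set0); first exact: open0.
rewrite -subset0 => x /(_ (Ordinal n0)) h.
by have := le_lt_trans (normr_ge0 _) h; rewrite ltNge r0.
Qed.

Lemma measurable_cube c r : measurable (cube c r).
Proof. by apply: open_measurable_rV; exact: cube_open. Qed.

Lemma lebesgueD_cube0 c r : (0 < n)%N -> 0 <= r -> lebesgueD n (cube c r) = ((r *+ 2) ^+ n)%:E.
Proof.
move=> n0; rewrite le_eqVlt => /predU1P[<-|r0]; last by rewrite cube_ball// lebesgueD_cube.
rewrite mul0rn expr0n gtn_eqF// (_ : cube c 0 = set0) ?measure0//.
rewrite -subset0 => x /(_ (Ordinal n0)) h.
by have := le_lt_trans (normr_ge0 _) h; rewrite ltxx.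
Qed.

(** J is covered by sets of diameters d_k <= h = |xi| with controlled sum of d_k^(n-1). Sweeping the
    k-th one along xi takes about h / r_k cubes of radius 2 r_k, where r_k is d_k slightly enlarged:
    a volume of order h r_k^(n-1). The sum is h times a bound on the Hausdorff premeasure, hence
    linear in h with C independent of xi. *)
Lemma sweep_cover J : (1 < n)%N -> (hausdorff n.-1 J < +oo)%E ->
  exists2 C : R, 0 <= C & forall xi, xi != 0 ->
    exists (c : nat -> 'rV[R]_n) (r : nat -> R),
      (forall z s, J z -> 0 <= s <= 1 -> exists m, cube (c m) (r m) (z - s *: xi)) /\
      (lebesgueD n (\bigcup_m cube (c m) (r m)) <= (C * enorm xi)%:E)%E.
Proof.
move=> n1 Hfin; have n0 : (0 < n)%N by exact: ltnW.
have H0 : (0 <= hausdorff n.-1 J)%E by exact: (outer_measure_ge0 (hausdorff_outer R n n.-1)).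
pose M := fine (hausdorff n.-1 J) + 1.
have ME : (M%:E = hausdorff n.-1 J + 1)%E by rewrite EFinD fineK// ge0_fin_numE.
have M0 : 0 <= M by rewrite addr_ge0// fine_ge0.
pose w := ball_volume R n.-1.
have w0 : 0 < w by exact: ball_volume_gt0.
(* 4^n: volume of a cube of side 4 r_k. 5: (N k + 1) r_k <= h + 2 r_k <= 5 h. First 2^(n-1): power
   of the sum d_k + sm k. 2^(n-1) / w: from gauge to d_k^(n-1). The final 1 bounds the sum of the
   (sm k)^(n-1). *)
pose C := 4 ^+ n * 5 * (2 ^+ n.-1 * (2 ^+ n.-1 / w * M + 1)).
exists C.
  by rewrite !mulr_ge0 ?exprn_ge0 ?addr_ge0 ?mulr_ge0 ?exprn_ge0 ?invr_ge0// ltW.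
move=> xi xi0; set h := enorm xi; have h0 : 0 < h by rewrite enorm_gt0.
have [F [JF Fh] FM] : exists2 F : (set 'rV[R]_n)^nat,
    J `<=` \bigcup_k F k /\ (forall k, ediam (F k) <= h%:E)%E &
    (\sum_(k <oo) hausdorff_gauge n.-1 (F k) <= M%:E)%E.
  have pfin : hausdorff_pre n.-1 h J \is a fin_num.
    rewrite ge0_fin_numE; first exact: le_lt_trans (hausdorff_pre_le _ _ h0) Hfin.
    by apply: le_ereal_inf_tmp => _ [F _ <-]; apply: nneseries_ge0 => *; exact: hausdorff_gauge_ge0.
  have [_ [F FP <-] FM] := lb_ereal_inf_adherent (@ltr01 R) pfin.
  exists F => //; apply/ltW/(lt_le_trans FM).
  by rewrite ME; apply: leeD2r; exact: hausdorff_pre_le.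
pose d k := fine (ediam (F k)).
have d0 k : 0 <= d k.
  rewrite /d; have [->|/set0P[x Fx]] := eqVneq (F k) set0; first by rewrite ediam_set0.
  by rewrite fine_ge0// (le_trans _ (ediam_ub Fx Fx))// lee_fin enorm_ge0.
have diamfin k x : F k x -> ediam (F k) = (d k)%:E.
  move=> Fx; rewrite /d fineK// fin_numElt; apply/andP; split.
    by apply: lt_le_trans (ediam_ub Fx Fx); rewrite ltNyr.
  by apply: le_lt_trans (Fh k) _; rewrite ltry.
have dh k : d k <= h.
  have [Fk0|/set0P[x Fx]] := eqVneq (F k) set0; first by rewrite /d Fk0 ediam_set0 ltW.
  by rewrite -lee_fin -(diamfin _ _ Fx).
have dg k : ((d k ^+ n.-1)%:E <= (2 ^+ n.-1 / w)%:E * hausdorff_gauge n.-1 (F k))%E.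
  rewrite /hausdorff_gauge; case: eqP => [Fk0|_].
    by rewrite mule0 /d Fk0 ediam_set0/= expr0n lee_fin; case: n n1 {F JF Fh FM d d0 diamfin dh Fk0 xi xi0 h h0 C w w0 M M0 ME H0 n0 J Hfin}=> [|[]].
  rewrite -EFinM lee_fin -/(d k) -/w le_eqVlt; apply/orP; left; apply/eqP.
  by rewrite exprMn exprVn; field; rewrite !gt_eqF ?exprn_gt0.
(* Some d_k may vanish. The enlargement is positive, summable, and capped at h so that r_k <= 2
   h. *)
pose sm k := Num.min h (2^-1 ^+ k.+1).
have sm0 k : 0 < sm k by rewrite lt_min h0 exprn_gt0.
pose rr k := d k + sm k.
have rr0 k : 0 < rr k by rewrite ltr_wpDl.
have smh k : sm k <= h by rewrite ge_min lexx.
have rrh k : rr k <= 2 * h by have := dh k; have := smh k; rewrite /rr; lra.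
(* Number of pieces of the segment: each has length h / N k <= r_k. *)
pose N k := (Num.truncn (h / rr k)).+1.
have N1 k : h / rr k <= (N k)%:R.
  by apply/ltW; have /andP[_] := truncn_itv (divr_ge0 (ltW h0) (ltW (rr0 k))).
have N2 k : (N k)%:R <= h / rr k + 1.
  by have /andP[hN _] := truncn_itv (divr_ge0 (ltW h0) (ltW (rr0 k))); rewrite /N -natr1 lerD2r.
have N0 k : 0 < (N k)%:R :> R by rewrite ltr0n.
have [zz zzP] : {zz : nat -> 'rV[R]_n & forall k x, F k x -> F k (zz k)}.
  apply: (@choice _ _ (fun k z => forall x, F k x -> F k z)) => k.
  by have [Fk0|/set0P[x Fx]] := eqVneq (F k) set0; [exists 0 => x; rewrite Fk0|exists x].
pose cc k j := zz k - (j%:R / (N k)%:R) *: xi.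
pose c m := if unpickle m is Some (k, j) then cc k j else 0.
pose r m := if unpickle m is Some (k, j) then (if (j <= N k)%N then 2 * rr k else 0) else 0 : R.
exists c, r; split.
  move=> z s Jz /andP[s0 s1]; have [k _ Fz] := JF z Jz.
  have sN : 0 <= s * (N k)%:R by rewrite mulr_ge0.
  pose j := Num.truncn (s * (N k)%:R).
  have /andP[j1 j2] := truncn_itv sN.
  have jN : (j <= N k)%N.
    by rewrite -(ler_nat R) (le_trans j1)// ler_piMl.
  exists (pickle (k, j)); rewrite /c /r pickleK jN => i.
  have /le_lt_trans := norm_coord_enorm (z - s *: xi - cc k j) i; rewrite !mxE; apply.
  (* At most d_k within [F k] and at most r_k along xi; the total stays below 2 r_k since [sm k] is
     positive. *)
  have -> : z - s *: xi - cc k j = (z - zz k) + (j%:R / (N k)%:R - s) *: xi.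
    by apply/rowP => l; rewrite !mxE; ring.
  apply: le_lt_trans (ler_enormD _ _) _; rewrite enormZ -/h.
  have e1 : enorm (z - zz k) <= d k.
    by rewrite -lee_fin -(diamfin _ _ Fz); apply: ediam_ub => //; exact: zzP Fz.
  have e2 : `|j%:R / (N k)%:R - s| * h <= rr k.
    have : `|j%:R / (N k)%:R - s| <= (N k)%:R^-1.
      rewrite distrC ger0_norm; last by rewrite subr_ge0 ler_pdivrMr.
      by rewrite -(ler_pM2r (N0 k)) mulrBl divfK ?gt_eqF// mulVf ?gt_eqF// lerBlDl natr1 ltW.
    move=> /(ler_wpM2r (ltW h0))/le_trans; apply.
    by rewrite mulrC ler_pdivrMr// mulrC -ler_pdivrMr.
  by have := sm0 k; move: e1 e2; rewrite /rr; lra.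
have -> : \bigcup_m cube (c m) (r m) = \bigcup_k \big[setU/set0]_(j < (N k).+1) cube (cc k j) (2 * rr k).
  apply/seteqP; split => x.
    move=> [m _]; rewrite /c /r; case: unpickle => [[k j]|] h1.
      have jN : (j <= N k)%N.
        rewrite leqNgt; apply/negP => Nj; move: h1; rewrite leqNgt Nj/= => /(_ (Ordinal n0)) h2.
        by have := le_lt_trans (normr_ge0 _) h2; rewrite ltxx.
      exists k => //; rewrite -(bigcup_mkord _ (fun j => cube (cc k j) (2 * rr k))); exists j; first by rewrite /= ltnS.
      by move: h1; rewrite jN.
    by have := le_lt_trans (normr_ge0 _) (h1 (Ordinal n0)); rewrite ltxx.
  move=> [k _]; rewrite -(bigcup_mkord _ (fun j => cube (cc k j) (2 * rr k))) => -[j /= jN h1]; exists (pickle (k, j)) => //.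
  by rewrite /c /r pickleK -ltnS jN.
have mk k : measurable (\big[setU/set0]_(j < (N k).+1) cube (cc k j) (2 * rr k)).
  by apply: bigsetU_measurable => j _; exact: measurable_cube.
apply: le_trans (measure_sigma_subadditive _ mk (bigcupT_measurable _ mk) (@subset_refl _ _)) _.
apply: (@le_trans _ _ (\sum_(k <oo) ((4 ^+ n * 5 * h)%:E * (rr k ^+ n.-1)%:E))%E).
  apply: lee_nneseries => [k _ _|k _]; first exact: measure_ge0.
  have /le_trans := @le_mu_bigsetU _ _ _ (lebesgueD n) (fun j => cube (cc k j) (2 * rr k)) (N k).+1
    (fun j _ => measurable_cube _ _).
  apply.
  rewrite (eq_bigr (fun=> ((4 * rr k) ^+ n)%:E)); last first.
    move=> j _; rewrite [LHS]lebesgueD_cube0// ?mulr_ge0// ?(ltW (rr0 k))//.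
    by congr ((_ ^+ _)%:E); ring.
  rewrite sumEFin sumr_const card_ord -EFinM lee_fin -[leLHS]mulr_natl exprMn.
  have -> : rr k ^+ n = rr k * rr k ^+ n.-1 by rewrite -exprS prednK.
  have key : (N k).+1%:R * rr k <= 5 * h.
    have : (N k)%:R * rr k <= h + rr k.
      by have := N2 k; rewrite -(ler_pM2r (rr0 k)) mulrDl divfK ?gt_eqF// mul1r.
    by have := rrh k; rewrite -natr1; lra.
  have -> : (N k).+1%:R * (4 ^+ n * (rr k * rr k ^+ n.-1)) =
    4 ^+ n * ((N k).+1%:R * rr k * rr k ^+ n.-1) by ring.
  have -> : 4 ^+ n * 5 * h * rr k ^+ n.-1 = 4 ^+ n * (5 * h * rr k ^+ n.-1) by ring.
  rewrite ler_wpM2l ?exprn_ge0// ler_wpM2r ?exprn_ge0 ?(ltW (rr0 k))//.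
rewrite nneseriesZl; last by move=> k _; rewrite lee_fin exprn_ge0// ltW.
have -> : (C * h)%:E = ((4 ^+ n * 5 * h)%:E * (2 ^+ n.-1 * (2 ^+ n.-1 / w * M + 1))%:E)%E.
  by rewrite -EFinM /C; congr EFin; ring.
apply: lee_wpmul2l.
  by rewrite lee_fin !mulr_ge0 ?exprn_ge0 ?(ltW h0).
apply: (@le_trans _ _ (\sum_(k <oo) ((2 ^+ n.-1)%:E *
    ((2 ^+ n.-1 / w)%:E * hausdorff_gauge n.-1 (F k) + (2^-1 * 2^-1 ^+ k)%:E)))%E).
  apply: lee_nneseries => [k _ _|k _]; first by rewrite lee_fin exprn_ge0// ltW.
  apply: (@le_trans _ _ ((2 ^+ n.-1)%:E * ((d k ^+ n.-1)%:E + (2^-1 * 2^-1 ^+ k)%:E))%E); last first.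
    by apply: lee_wpmul2l; [rewrite lee_fin exprn_ge0|exact: leeD2r].
  rewrite -EFinD -EFinM lee_fin.
  have s1 : sm k ^+ n.-1 <= 2^-1 * 2^-1 ^+ k.
    rewrite -exprS; have : sm k <= 2^-1 ^+ k.+1 by rewrite ge_min lexx orbT.
    apply: le_trans; rewrite -[leRHS]expr1; apply: ler_wiXn2l; rewrite ?(ltW (sm0 k))//.
      apply: (@le_trans _ _ (2^-1 ^+ k.+1 : R)); first by rewrite ge_min lexx orbT.
      by rewrite exprn_ile1// invf_le1// ler1n.
    by rewrite -ltnS prednK.
  apply: (@le_trans _ _ (2 ^+ n.-1 * (d k ^+ n.-1 + sm k ^+ n.-1))); last by rewrite ler_wpM2l ?exprn_ge0// lerD2l.
  have dp : 0 <= d k ^+ n.-1 by rewrite exprn_ge0.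
  have sp : 0 <= sm k ^+ n.-1 by rewrite exprn_ge0// ltW.
  have [ds|sd] := leP (d k) (sm k).
    apply: (@le_trans _ _ ((2 * sm k) ^+ n.-1)).
      rewrite lerXn2r// ?nnegrE ?(ltW (rr0 k)) ?mulr_ge0 ?(ltW (sm0 k))//.
      by rewrite /rr; lra.
    by rewrite exprMn ler_wpM2l ?exprn_ge0// lerDr.
  apply: (@le_trans _ _ ((2 * d k) ^+ n.-1)).
    rewrite lerXn2r// ?nnegrE ?(ltW (rr0 k)) ?mulr_ge0//.
    by rewrite /rr; lra.
  by rewrite exprMn ler_wpM2l ?exprn_ge0// lerDl.
have g0 k : (0 <= (2 ^+ n.-1 / w)%:E * hausdorff_gauge n.-1 (F k))%E.
  by rewrite mule_ge0 ?hausdorff_gauge_ge0// lee_fin divr_ge0 ?exprn_ge0// ltW.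
have p0 k : (0 <= (2^-1 * 2^-1 ^+ k : R)%:E)%E by rewrite lee_fin mulr_ge0// exprn_ge0.
rewrite nneseriesZl; last by move=> k _; rewrite adde_ge0.
rewrite [(2 ^+ n.-1 * (_ + 1))%:E]EFinM; apply: lee_wpmul2l; first by rewrite lee_fin exprn_ge0.
rewrite nneseriesD// EFinD; apply: leeD.
  rewrite nneseriesZl; last by move=> k _; exact: hausdorff_gauge_ge0.
  rewrite [(_ * M)%:E]EFinM; apply: lee_wpmul2l => //.
  by rewrite lee_fin divr_ge0 ?exprn_ge0// ltW.
rewrite nneseries_geometric//; last by lra.
have -> : 1 - 2^-1 = 2^-1 :> R by lra.
by rewrite divff.
Qed.

End sweep_cover.

(** * The strain identity along a direction *)

Section orthant_uniqueness.
Context {R : realType} {n : nat}.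
Local Notation V := 'rV[R]_n.

Definition orthant (c : V) : set V := [set x | forall i, x ord0 i < c ord0 i].

Lemma measurable_orthant (c : V) : measurable (orthant c).
Proof.
rewrite (_ : orthant c = [set x : V | forall i, `]-oo, c ord0 i[%classic (x ord0 i)]).
  exact: (@measurable_rV_forall _ n (fun i => `]-oo, c ord0 i[%classic)).
by apply/seteqP; split => x /= h i; have := h i; rewrite in_itv/=.
Qed.

Lemma orthant_generate : @measurable _ V = <<s range orthant >>.
Proof.
apply/seteqP; split; last first.
  apply: smallest_sub; first exact: sigma_algebra_measurable.
  by move=> _ [c _ <-]; exact: measurable_orthant.
pose T := g_sigma_algebraType (range orthant).
have mcoord (i : 'I_n) : measurable_fun [set: T] (fun x : V => x ord0 i).
  apply: measurability; first exact: RGenInftyO.measurableE.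
  move=> _ [A [t ->] <-]; rewrite setTI.
  rewrite (_ : _ @^-1` _ = \bigcup_(N : nat) orthant (\row_j if j == i then t else N%:R)).
    apply: bigcupT_measurable => N; apply: sub_sigma_algebra.
    by exists (\row_j if j == i then t else N%:R).
  apply/seteqP; split => x /=; rewrite in_itv/=.
    move=> xt; pose N := Num.bound (\sum_j `|x ord0 j|).
    exists N => // j; rewrite mxE; case: eqP => [->//|_].
    apply: le_lt_trans (_ : \sum_j `|x ord0 j| < _); last first.
      by apply: archi_boundP; exact: sumr_ge0.
    rewrite (le_trans (ler_norm _))// (bigD1 j)//= lerDl; exact: sumr_ge0.
  by move=> [N _ /(_ i)]; rewrite mxE eqxx.
apply: smallest_sub; first exact: (@sigma_algebra_measurable _ T).
rewrite -bigcup_seq => B [i _ [C mC <-]].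
exact: mcoord.
Qed.

Lemma setI_closed_orthant : setI_closed (range orthant).
Proof.
move=> _ _ [a _ <-] [b _ <-]; exists (\row_i Num.min (a ord0 i) (b ord0 i)) => //.
apply/seteqP; split => x /=.
  by move=> h; split => i; have := h i; rewrite mxE lt_min => /andP[].
by move=> [h1 h2] i; rewrite mxE lt_min h1 h2.
Qed.

Lemma bigcup_orthant : \bigcup_N orthant (\row_i N%:R) = setT.
Proof.
apply/seteqP; split => // x _; exists (Num.bound (\sum_j `|x ord0 j|)) => // i.
rewrite mxE; apply: le_lt_trans (_ : \sum_j `|x ord0 j| < _); last first.
  by apply: archi_boundP; exact: sumr_ge0.
rewrite (le_trans (ler_norm _))// (bigD1 i)//= lerDl; exact: sumr_ge0.
Qed.

(** The positive and negative parts of k are densities of two measures, finite and equal on the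
    orthants, which form a generating pi-system; so they agree on all Borel sets. Orthants are
    chosen because smooth products approximate their indicators. *)
Lemma orthant_integral_eq0 (k : V -> R) :
  (lebesgueD n).-integrable setT (EFin \o k) ->
  (forall c, \int[lebesgueD n]_(x in orthant c) (k x)%:E = 0)%E ->
  {ae lebesgueD n, forall x, k x = 0}.
Proof.
move=> ik k0.
have mk : measurable_fun setT (EFin \o k) by exact: measurable_int ik.
have mkp : measurable_fun setT ((EFin \o k)^\+)%E by exact: measurable_funepos.
have mkn : measurable_fun setT ((EFin \o k)^\-)%E by exact: measurable_funeneg.
pose mp (A : set V) := (\int[lebesgueD n]_(x in A) (EFin \o k)^\+ x)%E.
pose mn (A : set V) := (\int[lebesgueD n]_(x in A) (EFin \o k)^\- x)%E.
have mp0 : mp set0 = 0%E by rewrite /mp integral_set0.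
have mn0 : mn set0 = 0%E by rewrite /mn integral_set0.
have mp_ge0 A : (0 <= mp A)%E by exact: integral_ge0.
have mn_ge0 A : (0 <= mn A)%E by exact: integral_ge0.
have mpS : semi_sigma_additive mp.
  by apply: semi_sigma_additive_nng_induced => // x; exact: funepos_ge0.
have mnS : semi_sigma_additive mn.
  by apply: semi_sigma_additive_nng_induced => // x; exact: funeneg_ge0.
pose mixp := isMeasure.Build _ _ _ mp mp0 mp_ge0 mpS.
pose mixn := isMeasure.Build _ _ _ mn mn0 mn_ge0 mnS.
pose Mp : {measure set V -> \bar R} := HB.pack mp mixp.
pose Mn : {measure set V -> \bar R} := HB.pack mn mixn.
have fin A : measurable A -> (lebesgueD n).-integrable A (EFin \o k).
  by move=> mA; exact: integrableS ik.
have E A : measurable A -> Mp A = Mn A.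
  apply: (@measure_unique _ R V (range orthant) (fun N => orthant (\row_i N%:R))).
  - exact: orthant_generate.
  - exact: setI_closed_orthant.
  - by move=> N; eexists.
  - exact: bigcup_orthant.
  - move=> _ [c _ <-]; rewrite /Mp /Mn /= /mp /mn.
    have := k0 c; rewrite integralE => /eqP.
    have f1 := integrable_pos_fin_num (measurable_orthant c) (fin _ (measurable_orthant c)).
    have f2 := integrable_neg_fin_num (measurable_orthant c) (fin _ (measurable_orthant c)).
    by rewrite sube_eq// ?add0e ?fin_num_adde_defr// => /eqP.
  - move=> N; rewrite /Mp/= /mp -ge0_fin_numE; last exact: mp_ge0.
    have mo : measurable (orthant (\row__ N%:R : V)) by exact: measurable_orthant.
    have := integrable_pos_fin_num mo (fin _ mo); exact.
have : ae_eq (lebesgueD n) setT (EFin \o k) (cst 0%E).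
  apply: (integral_ae_eq measurableT ik); first exact: measurable_cst.
  move=> B _ mB; rewrite integral0 integralE.
  have := E B mB; rewrite /Mp /Mn /= /mp /mn => ->.
  by rewrite subee//; apply: integrable_neg_fin_num => //; exact: fin.
by apply: filterS => x /(_ I) /= [].
Qed.

End orthant_uniqueness.

(** * Translations, shears and line integrals *)

Section shift_integral.
Context {R : realType} {n : nat}.
Local Notation V := 'rV[R]_n.

Lemma integral_shift (f : V -> \bar R) (c : V) : measurable_fun setT f ->
  (\int[lebesgueD n]_x f (x + c)%R = \int[lebesgueD n]_x f x)%E.
Proof.
move=> mf; rewrite integralE [in RHS]integralE.
rewrite -(ge0_integral_shift c (measurable_funepos mf))//.
rewrite -(ge0_integral_shift c (measurable_funeneg mf))//.
by congr (_ - _)%E; apply: eq_integral => x _; rewrite ?funepos.unlock ?funeneg.unlock.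
Qed.

Lemma measurable_fun_shift d (T : measurableType d) (f : V -> T) (c : V) : measurable_fun setT f ->
  measurable_fun setT (fun x : V => f (x + c)).
Proof. by move=> mf; apply: measurableT_comp mf _; exact: measurable_rVD. Qed.

Lemma integrable_shift (f : V -> \bar R) (c : V) :
  (lebesgueD n).-integrable setT f -> (lebesgueD n).-integrable setT (fun x : V => f (x + c)).
Proof.
move=> /integrableP[mf foo]; apply/integrableP; split; first exact: measurable_fun_shift.
have mg : measurable_fun setT (abse \o f) by exact: measurableT_comp mf.
by have := ge0_integral_shift c mg (fun=> abse_ge0 _); rewrite /= => ->.
Qed.

End shift_integral.

Section sheared_fubini.
Context {R : realType} {n : nat}.
Local Notation V := 'rV[R]_n.
Local Notation mR := (measurableTypeR R).
Implicit Types (xi : V).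

Lemma measurable_shear xi :
  measurable_fun setT (fun p : V * mR => (p.1 + p.2 *: xi, p.2) : V * mR).
Proof.
apply: measurable_fun_pair; last exact: measurable_snd.
apply/measurable_fun_rVP => i; under eq_fun do rewrite !mxE.
apply: measurable_funD; first exact: measurableT_comp (measurable_rV_coord i) measurable_fst.
by apply: measurable_funM => //; exact: measurable_snd.
Qed.

Lemma sheared_integrable xi (F : V * mR -> \bar R) :
  (lebesgueD n \x @lebesgue_measure R)%E.-integrable setT F ->
  (lebesgueD n \x @lebesgue_measure R)%E.-integrable setT
    (fun p : V * mR => F (p.1 + p.2 *: xi, p.2)).
Proof.
move=> iF; have mF := measurable_int _ iF.
have mF' : measurable_fun setT (fun p : V * mR => F (p.1 + p.2 *: xi, p.2)).
  exact: measurableT_comp mF (measurable_shear xi).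
have := proj1 (integrable21ltyP _ _ mF) iF.
suff -> : (\int[lebesgue_measure]_s \int[lebesgueD n]_x `|F (x, s)| =
    \int[lebesgue_measure]_s \int[lebesgueD n]_x `|F ((x + s *: xi)%R, s)|)%E.
  exact: (proj2 (integrable21ltyP _ _ mF')).
apply: eq_integral => s _.
have mg : measurable_fun setT (fun x : V => `|F (x, s)|%E).
  apply: measurableT_comp => //; exact: measurableT_comp mF (measurable_pair2 s).
by have := ge0_integral_shift (s *: xi) mg (fun=> abse_ge0 _).
Qed.

(** For fixed s the shear is a translation of x, which preserves Lebesgue measure; Fubini's theorem
    allows integrating in x before s. *)
Lemma sheared_fubini xi (F : V * mR -> \bar R) :
  (lebesgueD n \x @lebesgue_measure R)%E.-integrable setT F ->
  (\int[lebesgueD n]_x \int[lebesgue_measure]_s F ((x + s *: xi)%R, s) =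
   \int[lebesgueD n]_x \int[lebesgue_measure]_s F (x, s))%E.
Proof.
move=> iF; have iF' := sheared_integrable xi iF.
rewrite (Fubini iF) (Fubini iF'); apply: eq_integral => s _ /=.
have mg : measurable_fun setT (fun x : V => F (x, s)).
  exact: measurableT_comp (measurable_int _ iF) (measurable_pair2 s).
exact: (integral_shift (s *: xi) mg).
Qed.

Local Notation I01 h := (\int[lebesgue_measure]_(s in `[0%R, 1%R]) h s)%R.

Section along_direction.
Variables (e phi : V -> R) (L : R) (xi : V).
Hypotheses (ie : (lebesgueD n).-integrable setT (EFin \o e))
  (mphi : measurable_fun setT phi) (phiL : forall x, `|phi x| <= L).

Let one (s : R) : R := \1_`[0%R, 1%R] s.
Let F (p : V * mR) : \bar R := (e p.1 * phi (p.1 - p.2 *: xi) * one p.2)%:E.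

Let me : measurable_fun setT e.
Proof. by have /measurable_EFinP := measurable_int _ ie. Qed.

Let mF : measurable_fun setT F.
Proof.
apply/measurable_EFinP; apply: measurable_funM; first apply: measurable_funM.
- exact: measurableT_comp me measurable_fst.
- apply: measurableT_comp mphi _; apply/measurable_fun_rVP => i; under eq_fun do rewrite !mxE.
  apply: measurable_funB; first exact: measurableT_comp (measurable_rV_coord i) measurable_fst.
  by apply: measurable_funM => //; exact: measurable_snd.
- exact: measurableT_comp (measurable_indic _) measurable_snd.
Qed.

Lemma integrable_along : (lebesgueD n \x @lebesgue_measure R)%E.-integrable setT F.
Proof.
apply/(integrable12ltyP _ _ mF); have L0 : 0 <= L by apply: le_trans (phiL 0).
apply: (@le_lt_trans _ _ (\int[lebesgueD n]_x (L%:E * `|(e x)%:E|))%E).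
  apply: ge0_le_integral => //.
  - by move=> x _; exact: integral_ge0.
  - by apply: (@measurable_fun_fubini_tonelli_F _ _ _ _ _ _ (fun p => `|F p|%E)) => //; exact: measurableT_comp.
  - by apply: measurable_funeM; apply: measurableT_comp => //; exact/measurable_EFinP.
  move=> x _; apply: (@le_trans _ _ (\int[lebesgue_measure]_y (((L * `|e x|)%:E) * (one y)%:E))%E).
    apply: ge0_le_integral => //.
    - apply: measurableT_comp => //; exact: measurableT_comp mF (measurable_pair1 x).
    - by apply: measurable_funeM; apply/measurable_EFinP; exact: measurable_indic.
    move=> y _; rewrite /F/= lee_fin !normrM -mulrA mulrCA mulrA.
    rewrite [`|one y|]ger0_norm /one ?indicE// ler_wpM2r// ler_wpM2r//.
  rewrite ge0_integralZl//; last 3 first.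
  - by apply/measurable_EFinP; exact: measurable_indic.
  - by move=> y _; rewrite lee_fin /one indicE.
  - by rewrite lee_fin mulr_ge0.
  rewrite integral_indic// setIT /= lebesgue_measure_itv/= lte_fin ltr01 oppr0 adde0 mule1.
  by rewrite EFinM.
rewrite ge0_integralZl//; last first.
- by apply: measurableT_comp => //; exact/measurable_EFinP.
- by move/integrableP: ie => [_ ?]; rewrite lte_mul_pinfty.
Qed.

Lemma integral_along : (\int[lebesgueD n]_z (e z * avg phi xi z)%:E =
  \int[lebesgueD n]_z \int[lebesgue_measure]_s F (z, s))%E.
Proof.
apply: eq_integral => z _.
have ip : lebesgue_measure.-integrable `[0, 1] (EFin \o (fun s : R => phi (z - s *: xi))).
  apply: (@integrable01 _ _ L) => //; exact: measurableT_comp mphi (measurable_line _ _).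
transitivity (\int[lebesgue_measure]_(s in `[0%R, 1%R]) ((e z)%:E * (phi (z - s *: xi))%:E))%E.
  by rewrite integralZl// EFinM /avg /Rintegral fineK//; exact: integrable_fin_num.
rewrite integral_mkcond; apply: eq_integral => s _.
by rewrite epatch_indic /= /F/= !EFinM.
Qed.

Lemma integral_along_shift : (\int[lebesgueD n]_z (e z * avg phi xi z)%:E =
  \int[lebesgueD n]_x \int[lebesgue_measure]_s (e (x + s *: xi) * phi x * one s)%:E)%E.
Proof.
rewrite integral_along -(sheared_fubini xi integrable_along).
by apply: eq_integral => x _; apply: eq_integral => s _; rewrite /F/= addrK.
Qed.

End along_direction.

(** The case phi = 1 of [integrable_along], sheared: Fubini's theorem makes e integrable on almost
    every segment, and the line integrals integrable in the starting point. *)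
Lemma line_average (e : V -> R) xi : (lebesgueD n).-integrable setT (EFin \o e) ->
  {ae lebesgueD n, forall x, lebesgue_measure.-integrable `[0%R, 1%R] (EFin \o (fun s : R => e (x + s *: xi)))} /\
  (lebesgueD n).-integrable setT (EFin \o (fun x => I01 (fun s : R => e (x + s *: xi)))).
Proof.
move=> ie.
have m1 : measurable_fun setT (cst 1 : V -> R) by exact: measurable_cst.
have b1 (x : V) : `|cst (1 : R) x| <= 1 by rewrite normr1.
have iF := sheared_integrable xi (integrable_along xi ie m1 b1).
have aeF : {ae lebesgueD n, forall x, lebesgue_measure.-integrable `[0%R, 1%R]
    (EFin \o (fun s : R => e (x + s *: xi)))}.
  have := ae_integrable1 iF; apply: filterS => x h.
  apply/integrable_mkcond => //; apply: eq_integrable h => //= s _.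
  by rewrite epatch_indic/= mulr1 EFinM.
split => //.
have /integrableP[mG foo] := integrable_fubini_F iF.
rewrite (_ : EFin \o _ = EFin \o (fine \o fubini_F (@lebesgue_measure R)
    (fun p : V * mR => (e (p.1 + p.2 *: xi, p.2).1 *
           cst 1 ((p.1 + p.2 *: xi, p.2).1 - (p.1 + p.2 *: xi, p.2).2 *: xi) *
           \1_`[0, 1] (p.1 + p.2 *: xi, p.2).2)%:E))); last first.
  apply/funext => x /=; congr EFin; rewrite /fubini_F /Rintegral integral_mkcond; congr fine.
  by apply: eq_integral => s _; rewrite epatch_indic/= mulr1 EFinM.
apply/integrableP; split.
  by apply/measurable_EFinP; exact: measurableT_comp.
apply: le_lt_trans foo; apply: ge0_le_integral => //.
- by apply: measurableT_comp => //; apply/measurable_EFinP; exact: measurableT_comp.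
- exact: measurableT_comp.
- by move=> x _ /=; case: (fubini_F _ _ _) => [r| |] //=; rewrite normr0 leey.
Qed.


(** Averaging along -xi is the adjoint of averaging along xi; the shear moves the displacement from
    phi to e. *)
Lemma Rintegral_avg (e phi : V -> R) (L : R) xi : (lebesgueD n).-integrable setT (EFin \o e) ->
  measurable_fun setT phi -> (forall x, `|phi x| <= L) ->
  \int[lebesgueD n]_x (e x * avg phi xi x) =
  \int[lebesgueD n]_x (I01 (fun s : R => e (x + s *: xi)) * phi x).
Proof.
move=> ie mphi phiL; rewrite /Rintegral (integral_along_shift _ ie mphi phiL); congr fine.
have [ae iI] := line_average xi ie.
have iF := sheared_integrable xi (integrable_along xi ie mphi phiL).
apply: ae_eq_integral => //.
- have := measurable_fubini_F iF; apply: eq_measurable_fun => x _.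
  by rewrite /fubini_F; apply: eq_integral => s _ /=; rewrite addrK.
- apply/measurable_EFinP; apply: measurable_funM => //.
  by apply/measurable_EFinP; exact: measurable_int iI.
apply: filterS ae => x h _.
transitivity (\int[lebesgue_measure]_(s in `[0%R, 1%R]) ((phi x)%:E * (e (x + s *: xi))%:E))%E.
  rewrite [RHS]integral_mkcond; apply: eq_integral => s _; rewrite epatch_indic/= !EFinM.
  by rewrite [((phi x)%:E * _)%E]muleC.
by rewrite integralZl// mulrC EFinM /Rintegral fineK//; exact: integrable_fin_num.
Qed.

End sheared_fubini.

Lemma Rintegral_sum d (T : measurableType d) (R : realType) (mu : {measure set T -> \bar R})
    (D : set T) (I : Type) (r : seq I) (f : I -> T -> R) : measurable D ->
  (forall i, mu.-integrable D (EFin \o f i)) ->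
  \int[mu]_(x in D) (\sum_(i <- r) f i x) = \sum_(i <- r) \int[mu]_(x in D) f i x.
Proof.
move=> mD fi; rewrite /Rintegral.
under eq_integral do rewrite -sumEFin.
rewrite (integral_sum mD fi) -sum_fine// => i _; exact: integrable_fin_num.
Qed.

Lemma integrable_mul_bounded d (T : measurableType d) (R : realType) (mu : {measure set T -> \bar R})
    (D : set T) (f h : T -> R) (L : R) : measurable D ->
  mu.-integrable D (EFin \o f) -> measurable_fun D h -> (forall x, D x -> `|h x| <= L) ->
  mu.-integrable D (EFin \o (fun x => f x * h x)).
Proof.
move=> mD fi mh hL; have := integrableMl mD fi mh.
rewrite (_ : (_ \* _)%E = EFin \o (fun x => f x * h x)); last by apply/funext => x /=; rewrite EFinM.
apply; exists L; split; first exact: num_real.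
by move=> M LM x Dx /=; rewrite (le_trans (hL _ Dx))// ltW.
Qed.

Lemma sym_contraction (R : realType) n (p q xi : 'rV[R]_n) :
  \sum_i \sum_j xi ord0 i * xi ord0 j *
    ((p ord0 i * q ord0 j + p ord0 j * q ord0 i) / 2) = dotv p xi * dotv q xi.
Proof.
pose A i j := p ord0 i * xi ord0 i * (q ord0 j * xi ord0 j).
have SA : dotv p xi * dotv q xi = \sum_i \sum_j A i j by rewrite /dotv big_distrlr.
transitivity ((\sum_i \sum_j A i j) / 2 + (\sum_i \sum_j A j i) / 2).
  rewrite !mulr_suml -big_split/=; apply: eq_bigr => i _.
  rewrite !mulr_suml -big_split/=; apply: eq_bigr => j _; rewrite /A; by field.
by rewrite [X in _ + X / _]exchange_big/= -SA; lra.
Qed.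

Lemma partial_C11 (R : realType) n (phi : 'rV[R]_n -> R) G i x : C11 phi G ->
  partial i phi x = G x ord0 i.
Proof.
move=> cphi; rewrite /partial; have h := C11_is_derive x (delta_mx ord0 i) cphi.
rewrite derive_val /dotv (bigD1 i)//= big1 ?addr0 ?[delta_mx _ _ _ _]mxE ?eqxx ?mulr1// => j ji.
by rewrite [delta_mx _ _ _ _]mxE (negbTE ji) mulr0.
Qed.

(** * Increments of u tested along a direction *)

Section increment.
Context {R : realType} {n : nat}.
Local Notation V := 'rV[R]_n.
Local Notation leb := (lebesgueD n).
Local Notation I01 h := (\int[lebesgue_measure]_(s in `[0%R, 1%R]) h s)%R.
Variables (D : set V) (u : V -> V) (E : V -> 'M[R]_n) (xi : V).
Hypotheses (mD : measurable D)
  (ui : forall i, leb.-integrable D (fun x => (u x ord0 i)%:E))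
  (Ei : forall i j, leb.-integrable D (fun x => (E x i j)%:E)).

Definition along_disp x : R := dotv (u x) xi * \1_D x.

Definition along_strain x : R :=
  (\sum_i \sum_j xi ord0 i * xi ord0 j * E x i j) * \1_D x.

(** Failure of the fundamental theorem of calculus for the component of u along xi, between x and x
    + xi: the trace that the jumps leave. *)
Definition increment_defect x : R :=
  along_disp (x + xi) - along_disp x - I01 (fun s : R => along_strain (x + s *: xi)).

Let integrable_cut (f : V -> R) : leb.-integrable D (EFin \o f) ->
  leb.-integrable setT (EFin \o (fun x => f x * \1_D x)).
Proof.
by move=> /(integrable_mkcond _ mD) h; apply: eq_integrable h => // x _; rewrite epatch_indic/= EFinM.
Qed.

Let Rintegral_cut (f : V -> R) :
  \int[leb]_(x in D) f x = \int[leb]_x (f x * \1_D x).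
Proof.
rewrite /Rintegral integral_mkcond; congr fine; apply: eq_integral => x _.
by rewrite epatch_indic/= EFinM.
Qed.

Lemma integrable_along_disp : leb.-integrable setT (EFin \o along_disp).
Proof.
apply: integrable_cut.
rewrite (_ : EFin \o _ = (fun x => \sum_i ((xi ord0 i)%:E * (u x ord0 i)%:E)%E)); last first.
  by apply/funext => x /=; rewrite -sumEFin; apply: eq_bigr => i _; rewrite -EFinM mulrC.
by apply: integrable_sum => // i _; exact: integrableZl.
Qed.

Lemma integrable_along_strain : leb.-integrable setT (EFin \o along_strain).
Proof.
apply: integrable_cut.
rewrite (_ : EFin \o _ = (fun x => \sum_i \sum_j ((xi ord0 i * xi ord0 j)%:E * (E x i j)%:E)%E)); last first.
  apply/funext => x /=; rewrite -sumEFin; apply: eq_bigr => i _.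
  by rewrite -sumEFin; apply: eq_bigr => j _; rewrite -EFinM.
by do 2! (apply: integrable_sum => // ? _); exact: integrableZl.
Qed.

Lemma integrable_along_shift : leb.-integrable setT (EFin \o (fun x => along_disp (x + xi))).
Proof. exact: (integrable_shift xi integrable_along_disp). Qed.

Lemma integrable_increment_defect : leb.-integrable setT (EFin \o increment_defect).
Proof.
have [_ h] := line_average xi integrable_along_strain.
have h1 := integrableB measurableT integrable_along_shift integrable_along_disp.
have h2 := integrableB measurableT h1 h.
by apply: eq_integrable h2 => // x _.
Qed.

(** The weak formulation with test function [avg phi xi] is contracted with xi_i xi_j. The
    symmetrized derivative collapses to the component of u times phi(x) - phi(x - xi), and the
    strain term to line integrals against phi. The numbers [jump i j] stand for the jump
    integrals. *)
Lemma increment_identity (jump : 'I_n -> 'I_n -> R) phi G : C11 phi G ->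
  (forall i j,
    - (\int[leb]_(x in D) ((u x ord0 i * partial j (avg phi xi) x +
                            u x ord0 j * partial i (avg phi xi) x) / 2)) =
    \int[leb]_(x in D) (E x i j * avg phi xi x) + jump i j) ->
  \int[leb]_x (increment_defect x * phi x) =
    \sum_i \sum_j xi ord0 i * xi ord0 j * jump i j.
Proof.
move=> cphi hj; have cavg := C11_avg xi cphi.
have [L [_ _ phiL _]] := cphi; have [M [_ _ avgM gradM]] := cavg.
have mphi := measurable_C11 cphi; have mavg := measurable_C11 cavg.
have pE i x : partial i (avg phi xi) x = avg_grad G xi x ord0 i by exact: partial_C11.
pose a i j := xi ord0 i * xi ord0 j.
have gradb i x : `|avg_grad G xi x ord0 i| <= M.
  by apply: le_trans (gradM x); exact: norm_coord_enorm.
have mgrad i : measurable_fun D (fun x => avg_grad G xi x ord0 i).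
  exact: measurable_funS (measurable_C11_grad i cavg).
have i1 i j : leb.-integrable D (EFin \o (fun x => u x ord0 i * avg_grad G xi x ord0 j)).
  exact: (integrable_mul_bounded mD (ui i) (mgrad j) (fun x _ => gradb j x)).
have i2 i j : leb.-integrable D (EFin \o (fun x => (u x ord0 i * avg_grad G xi x ord0 j
    + u x ord0 j * avg_grad G xi x ord0 i) / 2)).
  have h := integrableZl mD (2^-1) (integrableD mD (i1 i j) (i1 j i)).
  by apply: eq_integrable h => // x _; rewrite /= -EFinD -EFinM mulrC.
have i3 i j : leb.-integrable D (EFin \o (fun x => E x i j * avg phi xi x)).
  apply: (integrable_mul_bounded mD (Ei i j) _ (fun x _ => avgM x)).
  exact: measurable_funS mavg.
have i4 (f : 'I_n -> 'I_n -> V -> R) : (forall i j, leb.-integrable D (EFin \o f i j)) ->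
    \sum_i \sum_j a i j * (\int[leb]_(x in D) f i j x) =
    \int[leb]_(x in D) (\sum_i \sum_j a i j * f i j x).
  move=> fi; have aint i j : leb.-integrable D (EFin \o (fun x => a i j * f i j x)).
    by apply: eq_integrable (integrableZl mD (a i j) (fi i j)) => // x _; rewrite /= EFinM.
  rewrite Rintegral_sum//; last first.
    move=> i; rewrite (_ : EFin \o _ =
        (fun x : V => \sum_j (a i j * f i j x)%:E)).
      by apply: integrable_sum => // j _; exact: aint.
    by apply/funext => x /=; rewrite sumEFin.
  apply: eq_bigr => i _; rewrite Rintegral_sum//; apply: eq_bigr => j _.
  by rewrite RintegralZl//; exact: fi.
have -> : \sum_i \sum_j xi ord0 i * xi ord0 j * jump i j =
    - (\sum_i \sum_j a i j * (\int[leb]_(x in D) ((u x ord0 i * avg_grad G xi x ord0 j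
    + u x ord0 j * avg_grad G xi x ord0 i) / 2))) -
    \sum_i \sum_j a i j * (\int[leb]_(x in D) (E x i j * avg phi xi x)).
  rewrite -opprD -big_split/= -sumrN; apply: eq_bigr => i _.
  rewrite -big_split/= -sumrN; apply: eq_bigr => j _.
  have := hj i j; under eq_Rintegral do rewrite !pE.
  by rewrite -/(a i j) -mulrDr -mulrN opprD => ->; rewrite addrAC subrr add0r.
rewrite i4// i4//.
have -> : \int[leb]_(x in D) (\sum_i \sum_j a i j * ((u x ord0 i * avg_grad G xi x ord0 j
    + u x ord0 j * avg_grad G xi x ord0 i) / 2)) =
    \int[leb]_x (along_disp x * (phi x - phi (x - xi))).
  rewrite Rintegral_cut; apply: eq_Rintegral => x _.
  rewrite /along_disp mulrAC; congr (_ * _).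
  by rewrite -(avg_grad_direction xi x cphi) -sym_contraction.
have -> : \int[leb]_(x in D) (\sum_i \sum_j a i j * (E x i j * avg phi xi x)) =
    \int[leb]_x (I01 (fun s : R => along_strain (x + s *: xi)) * phi x).
  rewrite -(Rintegral_avg _ integrable_along_strain mphi phiL) Rintegral_cut.
  apply: eq_Rintegral => x _; rewrite /along_strain mulrAC; congr (_ * _).
  rewrite mulr_suml; apply: eq_bigr => i _; rewrite mulr_suml; apply: eq_bigr => j _.
  by rewrite mulrA.
have [_ iI] := line_average xi integrable_along_strain.
have bd (f : V -> R) : leb.-integrable setT (EFin \o f) ->
    leb.-integrable setT (EFin \o (fun x => f x * phi x)).
  by move=> fi; exact: (integrable_mul_bounded measurableT fi mphi (fun x _ => phiL x)).
(* Translation invariance moves the difference from phi to u. *)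
have -> : \int[leb]_x (along_disp x * (phi x - phi (x - xi))) =
    \int[leb]_x (along_disp x * phi x) - \int[leb]_x (along_disp (x + xi) * phi x).
  have ih : leb.-integrable setT (EFin \o (fun x => along_disp x * phi (x - xi))).
    have := integrable_shift (- xi) (bd _ integrable_along_shift).
    by apply: eq_integrable => // x _ /=; rewrite subrK.
  under eq_Rintegral do rewrite mulrBr.
  rewrite RintegralB//; last exact: bd integrable_along_disp.
  congr (_ - _); rewrite /Rintegral; congr fine.
  have := integral_shift xi (measurable_int _ ih) => /= <-.
  by apply: eq_integral => x _ /=; rewrite addrK.
have := bd _ integrable_along_disp; have := bd _ integrable_along_shift; have := bd _ iI.
move=> b1 b2 b3.
transitivity (\int[leb]_x (along_disp (x + xi) * phi x - along_disp x * phi x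
    - I01 (fun s : R => along_strain (x + s *: xi)) * phi x)).
  by apply: eq_Rintegral => x _; rewrite /increment_defect !mulrBl.
rewrite RintegralB// ?RintegralB//; last first.
  by apply: eq_integrable (integrableB measurableT b2 b3) => // x _.
by rewrite opprB.
Qed.

End increment.

(** * Cutoffs for cubes and orthants *)

Section bump.
Context {R : realType} {n : nat}.
Local Notation V := 'rV[R]_n.
Implicit Types (c x : V) (r k : R).

(** As k grows this tends to the indicator of [cube c r]; for every k > 0 it is positive exactly on
    the cube. The sharp versions excise the cover, the one with k = 1 only localizes. *)
Definition bump c r k x : R :=
  \prod_i (smoothstep (k * (x ord0 i - c ord0 i + r)) *
           smoothstep (k * (c ord0 i + r - x ord0 i))).

Definition orthant_cut c k x : R := \prod_i smoothstep (k * (c ord0 i - x ord0 i)).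

Lemma C11_smoothstep_affine (i : 'I_n) (k a b : R) :
  exists G, C11 (fun x : V => smoothstep (k * (a * x ord0 i + b))) G.
Proof.
have [G h] := @C11_smoothstep R n i (k * a) (k * b); exists G.
by under eq_fun do rewrite mulrDr mulrA.
Qed.

Lemma C11_bump c r k : exists G, C11 (bump c r k) G.
Proof.
apply: C11_prod => i.
have [G1 h1] := C11_smoothstep_affine i k 1 (r - c ord0 i).
have [G2 h2] := C11_smoothstep_affine i k (-1) (c ord0 i + r).
eexists; have := C11M h1 h2; congr C11.
by apply/funext => x; congr (smoothstep (_ * _) * smoothstep (_ * _)); ring.
Qed.

Lemma C11_orthant_cut c k : exists G, C11 (orthant_cut c k) G.
Proof.
apply: C11_prod => i; have [G h] := C11_smoothstep_affine i k (-1) (c ord0 i).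
by exists G; under eq_fun do rewrite addrC -mulN1r.
Qed.

Lemma prod01 (I : Type) (s : seq I) (F : I -> R) : (forall i, 0 <= F i <= 1) ->
  0 <= \prod_(i <- s) F i <= 1.
Proof.
move=> h; apply: (big_ind (fun t : R => 0 <= t <= 1)) => //; first by rewrite ler01 lexx.
by move=> x y /andP[x0 x1] /andP[y0 y1]; rewrite mulr_ge0 ?mulr_ile1.
Qed.

Lemma bump01 c r k x : 0 <= bump c r k x <= 1.
Proof.
apply: prod01 => i; have /andP[a0 a1] := smoothstep01 (k * (x ord0 i - c ord0 i + r)).
have /andP[b0 b1] := smoothstep01 (k * (c ord0 i + r - x ord0 i)).
by rewrite mulr_ge0 ?mulr_ile1.
Qed.

Lemma orthant_cut01 c k x : 0 <= orthant_cut c k x <= 1.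
Proof. by apply: prod01 => i; exact: smoothstep01. Qed.

Lemma bump_out c r k x : 0 <= k -> ~ cube c r x -> bump c r k x = 0.
Proof.
move=> k0 /existsNP[i /negP]; rewrite -leNgt ler_normr => /orP[] h;
rewrite /bump (bigD1 i)//=.
- by rewrite [X in _ * X * _]smoothstep_le0 ?mulr0 ?mul0r// mulr_ge0_le0//; lra.
- by rewrite [X in X * _ * _]smoothstep_le0 ?mul0r// mulr_ge0_le0//; lra.
Qed.

Lemma bump_gt0 c r k x : 0 < k -> cube c r x -> 0 < bump c r k x.
Proof.
move=> k0 xc; apply: prodr_gt0 => i _; have := xc i; rewrite ltr_norml => /andP[h1 h2].
by rewrite mulr_gt0// smoothstep_gt0// mulr_gt0//; lra.
Qed.

Lemma near_bump1 c r x : cube c r x -> \forall k \near \oo, bump c r k%:R x = 1.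
Proof.
move=> xc.
have h : \forall k \near \oo, forall i : 'I_n,
    smoothstep (k%:R * (x ord0 i - c ord0 i + r)) = 1 /\
    smoothstep (k%:R * (c ord0 i + r - x ord0 i)) = 1.
  apply: filter_forall => i; have := xc i; rewrite ltr_norml => /andP[h1 h2].
  have := near_smoothstep (x ord0 i - c ord0 i + r).
  have := near_smoothstep (c ord0 i + r - x ord0 i).
  have -> : 0 < c ord0 i + r - x ord0 i by lra.
  have -> : 0 < x ord0 i - c ord0 i + r by lra.
  by apply: filterS2 => k -> ->.
by apply: filterS h => k hk; rewrite /bump big1// => i _; have [-> ->] := hk i; rewrite mulr1.
Qed.

Lemma near_orthant_cut c x : \forall k \near \oo, orthant_cut c k%:R x = \1_(orthant c) x.
Proof.
have h : \forall k \near \oo, forall i : 'I_n,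
    smoothstep (k%:R * (c ord0 i - x ord0 i)) = (0 < c ord0 i - x ord0 i)%R%:R.
  by apply: filter_forall => i; exact: near_smoothstep.
apply: filterS h => k hk; rewrite /orthant_cut; under eq_bigr do rewrite hk subr_gt0.
rewrite indicE; case: (asboolP (orthant c x)) => xc.
  by rewrite mem_set// big1// => i _; rewrite xc.
rewrite memNset//; have /existsNP[i /negP/negbTE xi] := xc.
by rewrite (bigD1 i)//= xi mul0r.
Qed.

End bump.

(** * Vanishing of the defect off the cover *)

Section vanishing.
Context {R : realType} {n : nat}.
Local Notation V := 'rV[R]_n.

(** The average at z sees phi only between z - xi and z, so it vanishes unless z belongs to the cube
    swept along xi, which K contains. *)
Lemma test_function_avg (D : set V) (p xi : V) (rho : R) phi G K : C11 phi G ->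
  (forall x, ~ cube p rho x -> phi x = 0) -> compact K -> K `<=` D ->
  (forall (x : V) (s : R), cube p rho x -> 0 <= s <= 1 -> K (x + s *: xi)) ->
  test_function D (avg phi xi).
Proof.
move=> cphi phi0 cK KD hK; have cavg := C11_avg xi cphi; split.
- by move=> x; exact: C11_differentiable cavg.
- move=> i; rewrite (_ : partial i _ = fun z => avg_grad G xi z ord0 i).
    exact: C11_grad_continuous cavg.
  by apply/funext => x; exact: partial_C11.
- exists K => // z Kz; rewrite /avg /Rintegral integral0_eq// => s /=; rewrite in_itv/= => s01.
  by rewrite phi0// => /(hK _ s) /(_ s01); rewrite subrK.
Qed.

Lemma kernel_cvg0 d (T : measurableType d) (mu : {measure set T -> \bar R}) (J : set T)
    (m : T -> R) (Psi : nat -> T -> R) :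
  measurable_fun setT m -> (forall x, 0 <= m x) -> (forall x, ~ J x -> m x = 0) ->
  (\int[mu]_x (m x)%:E < +oo)%E ->
  (forall k, measurable_fun setT (Psi k)) -> (forall k x, `|Psi k x| <= 1) ->
  (forall x, J x -> Psi k x @[k --> \oo] --> (0 : R)) ->
  (\int[mu]_x (m x * `|Psi k x|)%:E @[k --> \oo] --> 0)%E.
Proof.
move=> mm m0 mJ moo mPsi Psi1 Psi0.
rewrite -[X in _ --> X](integral0 mu setT).
apply: (@dominated_cvg _ T R mu setT measurableT
  (fun k x => (m x * `|Psi k x|)%:E) (cst 0%E) (EFin \o m)) => //.
- move=> k; apply/measurable_EFinP; apply: measurable_funM => //.
  exact: measurableT_comp.
- move=> x _; apply/cvg_EFin; first by near=> k.
  have [xJ|xJ] := pselect (J x).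
    rewrite -[X in _ --> X](mulr0 (m x)); apply: cvgMr.
    by rewrite -[X in _ --> X](normr0 R); apply: cvg_norm; exact: Psi0.
  rewrite (_ : _ \o _ = cst 0); first exact: cvg_cst.
  by apply/funext => k; rewrite /= mJ// mul0r.
- apply/integrableP; split; first exact/measurable_EFinP.
  rewrite (_ : (fun x => _) = EFin \o m)//.
  by apply/funext => x /=; rewrite ger0_norm.
- by move=> k x _; rewrite /= lee_fin normrM normr_id (ger0_norm (m0 x)) ler_piMr.
Unshelve. all: by end_near.
Qed.

Lemma avg_cvg0 (phi : nat -> V -> R) (xi z : V) : (forall k, measurable_fun setT (phi k)) ->
  (forall k x, `|phi k x| <= 1) ->
  (forall s : R, 0 <= s <= 1 -> phi k (z - s *: xi) @[k --> \oo] --> (0 : R)) ->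
  avg (phi k) xi z @[k --> \oo] --> (0 : R).
Proof.
move=> mphi phi1 phi0.
have m k : measurable_fun `[(0 : R), 1] (fun s : R => phi k (z - s *: xi)).
  apply: measurable_funS (measurableT_comp (mphi k) (measurable_line _ _)) => //.
have : (\int[lebesgue_measure]_(s in `[0%R, 1%R]) (phi k (z - s *: xi))%:E @[k --> \oo] --> 0)%E.
  rewrite -[X in _ --> X](integral0 (@lebesgue_measure R) `[0%R, 1%R]).
  apply: (@dominated_cvg _ _ _ _ _ _ _ _ (cst 1%E)) => //.
  - by move=> k; apply/measurable_EFinP; exact: m.
  - move=> s; rewrite /= in_itv/= => s01; apply/cvg_EFin; first by near=> k.
    exact: phi0.
  - have := @integrable01 R (cst 1) 1 (measurable_cst _) (fun=> _); apply.
    by move=> s; rewrite normr1.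
  - by move=> k s _; rewrite lee_fin.
move=> /fine_cvgP[_]; exact.
Unshelve. all: by end_near.
Qed.

End vanishing.

Section defect_vanishing.
Context {R : realType} {n : nat}.
Local Notation V := 'rV[R]_n.
Local Notation leb := (lebesgueD n).
Variables (D : set V) (u : V -> V) (E : V -> 'M[R]_n) (xi : V) (c : nat -> V) (r : nat -> R).
Hypotheses (oD : open D) (sbd : SBD D u E)
  (hcov : forall (z : V) (s : R), jump_set D u z -> 0 <= s <= 1 ->
     exists m, cube (c m) (r m) (z - s *: xi)).

Lemma cvg0_abs_le (a : nat -> R) (b : nat -> \bar R) :
  (forall k, (`|a k|%:E <= b k)%E) -> b k @[k --> \oo] --> 0%E ->
  a k @[k --> \oo] --> (0 : R).
Proof.
move=> ab b0; apply/cvgrPdist_lt => e e0.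
have := cvge0_near b0 e0; apply: filterS => k bk.
by rewrite sub0r normrN -lte_fin; apply: le_lt_trans bk; exact: ab.
Qed.

Lemma cvg_sum (I : Type) (t : seq I) (F : I -> nat -> R) :
  (forall i, F i k @[k --> \oo] --> (0 : R)) ->
  (\sum_(i <- t) F i k) @[k --> \oo] --> (0 : R).
Proof.
move=> h; elim: t => [|i t IH]; first by under eq_fun do rewrite big_nil; exact: cvg_cst.
under eq_fun do rewrite big_cons.
by have := cvgD (h i) IH; rewrite addr0; apply.
Qed.

Let U : set V := \bigcup_m cube (c m) (r m).

Let mU : measurable U.
Proof. by apply: bigcupT_measurable => m; exact: measurable_cube. Qed.

(** The test functions are a localizing weight, an orthant cutoff and factors that excise the cubes
    of the cover U. For a jump point x the whole segment from x - xi to x lies in U, so the averages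
    tend to 0 there and the jump integrals disappear. In the limit the defect, weighted and cut off
    to the complement of U, has integral 0 over every orthant. *)
Lemma defect_local (p : V) (rho : R) (K : set V) : compact K -> K `<=` D ->
  (forall (x : V) (s : R), cube p rho x -> 0 <= s <= 1 -> K (x + s *: xi)) ->
  {ae leb, forall x, cube p rho x -> ~ U x -> increment_defect D u E xi x = 0}.
Proof.
move=> cK KD hK; have mD : measurable D by exact: open_measurable_rV.
have [ui Ei [up [um [nu [_ ji ident]]]]] := sbd.
have ig := integrable_increment_defect xi mD ui Ei.
set g := increment_defect D u E xi in ig *.
pose eta := bump p rho 1.
(* The one index k sharpens the cutoffs and lengthens the list of excised cubes. *)
pose phi cc k x := eta x * orthant_cut cc k%:R x * \prod_(l < k) (1 - bump (c l) (r l) k%:R x).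
have cphi cc k : exists G, C11 (phi cc k) G.
  have [G1 h1] := C11_bump p rho 1; have [G2 h2] := C11_orthant_cut cc k%:R.
  have [G3 h3] : exists G, C11 (fun x => \prod_(l < k) (1 - bump (c l) (r l) k%:R x)) G.
    apply: C11_prod => l; have [G h] := C11_bump (c l) (r l) k%:R.
    by eexists; exact: C11_onem h.
  by eexists; exact: C11M (C11M h1 h2) h3.
have phi01 cc k x : 0 <= phi cc k x <= 1.
  have /andP[a0 a1] := bump01 p rho 1 x; have /andP[b0 b1] := orthant_cut01 cc k%:R x.
  have /andP[d0 d1] : 0 <= \prod_(l < k) (1 - bump (c l) (r l) k%:R x) <= 1.
    by apply: prod01 => l; have /andP[? ?] := bump01 (c l) (r l) k%:R x; lra.
  by rewrite /phi !mulr_ge0//= !mulr_ile1// mulr_ge0.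
have phi_norm cc k x : `|phi cc k x| <= 1 by have /andP[? ?] := phi01 cc k x; rewrite ger0_norm.
have mphi cc k : measurable_fun setT (phi cc k) by have [G h] := cphi cc k; exact: measurable_C11 h.
pose psi cc x : R := eta x * \1_(orthant cc) x * \1_(~` U) x.
(* At each point the sequence is eventually equal to its limit: if x lies in the l-th cube, that
   factor is 0 for k large; if x lies in no cube, all these factors are 1. *)
have phi_psi cc x : \forall k \near \oo, phi cc k x = psi cc x.
  have [xU|xU] := pselect (U x).
    have [l _ xl] := xU.
    have := near_bump1 xl; have : \forall k \near \oo, (l < k)%N by exact: nbhs_infty_gt.
    have -> : psi cc x = 0 by rewrite /psi [\1_(~` U) x]indicE memNset ?mulr0//; apply.
    apply: filterS2 => k lk bk; rewrite /phi.
    by rewrite (bigD1 (Ordinal lk))//= bk subrr mul0r mulr0.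
  apply: filterS (near_orthant_cut cc x) => k hk.
  rewrite /phi /psi hk [\1_(~` U) x]indicE mem_set//; congr (_ * _).
  rewrite big1// => l _; rewrite bump_out ?subr0// => xl; apply: xU; by exists l.
have mpsi cc : measurable_fun setT (psi cc).
  have [G h] := C11_bump p rho 1; apply: measurable_funM; first apply: measurable_funM.
  - exact: measurable_C11 h.
  - exact: measurable_indic (measurable_orthant cc).
  - by apply: measurable_indic; exact: measurableC.
have psi1 cc x : `|psi cc x| <= 1.
  have [k hk] : exists k, phi cc k x = psi cc x.
    by have [N _ hN] := phi_psi cc x; exists N; exact: hN (leqnn N).
  by rewrite -hk.
(* Dominated convergence is run for the measurable kernel m that replaces the jump density. *)
have jump0 cc i j : \int[hausdorff_measure R n n.-1]_(x in jump_set D u)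
   (sym_tensor (up x - um x) (nu x) i j * avg (phi cc k) xi x) @[k --> \oo] --> (0 : R).
  have /integrableP[_ joo] := ji i j.
  have [m [mm m0 mJ moo hm]] := lower_integral_kernel joo.
  have avg1 k x : `|avg (phi cc k) xi x| <= 1.
    by apply: I01_bound => //; exact: measurableT_comp (mphi cc k) (measurable_line _ _).
  have mavg k : measurable_fun [set: hausdorff_type R n n.-1] (avg (phi cc k) xi).
    apply: measurable_fun_hausdorff; have [G h] := cphi cc k.
    exact: measurable_C11 (C11_avg xi h).
  apply: (cvg0_abs_le (b := fun k => \int[hausdorff_measure R n n.-1]_x
      (m x * `|avg (phi cc k) xi x|)%:E)%E) => [k|]; first exact: hm.
  apply: (@kernel_cvg0 R _ (hausdorff_type R n n.-1) (hausdorff_measure R n n.-1)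
    (jump_set D u) m (fun k => avg (phi cc k) xi) mm m0 mJ moo mavg avg1) => x Jx.
  apply: avg_cvg0 => // s s01; have [l xl] := hcov Jx s01.
  apply: cvg_near_cst; have := phi_psi cc (x - s *: xi); apply: filterS => k ->.
  by rewrite /psi [\1_(~` U) _]indicE memNset ?mulr0//; apply; exists l.
have psi0 cc : (\int[leb]_x (g x * psi cc x)%:E = 0)%E.
  have lim1 : (\int[leb]_x (g x * phi cc k x)%:E @[k --> \oo] --> \int[leb]_x (g x * psi cc x)%:E)%E.
    apply: (@dominated_cvg _ V R leb setT measurableT (fun k x => (g x * phi cc k x)%:E)
        (fun x => (g x * psi cc x)%:E) (abse \o (EFin \o g))) => //.
    - move=> k; apply/measurable_EFinP; apply: measurable_funM => //.
      by apply/measurable_EFinP; exact: measurable_int ig.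
    - move=> x _; apply: cvg_near_cst; apply: filterS (phi_psi cc x) => k ->//.
    - exact: integrable_abse.
    - by move=> k x _; rewrite /= lee_fin normrM ler_piMr.
  have lim2 : \int[leb]_x (g x * phi cc k x) @[k --> \oo] --> (0 : R).
    have -> : (fun k => \int[leb]_x (g x * phi cc k x)) = (fun k => \sum_i \sum_j xi ord0 i * xi ord0 j *
        \int[hausdorff_measure R n n.-1]_(x in jump_set D u)
          (sym_tensor (up x - um x) (nu x) i j * avg (phi cc k) xi x)).
      apply/funext => k; have [G h] := cphi cc k.
      apply: (increment_identity mD ui Ei h) => i j; apply: ident.
      apply: (test_function_avg h _ cK KD hK) => x xp.
      by rewrite /phi /eta bump_out// !mul0r.
    apply: cvg_sum => i; apply: cvg_sum => j; rewrite -[X in _ --> X](mulr0 (xi ord0 i * xi ord0 j)).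
    by apply: cvgMr; exact: jump0.
  have ipsi : leb.-integrable setT (EFin \o (fun x => g x * psi cc x)).
    exact: (integrable_mul_bounded measurableT ig (mpsi cc) (fun x _ => psi1 cc x)).
  have fin := integrable_fin_num measurableT ipsi.
  rewrite -(fineK fin) in lim1 *.
  by rewrite (cvg_unique _ (fine_cvg lim1) lim2).
(* Orthants have served their purpose; eta is positive on the cube of radius rho and drops out at
   the end. *)
have gk : {ae leb, forall x, g x * (eta x * \1_(~` U) x) = 0}.
  apply: orthant_integral_eq0.
    have := integrable_mul_bounded measurableT ig (h := fun x => eta x * \1_(~` U) x) (L := 1).
    apply.
    - have [G h] := C11_bump p rho 1; apply: measurable_funM; first exact: measurable_C11 h.
      by apply: measurable_indic; exact: measurableC.
    - move=> x _; have /andP[a0 a1] := bump01 p rho 1 x.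
      by rewrite indicE ger0_norm ?mulr_ge0// mulr_ile1//; case: (_ \in _).
  move=> cc; rewrite -[RHS](psi0 cc) integral_mkcond; apply: eq_integral => x _.
  by rewrite epatch_indic /= -EFinM /psi; congr EFin; ring.
apply: filterS gk => x + xp xU; rewrite indicE mem_set// mulr1 => /eqP.
rewrite mulf_eq0 => /orP[/eqP//|/eqP eta0].
by have := bump_gt0 (@ltr01 R) xp; rewrite -/eta eta0 ltxx.
Qed.

End defect_vanishing.

(** * Distance to the boundary of the domain *)

Section interior_points.
Context {R : realType} {n : nat}.
Local Notation V := 'rV[R]_n.

(** The infimum of the times spent outside D. It is attained because the complement is closed, it is
    positive because x lies in D, and slightly earlier points still lie in D. *)
Lemma segment_leaves (D : set V) (x y : V) : open D -> D x -> ~ D y ->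
  exists2 t : R, 0 < t <= 1 & (closure D `\` D) (x + t *: (y - x)).
Proof.
move=> oD Dx Dy; pose l (t : R) := x + t *: (y - x).
have cl : continuous l.
  move=> t; apply: cvgD; first exact: cvg_cst.
  by apply: cvgZr_tmp; exact: cvg_id.
pose A := [set t : R | 0 <= t <= 1 /\ ~ D (l t)].
have A1 : A 1 by split; rewrite ?ler01 ?lexx// /l scale1r subrKC.
have cA : closed A.
  have -> : A = `[0, 1] `&` l @^-1` (~` D).
    by apply/seteqP; split => t /=; rewrite in_itv.
  apply: closedI; first exact: itv_closed.
  by apply: closed_comp => [t _|]; [exact: cl|exact: open_closedC].
have hA : has_inf A by split; [exists 1|exists 0 => t [/andP[]]].
have Ai : A (inf A).
  apply: cA => B /nbhs_ballP[e /= e0 eB].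
  have [t At te] := inf_adherent e0 hA; exists t; split => //; apply: eB.
  have ti : inf A <= t by apply: ge_inf => //; exact: hA.2.
  by rewrite /ball/= ler0_norm; lra.
have [/andP[i0 i1] Di] := Ai.
have ip : 0 < inf A.
  rewrite lt_neqAle i0 andbT; apply/eqP => E; apply: Di.
  by rewrite -E /l scale0r addr0.
exists (inf A); first by rewrite ip.
split => // B /cl /nbhs_ballP[e /= e0 eB].
pose t := Num.max 0 (inf A - e / 2).
have [t0 ti te] : [/\ 0 <= t, t < inf A & inf A - t < e].
  have h1 : inf A - e / 2 <= t by rewrite le_max lexx orbT.
  split; [by rewrite le_max lexx| |lra].
  by rewrite gt_max ip ltrBlDr ltrDl divr_gt0.
exists (l t); split; last by apply: eB; rewrite /ball/= ger0_norm; lra.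
apply: contrapT => Dt; suff : inf A <= t by lra.
by apply: ge_inf; [exact: hA.2|split => //; apply/andP; split; lra].
Qed.

(** A point outside D closer than a to x would yield a boundary point on the segment between them,
    also closer than a. *)
Lemma interior_part_eball (D : set V) (a : R) (x : V) : open D -> interior_part D a x ->
  eball x a `<=` D.
Proof.
move=> oD [Dx nx] y yx; apply: contrapT => Dy.
have [t /andP[t0 t1] [zc zD]] := segment_leaves oD Dx Dy.
apply: nx; split => //; exists (x + t *: (y - x)).
  by rewrite -/(D°) (interior_id D).1.
rewrite opprD addNKr enormN enormZ gtr0_norm//; apply: le_lt_trans yx.
by rewrite ler_piMl ?enorm_ge0.
Qed.

Lemma compact_closed_eball (x : V) (r : R) : compact [set y : V | enorm (y - x) <= r].
Proof.
apply: bounded_closed_compact.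
  exists (`|x| + (r + 1)); split; first exact: num_real.
  move=> M rM y /= yx; apply: le_trans (ltW rM); rewrite -(subrKC x y).
  apply: le_trans (ler_normD _ _) _; rewrite lerD2l.
  have r1 : 0 < r + 1 by rewrite ltr_wpDl// (le_trans _ yx)// enorm_ge0.
  have : eball x (r + 1) y by rewrite /eball/= (le_lt_trans yx)// ltrDl.
  by move=> /(eball_sub_ball r1); rewrite -ball_normE /ball_/= distrC => /ltW.
apply: (@closed_comp _ _ (fun y : V => enorm (y - x)) [set t : R | t <= r]).
  move=> y _; apply: continuous_comp; last exact: continuous_enorm.
  have h : (fun z : V => z - x) z @[z --> y] --> y - x.
    by apply: (@cvgB R V V (nbhs y) _ id (cst x)); [move=> ? ?|exact: cvg_cst].
  exact: h.
exact: closed_le.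
Qed.

End interior_points.

Section defect_ae.
Context {R : realType} {n : nat}.
Local Notation V := 'rV[R]_n.

(** The local statement holds on cubes small enough that the swept cube stays within distance 3a/4
    of a point of the interior part, hence in a compact subset of D. Countably many such cubes cover
    the space. *)
Lemma defect_ae (D : set V) (u : V -> V) (E : V -> 'M[R]_n) (xi : V) (a : R)
    (c : nat -> V) (r : nat -> R) : open D -> SBD D u E ->
  (forall (z : V) (s : R), jump_set D u z -> 0 <= s <= 1 ->
     exists m, cube (c m) (r m) (z - s *: xi)) ->
  enorm xi < a / 2 ->
  {ae lebesgueD n, forall x, interior_part D a x \/ interior_part D a (x + xi) ->
    ~ (\bigcup_m cube (c m) (r m)) x -> increment_defect D u E xi x = 0}.
Proof.
move=> oD sbd hcov xia.
have a0 : 0 < a by have := enorm_ge0 xi; lra.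
(* Two points of a cube of radius rho differ by at most 2 n rho <= a/4 in norm; with |xi| < a/2 the
   total is below 3a/4. *)
pose rho := a / 8 / n.+1%:R; have rho0 : 0 < rho by rewrite !divr_gt0.
pose I x := interior_part D a x \/ interior_part D a (x + xi).
have local p : {ae lebesgueD n, forall x, cube p rho x -> I x ->
    ~ (\bigcup_m cube (c m) (r m)) x -> increment_defect D u E xi x = 0}.
  have [[x1 px1 Ix1]|none] := pselect (exists2 x1, cube p rho x1 & I x1); last first.
    by apply: aeW => x px Ix; exfalso; apply: none; exists x.
  (* Selects the endpoint x1 or x1 + xi that lies in the interior part. *)
  pose s1 : R := if `[< interior_part D a x1 >] then 0 else 1.
  pose x0 := x1 + s1 *: xi.
  have s101 : 0 <= s1 <= 1 by rewrite /s1; case: ifP; rewrite ?lexx ?ler01.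
  have ix0 : interior_part D a x0.
    rewrite /x0 /s1; case: asboolP => h; first by rewrite scale0r addr0.
    by rewrite scale1r; case: Ix1.
  pose K := [set y : V | enorm (y - x0) <= 3 / 4 * a].
  have KD : K `<=` D.
    move=> y /= yK; apply: (interior_part_eball oD ix0); rewrite /eball/= (le_lt_trans yK)//; lra.
  have hK (x : V) (s : R) : cube p rho x -> 0 <= s <= 1 -> K (x + s *: xi).
    move=> px /andP[s0 ss1]; have /andP[t0 t1] := s101; rewrite /K/=.
    have -> : x + s *: xi - x0 = (x - x1) + (s - s1) *: xi.
      by rewrite /x0 scalerBl opprD addrACA.
    apply: le_trans (ler_enormD _ _) _; rewrite enormZ.
    have h1 : enorm (x - x1) <= n%:R * (rho *+ 2).
      apply: enorm_le_cube => i; rewrite !mxE.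
      have := ltW (px i); have := ltW (px1 i).
      rewrite !ler_norml mulr2n => /andP[? ?] /andP[? ?]; apply/andP; split; lra.
    have h2 : n%:R * (rho *+ 2) <= a / 4.
      have -> : a / 4 = n.+1%:R * (rho *+ 2).
        by rewrite /rho -[in RHS]mulr_natl; field; rewrite nat1r pnatr_eq0.
      by rewrite ler_wpM2r// ?mulrn_wge0 ?(ltW rho0)// ler_nat.
    have h3 : `|s - s1| * enorm xi <= enorm xi.
      by rewrite ler_piMl ?enorm_ge0// ler_norml; apply/andP; split; lra.
    lra.
  have := defect_local oD sbd hcov (compact_closed_eball (x := x0) (r := 3 / 4 * a)) KD hK.
  by apply: filterS => x h px _; exact: h.
(* Cubes centred at the lattice of mesh rho, enumerated by [unpickle]; x lies in the cube at the
   lattice point obtained by rounding its coordinates down. *)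
pose P (k : nat) (x : V) : Prop := if @unpickle 'rV[int]_n k is Some q
  then cube (\row_i ((q ord0 i)%:~R * rho)) rho x -> I x ->
    ~ (\bigcup_m cube (c m) (r m)) x -> increment_defect D u E xi x = 0
  else True.
have : {ae lebesgueD n, forall x, forall k, P k x}.
  apply: ae_foralln => k; rewrite /P; case: unpickle => [q|]; [exact: local|exact: aeW].
apply: filterS => x hx.
pose q : 'rV[int]_n := \row_i Num.floor (x ord0 i / rho).
have := hx (pickle q); rewrite /P pickleK; apply => i; rewrite !mxE.
have /andP[h1 h2] := floor_itv (x ord0 i / rho).
rewrite ler_pdivlMr// in h1; rewrite ltr_pdivrMr// in h2.
rewrite intrD mulrDl mul1r in h2.
rewrite ger0_norm; lra.
Qed.

End defect_ae.

(** * Energy of an increment *)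

Section potential_measurability.
Context {R : realType}.
Variables (f : R -> R) (f0' finf rbar : R).
Hypothesis hf : cohesive_potential f f0' finf rbar.

(** Only the values of f on the half-line are constrained. Composition with the maximum of 0 and s
    gives a function that is nondecreasing, hence measurable, on the whole line. *)
Lemma measurable_potential d (T : measurableType d) (g : T -> R) :
  measurable_fun setT g -> (forall x, 0 <= g x) -> measurable_fun setT (fun x => f (g x)).
Proof.
move=> mg g0; have mf : measurable_fun [set: R] (fun s => f (Num.max 0 s)).
  apply: nondecreasing_measurable => // s t st; apply: (potential_mono hf).
    by rewrite le_max lexx.
  by rewrite ge_max !le_max lexx st orbT.
have := measurableT_comp mf mg; apply: eq_measurable_fun => x _ /=.
by rewrite max_r.
Qed.

End potential_measurability.

Section segment_average.
Context {R : realType} {n : nat}.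
Local Notation V := 'rV[R]_n.
Local Notation mR := (measurableTypeR R).
Local Notation leb := (lebesgueD n).
Local Notation I01 h := (\int[lebesgue_measure]_(s in `[0%R, 1%R]) h s)%R.

(** Jensen's inequality from (e - c)^2 >= 0, where c is the mean of e. If e^2 is not integrable the
    right side is infinite. *)
Lemma I01_sqr_le (e : R -> R) : lebesgue_measure.-integrable `[0, 1] (EFin \o e) ->
  ((I01 e ^+ 2)%:E <= \int[lebesgue_measure]_(s in `[0%R, 1%R]) (e s ^+ 2)%:E)%E.
Proof.
move=> ie; have me : measurable_fun `[(0 : R), 1] e.
  by apply/measurable_EFinP; exact: measurable_int ie.
have [foo|] := ltP (\int[lebesgue_measure]_(s in `[0%R, 1%R]) (e s ^+ 2)%:E)%E +oo%E; last first.
  by rewrite leye_eq => /eqP ->; rewrite leey.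
have ie2 : lebesgue_measure.-integrable `[0, 1] (EFin \o (fun s => e s ^+ 2)).
  apply/integrableP; split; first by apply/measurable_EFinP; exact: measurable_funX.
  by under eq_integral do rewrite /= ger0_norm ?sqr_ge0//.
set c := I01 e.
have ice : lebesgue_measure.-integrable `[0, 1] (EFin \o (fun s => 2 * c * e s)).
  have h : lebesgue_measure.-integrable `[0, 1] (fun s => (2 * c)%:E * (EFin \o e) s)%E.
    exact: integrableZl.
  by apply: eq_integrable h => // s _; rewrite /= EFinM.
have icc := @integrable01 R (cst (c ^+ 2)) `|c ^+ 2| (measurable_cst _) (fun=> lexx _).
have ic : lebesgue_measure.-integrable `[0, 1] (EFin \o (fun s => 2 * c * e s - c ^+ 2)).
  have h : lebesgue_measure.-integrable `[0, 1]
    ((EFin \o (fun s : R => 2 * c * e s)%R) \- (EFin \o (cst (c ^+ 2)%R)))%E by exact: integrableB.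
  by apply: eq_integrable h => // s _; rewrite /= EFinB.
have -> : (c ^+ 2)%:E = (\int[lebesgue_measure]_(s in `[0%R, 1%R]) (2 * c * e s - c ^+ 2)%:E)%E.
  rewrite -(@fineK _ (\int[_]_(_ in _) _)%E); last exact: integrable_fin_num ic.
  congr EFin; rewrite -/(Rintegral _ _ _) RintegralB// RintegralZl// Rintegral_cst//= -/c.
  by rewrite lebesgue_measure_itv/= lte_fin ltr01 oppr0 adde0/=; ring.
apply: le_integral => // s _; rewrite lee_fin -subr_ge0.
by rewrite (_ : _ - _ = (e s - c) ^+ 2) ?sqr_ge0//; ring.
Qed.

Lemma tonelli_segment (H : V -> \bar R) xi : measurable_fun setT H -> (forall x, 0 <= H x)%E ->
  (\int[leb]_x \int[lebesgue_measure]_(s in `[0%R, 1%R]) H (x + s *: xi)%R = \int[leb]_x H x)%E.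
Proof.
move=> mH H0; pose G (p : V * mR) : \bar R := (H (p.1 + p.2 *: xi)%R * (\1_`[0%R, 1%R] p.2)%:E)%E.
have mG : measurable_fun setT G.
  apply: emeasurable_funM.
    exact: measurableT_comp (measurableT_comp mH measurable_fst) (measurable_shear xi).
  by apply/measurable_EFinP; exact: measurableT_comp (measurable_indic _) measurable_snd.
have G0 p : (0 <= G p)%E by rewrite mule_ge0// lee_fin indicE.
transitivity (\int[leb]_x \int[lebesgue_measure]_s G (x, s))%E.
  apply: eq_integral => x _; rewrite integral_mkcond; apply: eq_integral => s _.
  by rewrite epatch_indic.
rewrite [LHS](@fubini_tonelli _ _ _ _ _ _ _ G mG G0).
transitivity (\int[lebesgue_measure]_s ((\int[leb]_x H x) * (\1_`[0%R, 1%R] s)%:E))%E.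
  apply: eq_integral => s _; rewrite /G/=.
  have mHs : measurable_fun setT (fun x : V => H (x + s *: xi)) by exact: measurable_fun_shift.
  rewrite ge0_integralZr//.
  by have := ge0_integral_shift (s *: xi) mH H0 => ->.
rewrite ge0_integralZl//; last 2 first.
- by apply/measurable_EFinP; exact: measurable_indic.
- exact: integral_ge0.
by rewrite integral_indic// setIT /= lebesgue_measure_itv/= lte_fin ltr01 oppr0 adde0 mule1.
Qed.

Lemma measurable_segment (H : V -> \bar R) (xi : V) : measurable_fun setT H -> (forall x, 0 <= H x)%E ->
  measurable_fun setT (fun x : V => \int[lebesgue_measure]_(s in `[0%R, 1%R]) H (x + s *: xi)%R)%E.
Proof.
move=> mH H0; pose G (p : V * mR) : \bar R := (H (p.1 + p.2 *: xi)%R * (\1_`[0%R, 1%R] p.2)%:E)%E.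
have mG : measurable_fun setT G.
  apply: emeasurable_funM.
    exact: measurableT_comp (measurableT_comp mH measurable_fst) (measurable_shear xi).
  by apply/measurable_EFinP; exact: measurableT_comp (measurable_indic _) measurable_snd.
have G0 p : (0 <= G p)%E by rewrite mule_ge0// lee_fin indicE.
have := @measurable_fun_fubini_tonelli_F _ _ V mR R lebesgue_measure G mG G0.
apply: eq_measurable_fun => x _; rewrite /fubini_F [RHS]integral_mkcond.
by apply: eq_integral => s _; rewrite epatch_indic.
Qed.

Lemma ae_shift (P : V -> Prop) c : {ae leb, forall x, P x} -> {ae leb, forall x, P (x + c)}.
Proof.
move=> [A [mA A0 PA]]; exists [set x : V | A (x + c)]; split.
- by rewrite -[X in measurable X]setTI; apply: (measurable_fun_shift c (@measurable_id _ V setT)).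
- have := @lebesgueD_affine R n 1 c A ltr01 mA; rewrite A0 mule0 => <-; congr (leb _).
  by apply/seteqP; split => x /=; rewrite scale1r.
- by move=> x /= nP; apply: PA.
Qed.

(** Cauchy-Schwarz twice, once for each index of the quadratic form xi.E xi. *)
Lemma along_strain_sqr_le (D : set V) (E : V -> 'M[R]_n) xi z :
  along_strain D E xi z ^+ 2 <= enorm xi ^+ 4 * ((\sum_i \sum_j E z i j ^+ 2) * \1_D z).
Proof.
have d2 : \1_D z ^+ 2 = \1_D z :> R by rewrite indicE; case: (_ \in _); rewrite ?expr1n ?expr0n.
rewrite /along_strain exprMn d2 mulrA ler_wpM2r ?indicE//.
pose y : V := \row_i dotv xi (row i (E z)).
have -> : \sum_i \sum_j xi ord0 i * xi ord0 j * E z i j = dotv xi y.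
  rewrite /dotv; apply: eq_bigr => i _; rewrite !mxE /dotv mulr_sumr.
  by apply: eq_bigr => j _; rewrite mxE mulrA.
have cs (p q : V) : dotv p q ^+ 2 <= enorm p ^+ 2 * enorm q ^+ 2.
  rewrite -exprMn -(real_normK (num_real (dotv p q))) lerXn2r ?nnegrE ?mulr_ge0 ?enorm_ge0//.
  exact: dotv_le_enorm.
apply: le_trans (cs _ _) _.
rewrite (_ : enorm xi ^+ 4 = enorm xi ^+ 2 * enorm xi ^+ 2); last by rewrite -exprD.
rewrite -mulrA ler_wpM2l ?sqr_ge0// enorm_sqr /dotv mulr_sumr; apply: ler_sum => i _.
rewrite !mxE -expr2; apply: le_trans (cs _ _) _; rewrite ler_wpM2l ?sqr_ge0//.
rewrite enorm_sqr; apply: ler_sum => j _; by rewrite !mxE expr2.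
Qed.

End segment_average.

Lemma slope_sum_measurable (R : realType) n (D : set 'rV[R]_n) (E : 'rV[R]_n -> 'M[R]_n) :
  measurable D -> (forall i j, measurable_fun D (fun x => E x i j)) ->
  measurable_fun setT (fun z => (\sum_i \sum_j E z i j ^+ 2) * \1_D z).
Proof.
move=> mD mE; have : measurable_fun D (fun z : 'rV[R]_n => \sum_i \sum_j E z i j ^+ 2).
  by do 2! (apply: measurable_sum => ?); exact: measurable_funX.
by move=> /(measurable_restrictT _ mD); apply: eq_measurable_fun => z _; rewrite patch_indic.
Qed.

Section increment_energy.
Context {R : realType} {n : nat}.
Local Notation V := 'rV[R]_n.
Local Notation leb := (lebesgueD n).
Local Notation I01 h := (\int[lebesgue_measure]_(s in `[0%R, 1%R]) h s)%R.
Variables (f : R -> R) (f0' finf rbar : R).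
Hypothesis hf : cohesive_potential f f0' finf rbar.

(** The argument of f equals h S^2 for the bond from x to x + xi, with h = |xi|. The bound linear in
    h makes the energy of the initial displacement uniform in the horizon. *)
Lemma increment_energy (D : set V) (u : V -> V) (E : V -> 'M[R]_n) (a : R) : (1 < n)%N ->
  open D -> SBD D u E -> measurable_fun setT u ->
  {ae leb, forall x, ~ interior_part D a x -> u x = 0} ->
  (hausdorff n.-1 (jump_set D u) < +oo)%E ->
  (\int[leb]_(x in D) (\sum_i \sum_j E x i j ^+ 2)%:E < +oo)%E ->
  exists2 C : R, 0 <= C & forall xi : V, xi != 0 -> enorm xi < a / 2 ->
    (\int[leb]_x (f (dotv (u (x + xi) - u x) xi ^+ 2 / enorm xi ^+ 3))%:E
      <= (C * enorm xi)%:E)%E.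
Proof.
move=> n1 oD sbd mu u0 Hoo Eoo.
have mD : measurable D by exact: open_measurable_rV.
have [ui Ei _] := sbd.
have mE i j : measurable_fun D (fun x => E x i j).
  by apply/measurable_EFinP; exact: measurable_int (Ei i j).
pose Q (z : V) : R := (\sum_i \sum_j E z i j ^+ 2) * \1_D z.
have Q0 z : 0 <= Q z.
  by rewrite mulr_ge0 ?indicE//; do 2! (apply: sumr_ge0 => ? _); exact: sqr_ge0.
have mQ : measurable_fun setT Q by exact: slope_sum_measurable.
have Qoo : (\int[leb]_x (Q x)%:E < +oo)%E.
  move: Eoo; rewrite integral_mkcond; congr (_ < _)%E; apply: eq_integral => x _.
  by rewrite epatch_indic/= EFinM.
have [C C0 hC] := sweep_cover n1 Hoo.
have fin0 : 0 <= finf by exact/ltW/(finf_gt0 hf).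
have f00 : 0 <= f0' by exact/ltW/(potential_slope_gt0 hf).
have IQ0 : (0 <= \int[leb]_x (Q x)%:E)%E by apply: integral_ge0 => x _; rewrite lee_fin.
(* [finf] times the volume constant of the cover, plus f'(0) times the integral of the squared
   strain density. *)
exists (finf * C + f0' * fine (\int[leb]_x (Q x)%:E)%E).
  by rewrite addr_ge0// mulr_ge0// fine_ge0.
move=> xi xi0 xia; have h0 : 0 < enorm xi by rewrite enorm_gt0.
have [c [r [hcov hU]]] := hC _ xi0.
set U := \bigcup_m cube (c m) (r m) in hU.
have mU : measurable U by apply: bigcupT_measurable => m; exact: measurable_cube.
pose g (x : V) := f (dotv (u (x + xi) - u x) xi ^+ 2 / enorm xi ^+ 3).
have arg0 x : 0 <= dotv (u (x + xi) - u x) xi ^+ 2 / enorm xi ^+ 3.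
  by rewrite divr_ge0 ?sqr_ge0 ?exprn_ge0// ltW.
have mg : measurable_fun setT g.
  apply: (measurable_potential hf) => //; apply: measurable_funM => //.
  apply: measurable_funX; apply: measurable_dotv => //.
  by apply: measurable_rVB => //; exact: measurable_fun_shift.
pose IQ x := (\int[lebesgue_measure]_(s in `[0%R, 1%R]) (Q (x + s *: xi))%:E)%E.
have IQx0 x : (0 <= IQ x)%E by apply: integral_ge0 => s _; rewrite lee_fin.
have mIQ : measurable_fun setT IQ.
  apply: (@measurable_segment _ _ (EFin \o Q)); first exact/measurable_EFinP.
  by move=> x; rewrite lee_fin.
have u0' : {ae leb, forall x, ~ interior_part D a (x + xi) -> u (x + xi) = 0}.
  exact: (ae_shift xi u0).
have defect := defect_ae oD sbd hcov xia.
have [line _] := line_average xi (integrable_along_strain xi mD Ei).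
apply: (@le_trans _ _ (\int[leb]_x ((finf * \1_U x)%:E + (f0' * enorm xi)%:E * IQ x))%E).
  apply: ae_ge0_le_integral => //.
  - by move=> x _; rewrite lee_fin (potential_ge0 hf).
  - exact/measurable_EFinP.
  - by move=> x _; rewrite adde_ge0// ?mule_ge0// lee_fin mulr_ge0 ?indicE// ltW.
  - apply: emeasurable_funD; last exact: measurable_funeM.
    by apply/measurable_EFinP; apply: measurable_funM => //; exact: measurable_indic.
  have uu : {ae leb, forall x, (~ interior_part D a x -> u x = 0) /\
      (~ interior_part D a (x + xi) -> u (x + xi) = 0)}.
    by apply: filterS2 u0 u0'.
  move: uu defect line; apply: filterS3 => x [ux ux'] dx lx _.

  have [xU|xU] := pselect (U x).
    rewrite indicE mem_set// mulr1 -[leLHS]adde0; apply: leeD; last first.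
      by rewrite mule_ge0// lee_fin mulr_ge0// ltW.
    by rewrite lee_fin (potential_le_finf hf).
  rewrite indicE memNset// mulr0 add0e.
  (* If neither endpoint lies in the interior part, u vanishes at both and the bond carries no
     energy; the defect is only known to vanish in the other case. *)
  have [xI|xI] := pselect (interior_part D a x \/ interior_part D a (x + xi)); last first.
    move/not_orP: xI => [/ux -> /ux' ->]; rewrite subrr dotv0l expr0n/= mul0r (potential0 hf).
    by rewrite mule_ge0// lee_fin mulr_ge0// ltW.
  have := dx xI xU; rewrite /increment_defect => /eqP; rewrite subr_eq0 => /eqP dE.
  (* The cut to D in [along_disp] is harmless: outside D, hence outside the interior part, u is
     already 0. *)
  have wE y : (~ interior_part D a y -> u y = 0) -> along_disp D u xi y = dotv (u y) xi.
    move=> uy; rewrite /along_disp indicE; have [yD|yD] := pselect (D y).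
      by rewrite mem_set// mulr1.
    by rewrite memNset// mulr0 uy ?dotv0l// => -[].
  rewrite !wE// in dE; rewrite dotvBl dE.
  apply: (@le_trans _ _ ((f0' / enorm xi ^+ 3)%:E *
     (I01 (fun s : R => along_strain D E xi (x + s *: xi)) ^+ 2)%:E)%E).
    rewrite -EFinM lee_fin; apply: le_trans (potential_le_linear hf _) _.
      by rewrite divr_ge0 ?sqr_ge0 ?exprn_ge0// ltW.
    by rewrite mulrA mulrAC.
  have -> : f0' * enorm xi = (f0' / enorm xi ^+ 3) * enorm xi ^+ 4.
    by field; rewrite gt_eqF.
  have k0 : 0 <= f0' / enorm xi ^+ 3 by rewrite divr_ge0 ?exprn_ge0// ltW.
  rewrite [(_ * enorm xi ^+ 4)%:E]EFinM -muleA; apply: lee_wpmul2l; first by rewrite lee_fin.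
  apply: le_trans (I01_sqr_le lx) _.
  have mQx : measurable_fun [set: R] (fun s : R => Q (x + s *: xi)).
    apply: measurableT_comp mQ _; apply: measurable_rVD => //; exact: measurable_rVZ.
  rewrite /IQ -ge0_integralZl//; last 3 first.
  - by apply/measurable_EFinP; exact: measurable_funS mQx.
  - by move=> s _; rewrite lee_fin.
  - by rewrite lee_fin exprn_ge0// ltW.
  apply: ge0_le_integral => //.
  - by move=> s _; rewrite lee_fin sqr_ge0.
  - apply/measurable_EFinP; apply: measurable_funX; apply/measurable_EFinP.
    exact: measurable_int lx.
  - apply: measurable_funeM; apply/measurable_EFinP; exact: measurable_funS mQx.
  by move=> s _; rewrite -EFinM lee_fin; exact: along_strain_sqr_le.
rewrite ge0_integralD//; last 4 first.
- by move=> x _; rewrite lee_fin mulr_ge0 ?indicE.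
- by apply/measurable_EFinP; apply: measurable_funM => //; exact: measurable_indic.
- by move=> x _; rewrite mule_ge0// lee_fin mulr_ge0// ltW.
- exact: measurable_funeM.
rewrite ge0_integralZl//; last by rewrite lee_fin mulr_ge0// ltW.
have mQe : measurable_fun setT (EFin \o Q) by exact/measurable_EFinP.
have -> : (\int[leb]_x IQ x = \int[leb]_x (Q x)%:E)%E.
  by rewrite -(tonelli_segment xi mQe)// => x; rewrite lee_fin.
under eq_integral do rewrite EFinM.
rewrite ge0_integralZl//; last by apply/measurable_EFinP; exact: measurable_indic.
rewrite integral_indic// setIT mulrDl EFinD; apply: leeD.
  by rewrite -mulrA EFinM lee_wpmul2l// lee_fin.
rewrite [(f0' * _ * _)%R]mulrAC [(f0' * enorm xi * _)%:E]EFinM fineK//.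
by rewrite ge0_fin_numE.
Qed.

End increment_energy.

(** * Square-integrable fields *)

Section square_integrable.
Context {R : realType} {n : nat}.
Local Notation V := 'rV[R]_n.
Local Notation leb := (lebesgueD n).
Implicit Types v w : V -> V.

Definition sqint v : Prop :=
  measurable_fun setT v /\ (\int[leb]_x (enorm (v x) ^+ 2)%:E < +oo)%E.

Definition sqn v : R := \int[leb]_x (enorm (v x) ^+ 2).

Definition ip v w : R := \int[leb]_x dotv (v x) (w x).

Lemma measurable_sqn v : measurable_fun setT v -> measurable_fun setT (fun x => enorm (v x) ^+ 2).
Proof. by move=> mv; apply: measurable_funX; exact: measurableT_comp measurable_enorm mv. Qed.

Lemma sqint_integrable v : sqint v -> leb.-integrable setT (EFin \o (fun x => enorm (v x) ^+ 2)).
Proof.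
move=> [mv voo]; apply/integrableP; split; first by apply/measurable_EFinP; exact: measurable_sqn.
by under eq_integral do rewrite /= ger0_norm ?sqr_ge0//.
Qed.

Lemma sqint_bounded v (g : V -> R) : measurable_fun setT v ->
  (forall x, enorm (v x) ^+ 2 <= g x) -> leb.-integrable setT (EFin \o g) -> sqint v.
Proof.
move=> mv vg /integrableP[mg goo]; split => //; apply: le_lt_trans goo.
apply: ge0_le_integral => //.
- by move=> x _; rewrite lee_fin sqr_ge0.
- by apply/measurable_EFinP; exact: measurable_sqn.
- exact: measurableT_comp.
by move=> x _; rewrite lee_fin (le_trans (vg x))// ler_norm.
Qed.

Lemma enormD_sqr (x y : V) : enorm (x + y) ^+ 2 = enorm x ^+ 2 + 2 * dotv x y + enorm y ^+ 2.
Proof. by rewrite !enorm_sqr !(dotvDl, dotvDr) [dotv y x]dotvC; ring. Qed.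

Lemma dotv_young (x y : V) (t : R) : 0 < t ->
  2 * `|dotv x y| <= t * enorm x ^+ 2 + t^-1 * enorm y ^+ 2.
Proof.
move=> t0; have := dotv_le_enorm x y; have := enorm_ge0 x; have := enorm_ge0 y.
move: (enorm x) (enorm y) `|_| => p q d q0 p0 h.
apply: (@le_trans _ _ (2 * (p * q))); first by rewrite ler_pM2l.
rewrite -subr_ge0 (_ : _ - _ = t^-1 * (t * p - q) ^+ 2).
  by rewrite mulr_ge0 ?sqr_ge0// invr_ge0 ltW.
by field; rewrite gt_eqF.
Qed.

Lemma enormD_sqr_le (x y : V) (t : R) : 0 < t ->
  enorm (x + y) ^+ 2 <= (1 + t) * enorm x ^+ 2 + (1 + t^-1) * enorm y ^+ 2.
Proof.
move=> t0; rewrite enormD_sqr; have := dotv_young x y t0; have := ler_norm (dotv x y); lra.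
Qed.

Lemma integrable_dotv v w : sqint v -> sqint w ->
  leb.-integrable setT (EFin \o (fun x => dotv (v x) (w x))).
Proof.
move=> sv sw; have iv := sqint_integrable sv; have iw := sqint_integrable sw.
apply: (le_integrable measurableT _ _ (integrableD measurableT iv iw)).
  by apply/measurable_EFinP; apply: measurable_dotv; [exact: sv.1|exact: sw.1].
move=> x _; change (`|dotv (v x) (w x)|%:E <= `|enorm (v x) ^+ 2 + enorm (w x) ^+ 2|%:E)%E.
rewrite lee_fin [leRHS]ger0_norm ?addr_ge0 ?sqr_ge0//.
have := dotv_young (v x) (w x) (@ltr01 R); rewrite invr1 !mul1r.
have := normr_ge0 (dotv (v x) (w x)); lra.
Qed.

Lemma sqintD v w : sqint v -> sqint w -> sqint (fun x => v x + w x).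
Proof.
move=> sv sw; have iv := sqint_integrable sv; have iw := sqint_integrable sw.
apply: (@sqint_bounded _ (fun x => 2 * enorm (v x) ^+ 2 + 2 * enorm (w x) ^+ 2)).
- by apply: measurable_rVD; [exact: sv.1|exact: sw.1].
- move=> x; have := enormD_sqr_le (v x) (w x) (@ltr01 R); rewrite invr1; lra.
- have := integrableD measurableT (integrableZl measurableT 2 iv) (integrableZl measurableT 2 iw).
  by apply: eq_integrable => // x _; rewrite /= -!EFinM -EFinD.
Qed.

Lemma sqintZ (k : R) v : sqint v -> sqint (fun x => k *: v x).
Proof.
move=> sv; apply: (@sqint_bounded _ (fun x => k ^+ 2 * enorm (v x) ^+ 2)).
- by apply: measurable_rVZ => //; exact: sv.1.
- by move=> x; rewrite enormZ exprMn real_normK ?num_real.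
- have := integrableZl measurableT (k ^+ 2) (sqint_integrable sv).
  by apply: eq_integrable => // x _; rewrite /= -!EFinM.
Qed.

Lemma sqintB v w : sqint v -> sqint w -> sqint (fun x => v x - w x).
Proof.
move=> sv sw; have := sqintD sv (sqintZ (-1) sw).
by congr sqint; apply/funext => x; rewrite scaleN1r.
Qed.

Lemma sqn_ge0 v : 0 <= sqn v.
Proof. by apply: Rintegral_ge0 => // x _; exact: sqr_ge0. Qed.

Lemma sqnE v : sqint v -> (sqn v)%:E = (\int[leb]_x (enorm (v x) ^+ 2)%:E)%E.
Proof. by move=> sv; rewrite /sqn /Rintegral fineK//; exact: integrable_fin_num (sqint_integrable sv). Qed.

Lemma sqnZ (k : R) v : sqint v -> sqn (fun x => k *: v x) = k ^+ 2 * sqn v.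
Proof.
move=> sv; rewrite /sqn -RintegralZl//; last exact: sqint_integrable.
by apply: eq_Rintegral => x _; rewrite enormZ exprMn real_normK ?num_real.
Qed.

Lemma sqnD v w : sqint v -> sqint w -> sqn (fun x => v x + w x) = sqn v + 2 * ip v w + sqn w.
Proof.
move=> sv sw; have id := integrable_dotv sv sw.
have id2 : leb.-integrable setT (EFin \o (fun x => 2 * dotv (v x) (w x))).
  by apply: eq_integrable (integrableZl measurableT 2 id) => // x _; rewrite /= EFinM.
rewrite /sqn /ip -RintegralZl// -RintegralD//; last exact: sqint_integrable.
rewrite -RintegralD//; last exact: sqint_integrable.
  by apply: eq_Rintegral => x _; exact: enormD_sqr.
have := integrableD measurableT (sqint_integrable sv) id2.
by apply: eq_integrable => // x _.
Qed.

Lemma ipDr v w w' : sqint v -> sqint w -> sqint w' ->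
  ip v (fun x => w x + w' x) = ip v w + ip v w'.
Proof.
move=> sv sw sw'; rewrite /ip -RintegralD//; [|exact: integrable_dotv..].
by apply: eq_Rintegral => x _; rewrite dotvDr.
Qed.

Lemma ipDl v v' w : sqint v -> sqint v' -> sqint w ->
  ip (fun x => v x + v' x) w = ip v w + ip v' w.
Proof.
move=> sv sw sw'; rewrite /ip -RintegralD//; [|exact: integrable_dotv..].
by apply: eq_Rintegral => x _; rewrite dotvDl.
Qed.

Lemma ipZr (k : R) v w : sqint v -> sqint w -> ip v (fun x => k *: w x) = k * ip v w.
Proof.
move=> sv sw; rewrite /ip -RintegralZl//; last exact: integrable_dotv.
by apply: eq_Rintegral => x _; rewrite dotvZr.
Qed.

Lemma ipC v w : ip v w = ip w v.
Proof. by apply: eq_Rintegral => x _; rewrite dotvC. Qed.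

Lemma sqnBC v w : sqn (fun x => v x - w x) = sqn (fun x => w x - v x).
Proof. by apply: eq_Rintegral => x _; rewrite enormBC. Qed.

Lemma ip_young v w (t : R) : sqint v -> sqint w -> 0 < t ->
  2 * ip v w <= t * sqn v + t^-1 * sqn w.
Proof.
move=> sv sw t0; have := sqnD (sqintZ t sv) (sqintZ (-1) sw).
rewrite ipZr//; last exact: sqintZ.
rewrite [ip _ w]ipC ipZr// [ip w v]ipC !sqnZ// => E.
have := sqn_ge0 (fun x => t *: v x + -1 *: w x); rewrite E => h.
rewrite -(ler_pM2l t0) mulrDr mulrA [t * (t^-1 * _)]mulrA mulfV ?gt_eqF// mul1r; nra.
Qed.

(** Continuity of the inner product at 0: Young's inequality with weight e / (1 + sqn v). *)
Lemma ip_small v (e : R) : sqint v -> 0 < e ->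
  exists2 d : R, 0 < d & forall w, sqint w -> sqn w < d -> ip v w <= e.
Proof.
move=> sv e0; have q0 := sqn_ge0 v.
have t0 : 0 < e / (1 + sqn v) by rewrite divr_gt0// ltr_wpDr.
exists (e * (e / (1 + sqn v))) => [|w sw wd]; first by rewrite mulr_gt0.
have h := ip_young sv sw t0.
have h1 : e / (1 + sqn v) * sqn v <= e.
  by rewrite mulrAC ler_pdivrMr ?ltr_wpDr// mulrDr mulr1 lerDr ltW.
have h2 : (e / (1 + sqn v))^-1 * sqn w <= e by rewrite mulrC ler_pdivrMr// ltW.
lra.
Qed.

Lemma sqnD_le v w (t : R) : sqint v -> sqint w -> 0 < t ->
  sqn (fun x => v x + w x) <= (1 + t) * sqn v + (1 + t^-1) * sqn w.
Proof. by move=> sv sw t0; rewrite sqnD//; have := ip_young sv sw t0; lra. Qed.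

Lemma L2norm_sqrE v : (L2norm v `^ 2 = \int[leb]_x (enorm (v x) ^+ 2)%:E)%E.
Proof.
rewrite /L2norm powR_Lnorm//; apply: eq_integral => x _.
by rewrite gee0_abs ?lee_fin ?enorm_ge0// poweR_EFin powR_mulrn ?enorm_ge0.
Qed.

Lemma L2norm_sqint v : measurable_fun setT v -> (L2norm v < +oo)%E -> sqint v.
Proof. by move=> mv voo; split => //; rewrite -L2norm_sqrE poweR_lty. Qed.

Lemma L2norm_sqn v (e : R) : sqint v -> 0 < e -> (L2norm v < e%:E)%E -> sqn v < e ^+ 2.
Proof.
move=> sv e0 ve; have v0 : (0 <= L2norm v)%E by exact: Lnorm_ge0.
have := L2norm_sqrE v; rewrite -sqnE//; move: v0 ve.
case: (L2norm v) => [r| |]//; rewrite lee_fin lte_fin poweR_EFin => r0 re [<-].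
by rewrite powR_mulrn// ltrXn2r// nnegrE// ltW.
Qed.

End square_integrable.

(** * Peridynamic energy *)

Section pair_kernels.
Context {R : realType} {n : nat}.
Local Notation V := 'rV[R]_n.
Local Notation leb := (lebesgueD n).
Implicit Types (v w : V -> V) (p : V * V).

Lemma measurable_pairB : measurable_fun setT (fun p : V * V => p.2 - p.1).
Proof. by apply: measurable_rVB; [exact: measurable_snd|exact: measurable_fst]. Qed.

Lemma measurable_pair_enorm : measurable_fun setT (fun p : V * V => enorm (p.2 - p.1)).
Proof. exact: measurableT_comp measurable_enorm measurable_pairB. Qed.

Lemma measurable_inv_comp d (T : measurableType d) (g : T -> R) :
  (forall x, 0 <= g x) -> measurable_fun setT g -> measurable_fun setT (fun x => (g x)^-1).
Proof.
move=> g0 mg; under eq_fun do rewrite -powR_inv1//.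
exact: measurableT_comp (measurable_powR _) mg.
Qed.

Lemma measurable_strain v : measurable_fun setT v ->
  measurable_fun setT (fun p : V * V => strain v p.2 p.1).
Proof.
move=> mv; rewrite /strain.
have mi : measurable_fun setT (fun p : V * V => (enorm (p.2 - p.1))^-1).
  by apply: measurable_inv_comp measurable_pair_enorm => p; exact: enorm_ge0.
have mvd : measurable_fun setT (fun p : V * V => v p.2 - v p.1).
  apply: measurable_rVB; first exact: measurableT_comp mv measurable_snd.
  exact: measurableT_comp mv measurable_fst.
rewrite (_ : (fun _ => _) = (fun p : V * V => (enorm (p.2 - p.1))^-1 * ((enorm (p.2 - p.1))^-1 *
    dotv (v p.2 - v p.1) (p.2 - p.1)))); last by apply/funext => p; rewrite dotvZl dotvZr.
do 2! (apply: measurable_funM => //).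
by apply: measurable_dotv => //; exact: measurable_pairB.
Qed.

Lemma strainE v x y : strain v y x = dotv (v y - v x) (y - x) / enorm (y - x) ^+ 2.
Proof. by rewrite /strain dotvZl dotvZr mulrA -invfM -expr2 mulrC. Qed.

Lemma strainC v x y : strain v y x = strain v x y.
Proof. by rewrite !strainE [enorm (x - y)]enormBC -(opprB y) -(opprB (v y)) dotvNl dotvNr opprK. Qed.

Lemma strainD v w x y : strain (fun z => v z + w z) y x = strain v y x + strain w y x.
Proof.
rewrite !strainE -mulrDl -dotvDl; congr (dotv _ _ / _).
by rewrite opprD addrACA.
Qed.

Lemma strain_sqr_le v x y :
  enorm (y - x) * strain v y x ^+ 2 <= (enorm (y - x))^-1 * enorm (v y - v x) ^+ 2.
Proof.
rewrite strainE; set h := enorm (y - x); have := enorm_ge0 (y - x); rewrite -/h le_eqVlt.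
move=> /predU1P[<-|h0]; first by rewrite invr0 !mul0r.
have -> : h * (dotv (v y - v x) (y - x) / h ^+ 2) ^+ 2 = h^-1 * (dotv (v y - v x) (y - x) ^+ 2 / h ^+ 2).
  by field; rewrite gt_eqF.
rewrite ler_pM2l ?invr_gt0// ler_pdivrMr ?exprn_gt0//.
have := dotv_le_enorm (v y - v x) (y - x); rewrite -/h => hd.
rewrite -exprMn -(real_normK (num_real (dotv _ _))).
by apply: lerXn2r => //; rewrite nnegrE// mulr_ge0 ?enorm_ge0// ltW.
Qed.

Lemma strain_dot_le v x y (z : V) :
  `|strain v y x * dotv z (y - x)| / enorm (y - x) <=
   (enorm (y - x) * strain v y x ^+ 2 + (enorm (y - x))^-1 * enorm z ^+ 2) / 2.
Proof.
set h := enorm (y - x); have := enorm_ge0 (y - x); rewrite -/h le_eqVlt.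
move=> /predU1P[<-|h0]; first by rewrite !invr0 !mul0r mulr0 addr0 mul0r.
have := dotv_le_enorm z (y - x); rewrite -/h => hd.
have : `|strain v y x * dotv z (y - x)| / h <= `|strain v y x| * enorm z.
  by rewrite ler_pdivrMr// normrM -mulrA ler_wpM2l.
move=> /le_trans; apply; rewrite -(real_normK (num_real (strain v y x))).
move: (`|strain v y x|) (enorm z) => s q.
rewrite ler_pdivlMr// -subr_ge0 (_ : _ - _ = h^-1 * (h * s - q) ^+ 2).
  by rewrite mulr_ge0 ?sqr_ge0// invr_ge0 ltW.
by field; rewrite gt_eqF.
Qed.

(** Dominates the bonds: h S^2 is at most the squared increment of the field divided by h. It is
    integrable in dimension at least 2. *)
Definition inv_kernel (eps : R) (z : V) : R := (enorm z)^-1 * \1_(eball 0 eps) z.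

Lemma inv_kernel_ge0 eps z : 0 <= inv_kernel eps z.
Proof. by rewrite mulr_ge0 ?invr_ge0 ?enorm_ge0// indicE. Qed.

Lemma measurable_inv_kernel eps : measurable_fun setT (inv_kernel eps).
Proof.
apply: measurable_funM; first by apply: measurable_inv_comp measurable_enorm => z; exact: enorm_ge0.
by apply: measurable_indic; exact: measurable_eball.
Qed.

Definition inv_kernel_mass (eps : R) : R := fine (\int[leb]_z (inv_kernel eps z)%:E)%E.

Lemma inv_kernel_massE eps : (1 < n)%N -> 0 < eps ->
  (inv_kernel_mass eps)%:E = (\int[leb]_z (inv_kernel eps z)%:E)%E.
Proof.
move=> n1 e0; rewrite /inv_kernel_mass fineK// ge0_fin_numE.
  have := integral_inv_enorm_fin n1 e0; rewrite integral_mkcond; congr (_ < _)%E.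
  by apply: eq_integral => x _; rewrite epatch_indic/= -EFinM.
by apply: integral_ge0 => x _; rewrite lee_fin inv_kernel_ge0.
Qed.

Lemma inv_kernel_integral1 eps (al : V -> R) : (1 < n)%N -> 0 < eps ->
  measurable_fun setT al -> (forall x, 0 <= al x) ->
  (\int[leb]_x \int[leb]_y (inv_kernel eps (y - x) * al x)%:E =
    (inv_kernel_mass eps)%:E * \int[leb]_x (al x)%:E)%E.
Proof.
move=> n1 e0 mal al0; have mk := measurable_inv_kernel eps.
have mke : measurable_fun setT (EFin \o inv_kernel eps) by exact/measurable_EFinP.
rewrite -ge0_integralZl//; last 3 first.
- exact/measurable_EFinP.
- by move=> x _; rewrite lee_fin.
- by rewrite inv_kernel_massE//; apply: integral_ge0 => x _; rewrite lee_fin inv_kernel_ge0.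
apply: eq_integral => x _; under eq_integral do rewrite mulrC EFinM.
rewrite ge0_integralZl//; last 3 first.
- by apply/measurable_EFinP; apply: measurableT_comp mk _; exact: measurable_rVB.
- by move=> y _; rewrite lee_fin inv_kernel_ge0.
- by rewrite lee_fin.
rewrite muleC (inv_kernel_massE n1 e0); apply: (congr1 (fun z => (z * _)%E)).
have mke0 y : (0 <= (EFin \o inv_kernel eps) y)%E by rewrite lee_fin inv_kernel_ge0.
exact: (ge0_integral_shift (- x) mke mke0).
Qed.

Lemma measurable_pair_kernel eps : measurable_fun setT (fun p : V * V => inv_kernel eps (p.2 - p.1)).
Proof. exact: measurableT_comp (measurable_inv_kernel eps) measurable_pairB. Qed.

Lemma inv_kernelN eps z : inv_kernel eps (- z) = inv_kernel eps z.
Proof.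
rewrite /inv_kernel enormN !indicE; congr (_ * (nat_of_bool _)%:R).
by apply/idP/idP; rewrite !inE /eball/= !subr0 enormN.
Qed.

Lemma inv_kernel_integral2 eps (al : V -> R) : (1 < n)%N -> 0 < eps ->
  measurable_fun setT al -> (forall x, 0 <= al x) ->
  (\int[leb]_x \int[leb]_y (inv_kernel eps (y - x) * al y)%:E =
    (inv_kernel_mass eps)%:E * \int[leb]_x (al x)%:E)%E.
Proof.
move=> n1 e0 mal al0.
have mF : measurable_fun setT (fun p : V * V => (inv_kernel eps (p.2 - p.1) * al p.2)%:E).
  apply/measurable_EFinP; apply: measurable_funM; first exact: measurable_pair_kernel.
  exact: measurableT_comp mal measurable_snd.
have F0 (p : V * V) : (0 <= (inv_kernel eps (p.2 - p.1) * al p.2)%:E)%E.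
  by rewrite lee_fin mulr_ge0 ?inv_kernel_ge0.
have FT := @fubini_tonelli _ _ V V R leb leb
  (fun p : V * V => (inv_kernel eps (p.2 - p.1) * al p.2)%:E) mF F0.
etransitivity; first exact: FT.
rewrite -(inv_kernel_integral1 n1 e0 mal al0) {FT}; apply: eq_integral => y _; apply: eq_integral => x _ /=.
by rewrite -opprB inv_kernelN.
Qed.

Lemma integrable_pair_kernel eps v : (1 < n)%N -> 0 < eps -> sqint v ->
  (leb \x leb)%E.-integrable setT
    (EFin \o (fun p : V * V => inv_kernel eps (p.2 - p.1) * (enorm (v p.1) ^+ 2 + enorm (v p.2) ^+ 2))) /\
  \int[(leb \x leb)%E]_p (inv_kernel eps (p.2 - p.1) * (enorm (v p.1) ^+ 2 + enorm (v p.2) ^+ 2)) =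
    2 * inv_kernel_mass eps * sqn v.
Proof.
move=> n1 e0 sv; have mv := measurable_sqn sv.1.
set F := (fun p : V * V => _).
have F0 p : 0 <= F p by rewrite mulr_ge0 ?inv_kernel_ge0// addr_ge0 ?sqr_ge0.
have mF : measurable_fun setT F.
  apply: measurable_funM; first exact: measurable_pair_kernel.
  by apply: measurable_funD; [exact: measurableT_comp mv measurable_fst|exact: measurableT_comp mv measurable_snd].
have E : (\int[(leb \x leb)%E]_p (F p)%:E = (2 * inv_kernel_mass eps * sqn v)%:E)%E.
  rewrite fubini_tonelli1//; last exact/measurable_EFinP.
  have mk x : measurable_fun setT (fun y : V => inv_kernel eps (y - x)).
    by apply: measurableT_comp (measurable_inv_kernel eps) _; exact: measurable_rVB.
  transitivity (\int[leb]_x (\int[leb]_y (inv_kernel eps (y - x) * enorm (v x) ^+ 2)%:E +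
      \int[leb]_y (inv_kernel eps (y - x) * enorm (v y) ^+ 2)%:E))%E.
    apply: eq_integral => x _; rewrite /fubini_F -ge0_integralD//.
    - by apply: eq_integral => y _; rewrite /F/= mulrDr EFinD.
    - by move=> y _; rewrite lee_fin mulr_ge0 ?sqr_ge0 ?inv_kernel_ge0.
    - by apply/measurable_EFinP; apply: measurable_funM.
    - by move=> y _; rewrite lee_fin mulr_ge0 ?sqr_ge0 ?inv_kernel_ge0.
    - by apply/measurable_EFinP; apply: measurable_funM.
  rewrite ge0_integralD//; last 4 first.
  - by move=> x _; apply: integral_ge0 => y _; rewrite lee_fin mulr_ge0 ?sqr_ge0 ?inv_kernel_ge0.
  - apply: (@measurable_fun_fubini_tonelli_F _ _ V V R leb
      (fun p => (inv_kernel eps (p.2 - p.1) * enorm (v p.1) ^+ 2)%:E)).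
      apply/measurable_EFinP; apply: measurable_funM; first exact: measurable_pair_kernel.
      exact: measurableT_comp mv measurable_fst.
    by move=> p; rewrite lee_fin mulr_ge0 ?sqr_ge0 ?inv_kernel_ge0.
  - by move=> x _; apply: integral_ge0 => y _; rewrite lee_fin mulr_ge0 ?sqr_ge0 ?inv_kernel_ge0.
  - apply: (@measurable_fun_fubini_tonelli_F _ _ V V R leb
      (fun p => (inv_kernel eps (p.2 - p.1) * enorm (v p.2) ^+ 2)%:E)).
      apply/measurable_EFinP; apply: measurable_funM; first exact: measurable_pair_kernel.
      exact: measurableT_comp mv measurable_snd.
    by move=> p; rewrite lee_fin mulr_ge0 ?sqr_ge0 ?inv_kernel_ge0.
  have s0 x : 0 <= enorm (v x) ^+ 2 by exact: sqr_ge0.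
  rewrite (inv_kernel_integral1 n1 e0 mv s0) (inv_kernel_integral2 n1 e0 mv s0).
  by rewrite -(sqnE sv) -EFinM -EFinD; congr EFin; ring.
split; last by rewrite /Rintegral E.
apply/integrableP; split; first exact/measurable_EFinP.
by under eq_integral do rewrite /= ger0_norm//; rewrite E ltry.
Qed.

End pair_kernels.

Lemma measurable_potential_deriv (R : realType) (f : R -> R) (f0' finf rbar : R) (f' : R -> R)
    d (T : measurableType d) (g : T -> R) : cohesive_potential f f0' finf rbar ->
  (forall r : R, 0 <= r -> (s - r)^-1 * (f s - f r) @[s --> within `[0, +oo[ (r^')] --> f' r) ->
  measurable_fun setT g -> (forall x, 0 <= g x) -> measurable_fun setT (fun x => f' (g x)).
Proof.
move=> hf hf' mg g0; have mf : measurable_fun [set: R] (fun s => f' (Num.max 0 s)).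
  apply: nonincreasing_measurable => // s t st; apply: (potential_deriv_anti hf hf').
    by rewrite le_max lexx.
  by rewrite ge_max !le_max lexx st orbT.
have := measurableT_comp mf mg; apply: eq_measurable_fun => x _ /=.
by rewrite max_r.
Qed.

Section peridynamic_energy.
Context {R : realType} {n : nat}.
Local Notation V := 'rV[R]_n.
Local Notation leb := (lebesgueD n).
Local Notation leb2 := (lebesgueD n \x lebesgueD n)%E.
Variables (f : R -> R) (f0' finf rbar : R) (J : R -> R) (eps M : R).
Hypotheses (hf : cohesive_potential f f0' finf rbar) (hJ : influence_function J)
  (e0 : 0 < eps) (n1 : (1 < n)%N) (JM : forall r, 0 <= r -> J r <= M).
Implicit Types (u v w g : V -> V) (p : V * V).

Definition bond_weight (z : V) : R := J (enorm z / eps).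

Definition bond_energy u p : R :=
  bond_weight (p.2 - p.1) * f (enorm (p.2 - p.1) * strain u p.2 p.1 ^+ 2).

(** The factor h of the energy cancels the 1/h of the density. The integral runs over all pairs of
    points: J removes bonds longer than eps, and for a field that vanishes off the interior part,
    with eps < a, bonds that leave D carry no energy. *)
Definition PD u : R :=
  (eps ^+ n * ball_volume R n * eps)^-1 * \int[leb2]_p bond_energy u p.

Definition bond_quadratic w p : R :=
  bond_weight (p.2 - p.1) * (enorm (p.2 - p.1) * strain w p.2 p.1 ^+ 2).

(** Bound for the quadratic part of the energy relative to the squared L^2 norm. The mass of the
    kernel scales like eps^(n-1), so this constant scales like eps^-2; it enters only through the
    length of time steps. *)
Definition PD_bound : R :=
  (eps ^+ n * ball_volume R n * eps)^-1 * (2 * M * (2 * inv_kernel_mass (n := n) eps)).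

Let c : R := (eps ^+ n * ball_volume R n * eps)^-1.

Let c0 : 0 < c.
Proof. by rewrite invr_gt0 !mulr_gt0 ?exprn_gt0 ?ball_volume_gt0. Qed.

Let M0 : 0 <= M.
Proof. exact: le_trans (influence_ge0 hJ (lexx 0)) (JM (lexx 0)). Qed.

Let f00 : 0 <= f0'.
Proof. exact/ltW/(potential_slope_gt0 hf). Qed.

Let arg0 u p : 0 <= enorm (p.2 - p.1) * strain u p.2 p.1 ^+ 2.
Proof. by rewrite mulr_ge0 ?enorm_ge0 ?sqr_ge0. Qed.

Lemma bond_weight_ge0 z : 0 <= bond_weight z.
Proof. by apply: (influence_ge0 hJ); rewrite divr_ge0 ?enorm_ge0// ltW. Qed.

Lemma bond_weight_le z : bond_weight z <= M.
Proof. by apply: JM; rewrite divr_ge0 ?enorm_ge0// ltW. Qed.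

Lemma bond_weight_out z : eps <= enorm z -> bond_weight z = 0.
Proof. by move=> h; apply: (influence_support hJ); rewrite ler_pdivlMr// mul1r. Qed.

Lemma bond_weight_inv_le z : bond_weight z * (enorm z)^-1 <= M * inv_kernel eps z.
Proof.
rewrite /inv_kernel indicE; have [ze|ze] := ltP (enorm z) eps.
  rewrite mem_set; last by rewrite /eball/= subr0.
  by rewrite mulr1 ler_wpM2r ?bond_weight_le// invr_ge0 enorm_ge0.
by rewrite bond_weight_out// mul0r !mulr_ge0 ?invr_ge0 ?enorm_ge0.
Qed.

Lemma measurable_bond_weight : measurable_fun setT bond_weight.
Proof.
have mg : measurable_fun setT (fun z : V => enorm z / eps).
  by apply: measurable_funM => //; exact: measurable_enorm.
have sub : [set enorm z / eps | z in [set: V]] `<=` `[0, +oo[%classic.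
  by move=> _ [z _ <-]; rewrite /= in_itv/= andbT divr_ge0 ?enorm_ge0// ltW.
exact: (measurable_comp _ sub (influence_measurable hJ) mg).
Qed.

Lemma measurable_pair_weight : measurable_fun setT (fun p : V * V => bond_weight (p.2 - p.1)).
Proof. exact: measurableT_comp measurable_bond_weight measurable_pairB. Qed.

Lemma measurable_pair_arg u : measurable_fun setT u ->
  measurable_fun setT (fun p : V * V => enorm (p.2 - p.1) * strain u p.2 p.1 ^+ 2).
Proof.
move=> mu; apply: measurable_funM; first exact: measurable_pair_enorm.
by apply: measurable_funX; exact: measurable_strain.
Qed.

Lemma bond_energy_ge0 u p : 0 <= bond_energy u p.
Proof. by rewrite mulr_ge0 ?bond_weight_ge0// (potential_ge0 hf). Qed.

Lemma measurable_bond_energy u : measurable_fun setT u -> measurable_fun setT (bond_energy u).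
Proof.
move=> mu; apply: measurable_funM; first exact: measurable_pair_weight.
by apply: (measurable_potential hf) => [|p]; [exact: measurable_pair_arg|exact: arg0].
Qed.

Let dom w p : R := 2 * M * (inv_kernel eps (p.2 - p.1) *
  (enorm (w p.1) ^+ 2 + enorm (w p.2) ^+ 2)).

Let dom_ge0 w p : 0 <= dom w p.
Proof.
by apply: mulr_ge0; [exact: mulr_ge0|apply: mulr_ge0; [exact: inv_kernel_ge0|rewrite addr_ge0 ?sqr_ge0]].
Qed.

Lemma bond_quadratic_ge0 w p : 0 <= bond_quadratic w p.
Proof. by rewrite mulr_ge0 ?bond_weight_ge0. Qed.

Let bond_quadratic_le w p : bond_quadratic w p <= dom w p.
Proof.
rewrite /bond_quadratic; apply: le_trans (ler_wpM2l (bond_weight_ge0 _) (strain_sqr_le w p.1 p.2)) _.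
rewrite mulrA; apply: le_trans (ler_wpM2r (sqr_ge0 _) (bond_weight_inv_le _)) _.
rewrite /dom (_ : 2 * M * _ = M * inv_kernel eps (p.2 - p.1) *
  (2 * (enorm (w p.1) ^+ 2 + enorm (w p.2) ^+ 2))); last by ring.
apply: ler_wpM2l; first by rewrite mulr_ge0 ?inv_kernel_ge0.
have := enormD_sqr_le (w p.2) (- w p.1) (@ltr01 R); rewrite enormN invr1; lra.
Qed.

Let integrable_dom w : sqint w -> leb2.-integrable setT (EFin \o dom w).
Proof.
move=> sw; have [h _] := integrable_pair_kernel n1 e0 sw.
by apply: eq_integrable (integrableZl measurableT (2 * M) h) => // p _; rewrite /= -EFinM.
Qed.

Let integral_dom w : sqint w -> c * \int[leb2]_p dom w p = PD_bound * sqn w.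
Proof.
move=> sw; have [h hE] := integrable_pair_kernel n1 e0 sw.
by rewrite /dom RintegralZl// hE /PD_bound -/c; ring.
Qed.

Let integrable_dominated (G H : V * V -> R) : measurable_fun setT G ->
  (forall p, `|G p| <= H p) -> leb2.-integrable setT (EFin \o H) ->
  leb2.-integrable setT (EFin \o G).
Proof.
move=> mG GH; apply: le_integrable => //; first exact/measurable_EFinP.
by move=> p _; rewrite /= lee_fin (le_trans (GH p))// ler_norm.
Qed.

Lemma integrable_bond_quadratic w : sqint w ->
  leb2.-integrable setT (EFin \o bond_quadratic w).
Proof.
move=> sw; apply: integrable_dominated (integrable_dom sw).
  by apply: measurable_funM; [exact: measurable_pair_weight|exact: measurable_pair_arg sw.1].
by move=> p; rewrite ger0_norm ?bond_quadratic_ge0.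
Qed.

Lemma bond_quadratic_integral_le w : sqint w ->
  c * \int[leb2]_p bond_quadratic w p <= PD_bound * sqn w.
Proof.
move=> sw; rewrite -integral_dom// ler_pM2l//.
by apply: le_Rintegral => // [|]; [exact: integrable_bond_quadratic|exact: integrable_dom].
Qed.

Lemma integrable_bond_energy u : sqint u -> leb2.-integrable setT (EFin \o bond_energy u).
Proof.
move=> su; have := integrableZl measurableT f0' (integrable_bond_quadratic su).
rewrite (_ : (fun _ => _) = EFin \o (fun p => f0' * bond_quadratic u p)); last first.
  by apply/funext => p; rewrite /= EFinM.
apply: integrable_dominated; first exact: measurable_bond_energy su.1.
move=> p; rewrite ger0_norm ?bond_energy_ge0// /bond_quadratic mulrCA ler_wpM2l ?bond_weight_ge0//.
exact: (potential_le_linear hf).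
Qed.

Lemma PD_ge0 u : 0 <= PD u.
Proof.
by rewrite mulr_ge0 ?(ltW c0)//; apply: Rintegral_ge0 => p _; exact: bond_energy_ge0.
Qed.

Let bond_strainD u w p : strain (fun x => u x + w x) p.2 p.1 = strain u p.2 p.1 + strain w p.2 p.1.
Proof. exact: strainD. Qed.

(** Young's inequality splits h (S + S')^2 with factors 1 + t and 1 + 1/t. Monotonicity and
    subadditivity of f separate the terms, star-shapedness extracts 1 + t from the first, and f(r)
    <= f'(0) r bounds the second. *)
Lemma PD_quasi_subadditive u w (t : R) : sqint u -> sqint w -> 0 < t ->
  PD (fun x => u x + w x) <= (1 + t) * PD u + (1 + t^-1) * f0' * PD_bound * sqn w.
Proof.
move=> su sw t0.
have iq := integrable_bond_quadratic sw; have ie := integrable_bond_energy su.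
have i1 : leb2.-integrable setT (EFin \o (fun p => (1 + t) * bond_energy u p)).
  by apply: eq_integrable (integrableZl measurableT (1 + t) ie) => // p _; rewrite /= EFinM.
have i2 : leb2.-integrable setT (EFin \o (fun p => (1 + t^-1) * f0' * bond_quadratic w p)).
  by apply: eq_integrable (integrableZl measurableT ((1 + t^-1) * f0') iq) => // p _; rewrite /= EFinM.
have i12 : leb2.-integrable setT (EFin \o (fun p => (1 + t) * bond_energy u p
    + (1 + t^-1) * f0' * bond_quadratic w p)).
  by apply: eq_integrable (integrableD measurableT i1 i2) => // p _.
have key : \int[leb2]_p bond_energy (fun x => u x + w x) p <=
    (1 + t) * (\int[leb2]_p bond_energy u p) + (1 + t^-1) * f0' * (\int[leb2]_p bond_quadratic w p).
  rewrite -!RintegralZl// -RintegralD//.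
  apply: le_Rintegral => //; first exact: integrable_bond_energy (sqintD su sw).
  move=> p _; rewrite /bond_energy /bond_quadratic bond_strainD.
  set b := bond_weight _; set h := enorm _; set S := strain u _ _; set S' := strain w _ _.
  have h0 : 0 <= h by exact: enorm_ge0.
  rewrite [leRHS](_ : _ = b * ((1 + t) * f (h * S ^+ 2) + f0' * ((1 + t^-1) * (h * S' ^+ 2)))); last by ring.
  rewrite ler_wpM2l ?bond_weight_ge0//.
  have r0 : 0 <= h * S ^+ 2 by rewrite mulr_ge0 ?sqr_ge0.
  have r0' : 0 <= (1 + t^-1) * (h * S' ^+ 2).
    by apply: mulr_ge0; [rewrite addr_ge0// invr_ge0 ltW|rewrite mulr_ge0 ?sqr_ge0].
  have rt : 0 <= (1 + t) * (h * S ^+ 2) by rewrite mulr_ge0// addr_ge0// ltW.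
  have hS : h * (S + S') ^+ 2 <= (1 + t) * (h * S ^+ 2) + (1 + t^-1) * (h * S' ^+ 2).
    rewrite -subr_ge0 (_ : _ - _ = h * (t^-1 * (t * S - S') ^+ 2)).
      by apply: mulr_ge0 => //; apply: mulr_ge0; [rewrite invr_ge0 ltW|exact: sqr_ge0].
    by field; rewrite gt_eqF.
  apply: (le_trans (potential_mono hf (mulr_ge0 h0 (sqr_ge0 _)) hS)).
  have sub := potential_subadditive hf rt r0'.
  have star : f ((1 + t) * (h * S ^+ 2)) <= (1 + t) * f (h * S ^+ 2).
    by apply: (potential_star_ge1 hf) => //; rewrite lerDl ltW.
  have lin := potential_le_linear hf r0'.
  lra.
have := bond_quadratic_integral_le sw; move: key; rewrite /PD -/c.
have t0' : 0 <= (1 + t^-1) * f0' by rewrite mulr_ge0// addr_ge0// invr_ge0 ltW.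
move: (\int[_]_p _) (\int[_]_p _) (\int[_]_p _) => A B C h1 h2.
have := ler_wpM2l (ltW c0) h1; have := ler_wpM2l t0' h2; lra.
Qed.

Variable f' : R -> R.
Hypothesis hf' : forall r : R, 0 <= r ->
  (s - r)^-1 * (f s - f r) @[s --> within `[0, +oo[ (r^')] --> f' r.

(** The derivative of f(h S^2) in S, weighted and divided by h^2. Multiplied by the component of
    w(y) - w(x) along y - x, it is the first variation of the bond energy in the direction w. *)
Definition bond_force u p : R :=
  let h := enorm (p.2 - p.1) in let S := strain u p.2 p.1 in
  bond_weight (p.2 - p.1) * (2 * h * S * f' (h * S ^+ 2)) / h ^+ 2.

Lemma bond_forceC u x y : bond_force u (y, x) = bond_force u (x, y).
Proof. by rewrite /bond_force /= /bond_weight strainC [enorm (x - y)]enormBC. Qed.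

Lemma measurable_bond_force u : measurable_fun setT u -> measurable_fun setT (bond_force u).
Proof.
move=> mu; have mS := measurable_strain mu; have mh := @measurable_pair_enorm R n.
apply: measurable_funM; first apply: measurable_funM.
- exact: measurable_pair_weight.
- apply: measurable_funM; first by apply: measurable_funM => //; exact: measurable_funM.
  apply: (measurable_potential_deriv hf hf'); last exact: arg0.
  exact: measurable_pair_arg.
- by apply: measurable_inv_comp => [p|]; [exact: sqr_ge0|exact: measurable_funX].
Qed.

Let f'_le r : 0 <= r -> 0 <= f' r <= f0'.
Proof. by move=> r0; rewrite (potential_deriv_ge0 hf hf')// (potential_deriv_le hf hf'). Qed.

Lemma bond_force_dot_le u p (z : V) : `|bond_force u p * dotv z (p.2 - p.1)| <=
  f0' * (bond_quadratic u p + M * inv_kernel eps (p.2 - p.1) * enorm z ^+ 2).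
Proof.
have b0 := bond_weight_ge0 (p.2 - p.1); have bM := bond_weight_inv_le (p.2 - p.1).
have sd := strain_dot_le u p.1 p.2 z; have /andP[F0 Fle] := f'_le (arg0 u p).
rewrite /bond_force /bond_quadratic /=; move: b0 bM sd F0 Fle.
set b := bond_weight _; set h := enorm (p.2 - p.1); set S := strain _ _ _; set k := inv_kernel _ _.
move: (f' _) (dotv _ _) => F d b0 bM sd F0 Fle.
have [h0|h0] := eqVneq h 0.
  rewrite h0 mulr0 mul0r mul0r mulr0 mul0r mul0r normr0 mul0r mulr0 add0r.
  by apply: mulr_ge0 => //; apply: mulr_ge0; [apply: mulr_ge0 => //; exact: inv_kernel_ge0|exact: sqr_ge0].
have hp : 0 < h by rewrite lt_neqAle eq_sym h0 enorm_ge0.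
have -> : b * (2 * h * S * F) / h ^+ 2 * d = b * 2 * F * (S * d / h) by field.
rewrite normrM [`|S * d / h|]normrM [`|h^-1|]gtr0_norm ?invr_gt0//.
rewrite [`|b * 2 * F|]ger0_norm ?mulr_ge0//.
apply: (@le_trans _ _ (b * 2 * f0' * ((h * S ^+ 2 + h^-1 * enorm z ^+ 2) / 2))).
  by apply: ler_pM => //; [rewrite !mulr_ge0|rewrite mulr_ge0 ?invr_ge0 ?(ltW hp)|rewrite ler_wpM2l ?mulr_ge0].
rewrite [leLHS](_ : _ = f0' * (b * (h * S ^+ 2) + b * h^-1 * enorm z ^+ 2)); last by field.
by rewrite ler_wpM2l// lerD2l ler_wpM2r ?sqr_ge0.
Qed.

(** A bound free of u: it makes the force integrable in y for every single x, so that the integral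
    in [gradPD] can be split by coordinates. *)
Lemma bond_force_coord_le u p i : `|bond_force u p * (p.2 - p.1) ord0 i| <=
  M * (f0' * eps + finf) * inv_kernel eps (p.2 - p.1).
Proof.
have b0 := bond_weight_ge0 (p.2 - p.1); have bM := bond_weight_le (p.2 - p.1).
have bo := @bond_weight_out (p.2 - p.1); have /andP[F0 Fle] := f'_le (arg0 u p).
have Fs := potential_deriv_star hf hf' (arg0 u p); have Ff := potential_le_finf hf (arg0 u p).
have hz := norm_coord_enorm (p.2 - p.1) i; have fin0 := finf_gt0 hf.
rewrite /bond_force /inv_kernel indicE /=; move: b0 bM bo F0 Fle Fs Ff hz.
set b := bond_weight _; set h := enorm (p.2 - p.1); set S := strain _ _ _.
move: ((p.2 - p.1) ord0 i) (f' _) (f _) => z F f1 b0 bM bo F0 Fle Fs Ff hz.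
have [h0|h0] := eqVneq h 0.
  by rewrite h0 mulr0 mul0r mul0r mulr0 mul0r mul0r normr0 invr0 mul0r mulr0.
have hp : 0 < h by rewrite lt_neqAle eq_sym h0 enorm_ge0.
have [he|he] := ltP h eps; last first.
  rewrite bo// !mul0r normr0 mulr_ge0 ?mulr_ge0 ?invr_ge0 ?(ltW hp)//.
  by rewrite addr_ge0 ?mulr_ge0 ?(ltW e0) ?(ltW fin0).
rewrite mem_set; last by rewrite /eball/= subr0.
rewrite mulr1.
have -> : b * (2 * h * S * F) / h ^+ 2 * z = (b * (2 * h * S * F)) * (z / h) / h by field.
have zh : `|z / h| <= 1 by rewrite normrM [`|h^-1|]gtr0_norm ?invr_gt0// ler_pdivrMr// mul1r.
have key : `|2 * h * S * F| <= f0' * eps + finf.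
  rewrite (_ : 2 * h * S * F = h * F * (2 * S)); last by ring.
  have hF : 0 <= h * F by rewrite mulr_ge0 ?(ltW hp).
  rewrite normrM (ger0_norm hF).
  (* With F = f'(h S^2), h F |2S| <= h F + h S^2 F; the first term is at most f'(0) eps, the second
     at most f(h S^2) <= finf. *)
  have S2 : `|2 * S| <= 1 + S ^+ 2.
    by have := sqr_ge0 (1 + S); have := sqr_ge0 (1 - S); rewrite ler_norml => ? ?; apply/andP; split; lra.
  apply: le_trans (ler_wpM2l hF S2) _; rewrite mulrDr mulr1 lerD//; last by apply: le_trans Ff; lra.
  by rewrite mulrC ler_pM// ltW.
rewrite 2!normrM [`|h^-1|]gtr0_norm ?invr_gt0// ler_wpM2r ?invr_ge0 ?(ltW hp)//.
rewrite -[leRHS]mulr1; apply: ler_pM => //.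
by rewrite normrM (ger0_norm b0); apply: ler_pM.
Qed.

Lemma is_derive_energy_density (z : V) (S : R) :
  derive1 (fun S => energy_density f J eps S z) S =
  eps^-1 * J (enorm z / eps) * (enorm z)^-1 * (2 * enorm z * S * f' (enorm z * S ^+ 2)).
Proof.
rewrite derive1E /energy_density.
have h := is_derive_potential_sqr hf hf' S (enorm_ge0 z).
have h2 := is_deriveZ (eps^-1 * J (enorm z / eps) * (enorm z)^-1) h.
exact: (derive_val (is_derive := h2)).
Qed.

Let L1 u w p : R := bond_force u p * dotv (w p.1) (p.2 - p.1).
Let L2 u w p : R := bond_force u p * dotv (w p.2) (p.2 - p.1).

Let mdot (w : V -> V) (q : V * V -> V) : measurable_fun setT w -> measurable_fun setT q ->
  measurable_fun setT (fun p => dotv (w (q p)) (p.2 - p.1)).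
Proof.
move=> mw mq; apply: measurable_dotv; last exact: measurable_pairB.
exact: measurableT_comp mw mq.
Qed.

Let dom2 u w p : R := f0' * (dom u p + dom w p).

Let integrable_dom2 u w : sqint u -> sqint w -> leb2.-integrable setT (EFin \o dom2 u w).
Proof.
move=> su sw; have := integrableZl measurableT f0' (integrableD measurableT (integrable_dom su) (integrable_dom sw)).
by apply: eq_integrable => // p _; rewrite /= -EFinD -EFinM.
Qed.

Let half_le w p q : q = p.1 \/ q = p.2 ->
  M * inv_kernel eps (p.2 - p.1) * enorm (w q) ^+ 2 <= dom w p.
Proof.
move=> hq; rewrite /dom (_ : 2 * M * _ = M * inv_kernel eps (p.2 - p.1) *
  (2 * (enorm (w p.1) ^+ 2 + enorm (w p.2) ^+ 2))); last by ring.
apply: ler_wpM2l; first by apply: mulr_ge0 => //; exact: inv_kernel_ge0.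
have := sqr_ge0 (enorm (w p.1)); have := sqr_ge0 (enorm (w p.2)).
by case: hq => ->; lra.
Qed.

Let integrable_L1 u w : sqint u -> sqint w -> leb2.-integrable setT (EFin \o L1 u w).
Proof.
move=> su sw; apply: integrable_dominated (integrable_dom2 su sw).
  apply: measurable_funM; first exact: measurable_bond_force su.1.
  exact: mdot sw.1 measurable_fst.
move=> p; apply: le_trans (bond_force_dot_le u p (w p.1)) _.
by rewrite ler_wpM2l// lerD//; apply: half_le; left.
Qed.

Let integrable_L2 u w : sqint u -> sqint w -> leb2.-integrable setT (EFin \o L2 u w).
Proof.
move=> su sw; apply: integrable_dominated (integrable_dom2 su sw).
  apply: measurable_funM; first exact: measurable_bond_force su.1.
  exact: mdot sw.1 measurable_snd.
move=> p; apply: le_trans (bond_force_dot_le u p (w p.2)) _.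
by rewrite ler_wpM2l// lerD//; apply: half_le; right.
Qed.

(* Exchanging the two points of a bond turns L2 into - L1. *)
Let integral_L2 u w : sqint u -> sqint w ->
  \int[leb2]_p L2 u w p = - (\int[leb2]_p L1 u w p).
Proof.
move=> su sw; have i1 := integrable_L1 su sw; have i2 := integrable_L2 su sw.
have i1n : leb2.-integrable setT (EFin \o (fun p => - 1 * L1 u w p)).
  by apply: eq_integrable (integrableZl measurableT (- 1) i1) => // p _; rewrite /= EFinM.
rewrite -mulN1r -RintegralZl// /Rintegral.
rewrite -(integral12_prod_meas1 i2) -(integral21_prod_meas1 i1n); congr fine.
apply: eq_integral => x _; apply: eq_integral => y _ /=; congr EFin.
by rewrite /L1 /L2 /= bond_forceC -(opprB x y) dotvNr mulN1r mulrN.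
Qed.

(** The integral of the bond forces at x is the gradient up to the factor -2c, which collects 2/V_d,
    1/eps and the sign. On bonds outside the ball both integrands vanish. *)
Let integral_line u w x : measurable_fun setT u ->
  ((- 2 * c)%:E * \int[leb]_y (L1 u w (x, y))%:E = (dotv (gradPD f J eps u x) (w x))%:E)%E.
Proof.
move=> mu; pose G i y := bond_force u (x, y) * (y - x) ord0 i.
have iG i : leb.-integrable setT (EFin \o G i).
  have ik : leb.-integrable setT (EFin \o (fun y : V => M * (f0' * eps + finf) * inv_kernel eps (y - x))).
    have mk := measurable_inv_kernel (n := n) eps.
    have mke : measurable_fun setT (EFin \o (inv_kernel (n := n) eps)) by exact/measurable_EFinP.
    have mk0 y : (0 <= (EFin \o (inv_kernel (n := n) eps)) y)%E by rewrite lee_fin inv_kernel_ge0.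
    have ik0 : leb.-integrable setT (EFin \o (inv_kernel (n := n) eps)).
      apply/integrableP; split => //; under eq_integral do rewrite gee0_abs//.
      by rewrite -(inv_kernel_massE n1 e0) ltry.
    have := integrableZl measurableT (M * (f0' * eps + finf)) (integrable_shift (- x) ik0).
    by apply: eq_integrable => // y _; rewrite /= -EFinM.
  apply: le_integrable ik => //.
    apply/measurable_EFinP; apply: measurable_funM.
      exact: measurableT_comp (measurable_bond_force mu) (measurable_pair1 x).
    apply: measurableT_comp (measurable_rV_coord i) _; exact: measurable_rVB.
  by move=> y _; rewrite /= lee_fin (le_trans (bond_force_coord_le u (x, y) i))// ler_norm.
have -> : (\int[leb]_y (L1 u w (x, y))%:E = (\sum_i (w x ord0 i * \int[leb]_y G i y))%:E)%E.
  have iwG i : leb.-integrable setT (EFin \o (fun y => w x ord0 i * G i y)).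
    by apply: eq_integrable (integrableZl measurableT (w x ord0 i) (iG i)) => // y _; rewrite /= EFinM.
  transitivity (\int[leb]_y (\sum_i w x ord0 i * G i y))%:E.
    have sumE : (fun y => (L1 u w (x, y))%:E) = (fun y => (\sum_i w x ord0 i * G i y)%:E).
      apply/funext => y; congr EFin; rewrite /L1 /G /= /dotv mulr_sumr.
      by apply: eq_bigr => i _; ring.
    rewrite sumE /Rintegral fineK//; apply: integrable_fin_num => //.
    rewrite (_ : (fun y => _) = (fun y => \sum_i (w x ord0 i * G i y)%:E)); last first.
      by apply/funext => y; rewrite sumEFin.
    by apply: integrable_sum => // i _; exact: iwG.
  rewrite Rintegral_sum//; congr EFin; apply: eq_bigr => i _.
  by rewrite RintegralZl//; exact: iG.
rewrite -EFinM; congr EFin; rewrite /gradPD /dotv mulr_sumr; apply: eq_bigr => i _.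
rewrite !mxE.
have -> : \int[leb]_(y in eball x eps)
      (derive1 (fun S => energy_density f J eps S (y - x)) (strain u y x) *
       ((enorm (y - x))^-1 *: (y - x)) ord0 i) = eps^-1 * \int[leb]_y G i y.
  rewrite -RintegralZl// /Rintegral integral_mkcond; congr fine; apply: eq_integral => y _.
  rewrite epatch_indic/= -EFinM; congr EFin; rewrite is_derive_energy_density mxE.
  rewrite /G /bond_force /= /bond_weight indicE.
  have [ye|ye] := ltP (enorm (y - x)) eps; last first.
    rewrite memNset; last by rewrite /eball/=; apply/negP; rewrite -leNgt.
    by have := bond_weight_out ye; rewrite /bond_weight => ->; rewrite !(mul0r, mulr0).
  have -> : (y \in eball x eps) = true by exact: mem_set.
  by rewrite mulr1 -[(enorm (y - x) ^+ 2)^-1]exprVn; ring.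
rewrite /c; field.
by rewrite gt_eqF ?e0// !gt_eqF ?exprn_gt0 ?ball_volume_gt0.
Qed.

(** The gradient enters only through its product with w, so a square-integrable g with the same
    products may stand for it; along the evolution the equation of motion provides one. The linear
    part of the tangent inequality is the integral of [L2] - [L1], which by symmetry is -2 times
    that of [L1], that is, the pairing with g. *)
Lemma PD_tangent u w g : sqint u -> sqint w -> sqint g ->
  {ae leb, forall x, dotv (gradPD f J eps u x) (w x) = dotv (g x) (w x)} ->
  PD (fun x => u x + w x) <= PD u + ip g w + f0' * PD_bound * sqn w.
Proof.
move=> su sw sg gE.
have i1 := integrable_L1 su sw; have i2 := integrable_L2 su sw.
have ie := integrable_bond_energy su; have iq := integrable_bond_quadratic sw.
have ipE : ip g w = - 2 * c * \int[leb2]_p L1 u w p.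
  rewrite /ip {1}/Rintegral.
  transitivity (fine (\int[leb]_x ((- 2 * c)%:E * \int[leb]_y (L1 u w (x, y))%:E))%E).
    congr fine; apply: ae_eq_integral => //.
    - by apply/measurable_EFinP; apply: measurable_dotv; [exact: sg.1|exact: sw.1].
    - by apply: measurable_funeM; exact: (measurable_fubini_F i1).
    - by apply: filterS gE => x gx _; rewrite integral_line ?gx//; exact: su.1.
  have iF := integrable_fubini_F i1.
  have -> : (\int[leb]_x ((- 2 * c)%:E * \int[leb]_y (L1 u w (x, y))%:E) =
      (- 2 * c)%:E * \int[leb2]_p (L1 u w p)%:E)%E.
    by rewrite -(integral12_prod_meas1 i1) -(integralZl measurableT iF).
  by rewrite fineM//; exact: integrable_fin_num i1.
have iqq : leb2.-integrable setT (EFin \o (fun p => f0' * bond_quadratic w p)).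
  by apply: eq_integrable (integrableZl measurableT f0' iq) => // p _; rewrite /= EFinM.
have i3 : leb2.-integrable setT (EFin \o (fun p => L2 u w p - L1 u w p)).
  by apply: eq_integrable (integrableB measurableT i2 i1) => // p _.
have i4 : leb2.-integrable setT (EFin \o (fun p => bond_energy u p + (L2 u w p - L1 u w p))).
  by apply: eq_integrable (integrableD measurableT ie i3) => // p _.
have i5 : leb2.-integrable setT (EFin \o (fun p => bond_energy u p + (L2 u w p - L1 u w p)
    + f0' * bond_quadratic w p)).
  by apply: eq_integrable (integrableD measurableT i4 iqq) => // p _.
have key : \int[leb2]_p bond_energy (fun x => u x + w x) p <=
    (\int[leb2]_p bond_energy u p) - 2 * (\int[leb2]_p L1 u w p)
     + f0' * (\int[leb2]_p bond_quadratic w p).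
  have -> : (\int[leb2]_p bond_energy u p) - 2 * (\int[leb2]_p L1 u w p) =
      (\int[leb2]_p bond_energy u p) + ((\int[leb2]_p L2 u w p) - \int[leb2]_p L1 u w p).
    by rewrite integral_L2//; ring.
  rewrite -RintegralB// -RintegralD// -RintegralZl// -RintegralD//.
  apply: le_Rintegral => //; first exact: integrable_bond_energy (sqintD su sw).
  move=> p _; rewrite /bond_energy /bond_quadratic /L1 /L2 /bond_force /= bond_strainD.
  rewrite -mulrBr -dotvBl.
  have hE := strainE w p.1 p.2; move: hE.
  set b := bond_weight _; set h := enorm _; set S := strain u _ _; set S' := strain w _ _ => hE.
  have h0 : 0 <= h by exact: enorm_ge0.
  have -> : b * (2 * h * S * f' (h * S ^+ 2)) / h ^+ 2 * dotv (w p.2 - w p.1) (p.2 - p.1) =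
     b * (2 * h * S * f' (h * S ^+ 2) * S').
    by rewrite hE; ring.
  rewrite [leRHS](_ : _ = b * (f (h * S ^+ 2) + 2 * h * S * f' (h * S ^+ 2) * S'
     + f0' * (h * S' ^+ 2))); last by ring.
  rewrite ler_wpM2l ?bond_weight_ge0//.
  have r0 : 0 <= h * S ^+ 2 by rewrite mulr_ge0 ?sqr_ge0.
  have r1 : 0 <= h * (S + S') ^+ 2 by rewrite mulr_ge0 ?sqr_ge0.
  apply: le_trans (potential_tangent hf hf' r0 r1) _.
  have /andP[F0 Fle] := f'_le r0.
  (* The cross term is the force term; the square is left as remainder, with f' <= f'(0). *)
  rewrite (_ : h * (S + S') ^+ 2 - h * S ^+ 2 = 2 * h * S * S' + h * S' ^+ 2); last by ring.
  rewrite mulrDr addrA (_ : f' _ * (2 * h * S * S') = 2 * h * S * f' (h * S ^+ 2) * S'); last by ring.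
  by rewrite lerD2l ler_wpM2r// mulr_ge0 ?sqr_ge0.
have := bond_quadratic_integral_le sw; move: key; rewrite ipE /PD -/c.
move: (\int[_]_p _) (\int[_]_p _) (\int[_]_p _) (\int[_]_p _) => A B C E h1 h2.
have := ler_wpM2l (ltW c0) h1; have := ler_wpM2l f00 h2; lra.
Qed.

End peridynamic_energy.

(** * Energy bound for the evolution *)

(** The supremum of the t such that P holds throughout [0, t] satisfies P by left closedness, and
    can be passed unless it is T. *)
Lemma real_induction (R : realType) (T : R) (P : R -> Prop) : 0 <= T -> P 0 ->
  (forall t, 0 <= t -> t < T -> P t ->
     exists2 d : R, 0 < d & forall s, t < s -> s < t + d -> s <= T -> P s) ->
  (forall t, 0 < t -> t <= T -> (forall s, 0 <= s -> s < t -> P s) -> P t) ->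
  forall t, 0 <= t <= T -> P t.
Proof.
move=> T0 P0 right left.
pose S := [set t : R | 0 <= t <= T /\ forall s, 0 <= s <= t -> P s].
have S0 : S 0.
  split; first by rewrite lexx.
  by move=> s; rewrite -eq_le => /eqP <-.
have hS : has_sup S by split; [exists 0|exists T => t [/andP[]]].
have c0 : 0 <= sup S by apply: ub_le_sup => //; exact: hS.2.
have cT : sup S <= T by apply: ge_sup; [exact: hS.1|move=> t [/andP[]]].
have Plt s : 0 <= s -> s < sup S -> P s.
  move=> s0 sc; have d0 : 0 < sup S - s by rewrite subr_gt0.
  have [t [_ Pt] ts] := sup_adherent d0 hS; apply: Pt; rewrite s0/=; lra.
have Pc : P (sup S).
  move: c0; rewrite le_eqVlt => /predU1P[<-//|c0].
  exact: left.
have Sc s : 0 <= s -> s <= sup S -> P s.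
  by move=> s0; rewrite le_eqVlt => /predU1P[->//|]; exact: Plt.
have [Tc|cltT] := leP T (sup S).
  by move=> t /andP[t0 tT]; apply: Sc => //; exact: le_trans Tc.
have [d d0 hd] := right _ c0 cltT Pc.
pose t := Num.min T (sup S + d / 2).
have tc : sup S < t by rewrite lt_min cltT ltrDl divr_gt0.
have tT : t <= T by rewrite ge_min lexx.
have td : t < sup S + d.
  by rewrite gt_min ltrD2l; apply/orP; right; lra.
have : S t.
  split; first by rewrite tT andbT (le_trans c0)// ltW.
  move=> s /andP[s0 st]; have [sc|sc] := leP s (sup S); first exact: Sc.
  by apply: hd => //; [exact: le_lt_trans td|exact: le_trans tT].
by move=> /(ub_le_sup hS.2); rewrite leNgt tc.
Qed.

(** * Energy of the initial displacement *)

Section initial_energy.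
Context {R : realType} {n : nat}.
Local Notation V := 'rV[R]_n.
Local Notation leb := (lebesgueD n).
Local Notation leb2 := (lebesgueD n \x lebesgueD n)%E.
Variables (f : R -> R) (f0' finf rbar : R) (J : R -> R) (eps M a C : R).
Hypotheses (hf : cohesive_potential f f0' finf rbar) (hJ : influence_function J)
  (e0 : 0 < eps) (n1 : (1 < n)%N) (JM : forall r, 0 <= r -> J r <= M)
  (ea : 2 * eps < a) (C0 : 0 <= C).

(** With y = x + xi and Tonelli's theorem, the energy becomes an integral over xi of energies of
    increments. Each slice is at most M C eps for |xi| < eps, and the volume of that ball cancels
    the rest of the normalization. *)
Lemma PD_increment_le (u : V -> V) : sqint u ->
  (forall xi : V, xi != 0 -> enorm xi < a / 2 ->
    (\int[leb]_x (f (dotv (u (x + xi) - u x) xi ^+ 2 / enorm xi ^+ 3))%:E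
      <= (C * enorm xi)%:E)%E) ->
  PD f J eps u <= M * C.
Proof.
move=> su hC; have M0 : 0 <= M by exact: le_trans (influence_ge0 hJ (lexx 0)) (JM (lexx 0)).
have vol := @ball_volume_gt0 R n.
have be0 := bond_energy_ge0 hf hJ e0.
have mbe := measurable_bond_energy hf hJ e0 su.1.
have mbeE : measurable_fun setT (EFin \o bond_energy f J eps u) by exact/measurable_EFinP.
pose F (p : V * V) : \bar R := (bond_energy f J eps u (p.2, p.2 + p.1))%:E.
have mF : measurable_fun setT F.
  apply: (measurableT_comp mbeE); apply: measurable_fun_pair; first exact: measurable_snd.
  by apply: measurable_rVD; [exact: measurable_snd|exact: measurable_fst].
have F0 p : (0 <= F p)%E by rewrite lee_fin.
have swap : (\int[leb2]_p (bond_energy f J eps u p)%:E = \int[leb]_xi \int[leb]_x F (xi, x))%E.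
  have be0E (p : V * V) : (0 <= (EFin \o bond_energy f J eps u) p)%E by rewrite lee_fin.
  rewrite [LHS](@fubini_tonelli1 _ _ V V R leb leb _ mbeE be0E).
  have FT := @fubini_tonelli _ _ V V R leb leb F mF F0.
  etransitivity; last exact: (esym FT).
  apply: eq_integral => x _; rewrite /fubini_F.
  have mx : measurable_fun setT (fun y : V => (bond_energy f J eps u (x, y))%:E).
    exact: measurableT_comp mbeE (measurable_pair1 x).
  have mx0 (y : V) : (0 <= (bond_energy f J eps u (x, y))%:E)%E by rewrite lee_fin.
  rewrite -[LHS](ge0_integral_shift x mx mx0); apply: eq_integral => y _.
  by rewrite /F/= addrC.
have bd xi : (\int[leb]_x F (xi, x) <= (M * (C * eps))%:E * (\1_(eball 0 eps) xi)%:E)%E.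
  have [xie|xie] := ltP (enorm xi) eps; last first.
    rewrite integral0_eq ?mule_ge0 ?lee_fin ?indicE ?mulr_ge0 ?(ltW e0)// => x _.
    by rewrite /F /bond_energy /= addrAC subrr add0r (bond_weight_out hJ e0)// mul0r.
  rewrite indicE mem_set ?mule1; last by rewrite /eball/= subr0.
  have [->|xi0] := eqVneq xi 0.
    rewrite integral0_eq ?lee_fin ?mulr_ge0 ?(ltW e0)// => x _.
    by rewrite /F /bond_energy /= addr0 subrr enorm0 mul0r (potential0 hf) mulr0.
  have h0 : 0 < enorm xi by rewrite enorm_gt0.
  have bw0 := bond_weight_ge0 hJ e0 xi.
  pose g x := f (dotv (u (x + xi) - u x) xi ^+ 2 / enorm xi ^+ 3).
  have FE x : F (xi, x) = ((bond_weight J eps xi)%:E * (g x)%:E)%E.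
    rewrite /F /bond_energy /= addrAC subrr add0r -EFinM strainE addrAC subrr add0r; congr (_ * f _)%:E.
    by field; rewrite gt_eqF.
  under eq_integral do rewrite FE.
  have mg : measurable_fun setT g.
    apply: (measurable_potential hf) => [|x]; last by rewrite divr_ge0 ?sqr_ge0 ?exprn_ge0// ltW.
    apply: measurable_funM => //; apply: measurable_funX; apply: measurable_dotv => //.
    by apply: measurable_rVB; [exact: measurable_fun_shift su.1|exact: su.1].
  rewrite ge0_integralZl//; last 2 first.
  - exact/measurable_EFinP.
  - by move=> x _; rewrite lee_fin (potential_ge0 hf)// divr_ge0 ?sqr_ge0 ?exprn_ge0// ltW.
  have bwM := bond_weight_le e0 JM xi.
  apply: (@le_trans _ _ ((bond_weight J eps xi)%:E * (C * enorm xi)%:E)%E).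
    apply: lee_wpmul2l; first by rewrite lee_fin.
    apply: hC => //; rewrite ltr_pdivlMr// mulrC; apply: le_lt_trans ea.
    by rewrite ler_pM2l// ltW.
  rewrite -EFinM lee_fin; apply: ler_pM => //; first by rewrite mulr_ge0 ?(ltW h0).
  by rewrite ler_wpM2l// ltW.
have c0 : 0 < eps ^+ n * ball_volume R n * eps by rewrite !mulr_gt0 ?exprn_gt0.
rewrite /PD ler_pdivrMl// -lee_fin /Rintegral fineK; last first.
  exact: integrable_fin_num (integrable_bond_energy hf hJ e0 n1 JM su).
rewrite swap; apply: (@le_trans _ _ (\int[leb]_xi ((M * (C * eps))%:E * (\1_(eball 0 eps) xi)%:E))%E).
  apply: ge0_le_integral => //.
  - by move=> xi _; exact: integral_ge0.
  - exact: (@measurable_fun_fubini_tonelli_F _ _ V V R leb F mF F0).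
  - apply: measurable_funeM; apply/measurable_EFinP; apply: measurable_indic; exact: measurable_eball.
rewrite ge0_integralZl//; last 2 first.
- by apply/measurable_EFinP; apply: measurable_indic; exact: measurable_eball.
- by rewrite lee_fin !mulr_ge0// ltW.
rewrite integral_indic//; last exact: measurable_eball.
by rewrite setIT [X in (_ * X)%E](lebesgueD_eball (0 : V) e0) -EFinM lee_fin le_eqVlt; apply/orP; left; apply/eqP; ring.
Qed.

End initial_energy.

(* Otherwise unification unfolds these down to the integrals. *)
Opaque sqn ip PD sqint.

Lemma sqnD_le2 (R : realType) n (v r : 'rV[R]_n -> 'rV[R]_n) : sqint v -> sqint r ->
  sqn r < 1 -> sqn (fun x => v x + r x) <= 2 * sqn v + 2.
Proof. by move=> sv sr r1; have := sqnD_le sv sr (@ltr01 R); rewrite invr1; lra. Qed.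

(** * Differentiable paths in L^2 *)

Section L2_paths.
Context {R : realType} {n : nat}.
Local Notation V := 'rV[R]_n.
Local Notation leb := (lebesgueD n).
Variable T : R.
Implicit Types w : R -> V -> V.

Lemma L20_sqint (D : set V) (a : R) (v : V -> V) : L20 D a v -> sqint v.
Proof. by move=> [mv voo _]; exact: L2norm_sqint. Qed.

Definition remainder w w' (t s : R) (x : V) : V := (s - t)^-1 *: (w s x - w t x) - w' t x.

Lemma sqint_remainder w w' t s : sqint (w s) -> sqint (w t) -> sqint (w' t) ->
  sqint (remainder w w' t s).
Proof. by move=> h1 h2 h3; apply: sqintB => //; apply: sqintZ; exact: sqintB. Qed.

Lemma L2_derivative_near w w' : L2_derivative T w w' ->
  (forall t, 0 <= t <= T -> sqint (w t)) -> (forall t, 0 <= t <= T -> sqint (w' t)) ->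
  forall t, 0 <= t <= T -> forall d : R, 0 < d -> exists2 e : R, 0 < e &
    forall s, 0 <= s <= T -> s != t -> `|s - t| < e -> sqn (remainder w w' t s) < d.
Proof.
move=> dw sw sw' t tT d d0.
(* The norm is made smaller than the minimum of 1 and d, whose square is at most d. *)
have m0 : 0 < Num.min 1 d by rewrite lt_min ltr01.
have /within_dnbhsP[e e0 he] := cvge0_near (dw t tT) m0.
exists e => // s sT st se.
have sr := sqint_remainder (sw _ sT) (sw _ tT) (sw' _ tT).
apply: lt_le_trans (L2norm_sqn sr m0 _) _.
  by apply: he => //=; rewrite in_itv.
by rewrite expr2 (le_trans (ler_piMl (ltW m0) _))// ge_min lexx ?orbT.
Qed.

Lemma increment_remainder w w' t s : s != t ->
  (fun x => w s x - w t x) = (fun x => (s - t) *: (w' t x + remainder w w' t s x)).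
Proof.
move=> st; apply/funext => x; rewrite /remainder subrKC scalerA mulfV ?scale1r//.
by rewrite subr_eq0.
Qed.

Lemma L2_derivative_continuous w w' : L2_derivative T w w' ->
  (forall t, 0 <= t <= T -> sqint (w t)) -> (forall t, 0 <= t <= T -> sqint (w' t)) ->
  forall t, 0 <= t <= T -> forall d : R, 0 < d -> exists2 e : R, 0 < e &
    forall s, 0 <= s <= T -> s != t -> `|s - t| < e -> sqn (fun x => w s x - w t x) < d.
Proof.
move=> dw sw sw' t tT d d0; have [e e0 he] := L2_derivative_near dw sw sw' tT (@ltr01 R).
pose K := 2 * sqn (w' t) + 2; have K0 : 0 < K by have := sqn_ge0 (w' t); rewrite /K; lra.
have m0 : 0 < Num.min 1 (d / K) by rewrite lt_min ltr01 divr_gt0.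
exists (Num.min e (Num.min 1 (d / K))); first by rewrite lt_min e0.
move=> s sT st; rewrite !lt_min => /and3P[se s1 sd].
have sr := sqint_remainder (sw _ sT) (sw _ tT) (sw' _ tT).
rewrite (increment_remainder w w' st) sqnZ; last exact: sqintD (sw' _ tT) sr.
have h : sqn (fun x => w' t x + remainder w w' t s x) <= K.
  exact: (sqnD_le2 (sw' _ tT) sr (he s sT st se)).
rewrite -real_normK ?num_real//.
apply: (@le_lt_trans _ _ (`|s - t| * K)); last by rewrite -ltr_pdivlMr.
apply: ler_pM; [exact: exprn_ge0|exact: sqn_ge0| |exact: h].
by rewrite expr2 ler_piMl// ltW.
Qed.

(** Continuity bounds the path near each time; real induction on the existence of a bound over
    [0, t] replaces compactness of [0, T]. *)
Lemma L2_path_bounded w w' : 0 <= T -> L2_derivative T w w' ->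
  (forall t, 0 <= t <= T -> sqint (w t)) -> (forall t, 0 <= t <= T -> sqint (w' t)) ->
  exists B : R, forall t, 0 <= t <= T -> sqn (w t) <= B.
Proof.
move=> T0 dw sw sw'; have near t : 0 <= t <= T -> exists2 e : R, 0 < e &
    forall s, 0 <= s <= T -> `|s - t| < e -> sqn (w s) <= 2 * sqn (w t) + 2.
  move=> tT; have [e e0 he] := L2_derivative_continuous dw sw sw' tT (@ltr01 R).
  exists e => // s sT se; have [->|st] := eqVneq s t; first by have := sqn_ge0 (w t); lra.
  have -> : w s = (fun x => w t x + (w s x - w t x)) by apply/funext => x; rewrite subrKC.
  exact: (sqnD_le2 (sw _ tT) (sqintB (sw _ sT) (sw _ tT)) (he s sT st se)).
suff : forall t, 0 <= t <= T -> exists B : R, forall s, 0 <= s <= t -> sqn (w s) <= B.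
  by move=> /(_ T); rewrite lexx T0; apply.
apply: real_induction => //.
- by exists (sqn (w 0)) => s; rewrite -eq_le => /eqP <-.
- move=> t t0 tT [B hB]; have tT' : 0 <= t <= T by rewrite t0 ltW.
  have [e e0 he] := near t tT'; exists e => // s ts se sT.
  exists (Num.max B (2 * sqn (w t) + 2)) => r /andP[r0 rs]; rewrite le_max.
  have [rt|rt] := leP r t; first by rewrite hB ?r0.
  by rewrite he ?orbT ?r0//=; [lra|rewrite gtr0_norm; lra].
- move=> t t0 tT hlt; have tT' : 0 <= t <= T by rewrite tT ltW.
  have [e e0 he] := near t tT'; pose s := Num.max 0 (t - e / 2).
  have s0 : 0 <= s by rewrite le_max lexx.
  have st : s < t by rewrite gt_max t0; lra.
  have se : t - e / 2 <= s by rewrite le_max lexx orbT.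
  have [B hB] := hlt s s0 st; exists (Num.max B (2 * sqn (w t) + 2)) => r /andP[r0 rt]; rewrite le_max.
  have [rs|rs] := leP r s; first by rewrite hB ?r0.
  by rewrite he ?orbT ?r0//=; [lra|rewrite ler0_norm; lra].
Qed.

End L2_paths.

Lemma step_absorb (R : realType) (s Q : R) : 0 <= Q -> 0 < s -> s < 2^-1 / (Q + 1) ->
  s * Q <= 2^-1.
Proof.
move=> Q0 s0; rewrite ltr_pdivlMr ?ltr_wpDl// mulrDr mulr1 => h; lra.
Qed.

(** The arithmetic of one time step of length s. Here i1, i2, i3, i4 are the pairings of g with the
    first remainder, of the velocity with the second remainder, of the velocity with the
    acceleration, and of the body force with the velocity. The i3 terms of kinetic and potential
    energy cancel. *)
Lemma step_growth (R : realType) (rho K B s q qq qb w z i1 i2 i3 i4 P P' : R) : 0 < s ->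
  K * w <= K * (s ^+ 2 * (2 * q + 2)) ->
  rho / 2 * z <= rho / 2 * (s ^+ 2 * (2 * qq + 2)) ->
  s * (K * (2 * q + 2) + rho / 2 * (2 * qq + 2)) <= 2^-1 ->
  2 * i4 <= qb + q -> i1 <= 4^-1 -> rho * i2 <= 4^-1 -> qb <= B ->
  P' <= P + s * (i4 - rho * i3 + i1) + K * w ->
  rho / 2 * (q + 2 * (s * (i3 + i2)) + z) + P' <=
  rho / 2 * q + P + s * (B / 2 + q / 2 + 1).
Proof.
move=> s0 KW RZ Qs y g1 g2 Bt tang.
have h1 : s * (i4 + i1 + rho * i2) <= s * (B / 2 + q / 2 + 2^-1) by rewrite ler_pM2l//; lra.
have h2 : s * (s * (K * (2 * q + 2) + rho / 2 * (2 * qq + 2))) <= s * 2^-1 by rewrite ler_pM2l.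
lra.
Qed.

(** * Growth of the total energy *)

Section evolution.
Context {R : realType} {n : nat}.
Local Notation V := 'rV[R]_n.
Local Notation leb := (lebesgueD n).
Variables (f f' : R -> R) (f0' finf rbar : R) (J : R -> R) (eps M a rho T : R) (D : set V).
Hypotheses (hf : cohesive_potential f f0' finf rbar) (hJ : influence_function J)
  (e0 : 0 < eps) (n1 : (1 < n)%N) (JM : forall r, 0 <= r -> J r <= M)
  (hf' : forall r : R, 0 <= r ->
    (s - r)^-1 * (f s - f r) @[s --> within `[0, +oo[ (r^')] --> f' r)
  (rho0 : 0 < rho) (T0 : 0 < T).
Variables (u ut utt b : R -> V -> V) (B : R).
Hypotheses (su : forall t, 0 <= t <= T -> [/\ L20 D a (u t), L20 D a (ut t) & L20 D a (utt t)])
  (du : L2_derivative T u ut) (dut : L2_derivative T ut utt)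
  (motion : forall t, 0 <= t <= T -> {ae leb, forall x, interior_part D a x ->
     rho *: utt t x = - gradPD f J eps (u t) x + b t x})
  (sb : forall t, 0 <= t <= T -> sqint (b t)) (bB : forall t, 0 <= t <= T -> sqn (b t) <= B).

Definition total_energy t : R := rho / 2 * sqn (ut t) + PD f J eps (u t).

Let su0 t : 0 <= t <= T -> sqint (u t).
Proof. by move=> /su[h _ _]; exact: L20_sqint h. Qed.

Let sut t : 0 <= t <= T -> sqint (ut t).
Proof. by move=> /su[_ h _]; exact: L20_sqint h. Qed.

Let sutt t : 0 <= t <= T -> sqint (utt t).
Proof. by move=> /su[_ _ h]; exact: L20_sqint h. Qed.

Let K : R := f0' * PD_bound (n := n) eps M.

Let K0 : 0 <= K.
Proof.
have M0 : 0 <= M by exact: le_trans (influence_ge0 hJ (lexx 0)) (JM (lexx 0)).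
rewrite mulr_ge0 ?(ltW (potential_slope_gt0 hf))// /PD_bound mulr_ge0//.
  by rewrite invr_ge0 !mulr_ge0 ?exprn_ge0 ?(ltW e0)// ltW// ball_volume_gt0.
apply: mulr_ge0; first exact: mulr_ge0.
apply: mulr_ge0 => //; apply: fine_ge0; apply: integral_ge0 => z _.
by rewrite lee_fin inv_kernel_ge0.
Qed.

Lemma total_energy_ge t : sqn (ut t) <= 2 / rho * total_energy t /\ 0 <= total_energy t.
Proof.
have P0 := PD_ge0 hf hJ e0 (u t); have q0 := sqn_ge0 (ut t).
rewrite /total_energy mulrDr mulrA (_ : 2 / rho * (rho / 2) = 1); last by field; rewrite gt_eqF.
by rewrite mul1r lerDl mulr_ge0 ?divr_ge0 ?(ltW rho0)// addr_ge0// mulr_ge0// divr_ge0// ltW.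
Qed.

(** The work of the body force is at most B/2 + sqn (ut t)/2 by Young's inequality. The summand 1 is
    slack: 1/4 for each of the two difference-quotient remainders and 1/2 for the quadratic terms.
    The step d may depend on t and eps, the rate does not mention eps. *)
Lemma energy_right_growth t : 0 <= t -> t < T -> exists2 d : R, 0 < d &
  forall s, t < s -> s < t + d -> s <= T ->
    total_energy s <= total_energy t + (s - t) * (B / 2 + sqn (ut t) / 2 + 1).
Proof.
move=> t0 tT; have tT' : 0 <= t <= T by rewrite t0 ltW.
have s1 := su0 tT'; have s2 := sut tT'; have s3 := sutt tT'; have s4 := sb tT'.
(* The gradient according to the equation of motion, valid on the interior part; elsewhere the
   increment w vanishes almost everywhere. *)
pose g x := b t x - rho *: utt t x; have sg : sqint g by exact: sqintB s4 (sqintZ rho s3).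
have q4 : 0 < 4^-1 :> R by rewrite invr_gt0.
have [d1 d10 hd1] := ip_small sg q4.
have r4 : 0 < 4^-1 / rho by rewrite divr_gt0.
have [d2 d20 hd2] := ip_small s2 r4.
have m1 : 0 < Num.min 1 d1 by rewrite lt_min ltr01.
have m2 : 0 < Num.min 1 d2 by rewrite lt_min ltr01.
have [a1 a10 ha1] := L2_derivative_near du su0 sut tT' m1.
have [a2 a20 ha2] := L2_derivative_near dut sut sutt tT' m2.
(* Coefficient of (s - t)^2 from both quadratic terms; a step below 1/(2 (Q + 1)) keeps their sum
   under (s - t)/2. *)
pose Q := K * (2 * sqn (ut t) + 2) + rho / 2 * (2 * sqn (utt t) + 2).
have Q0 : 0 <= Q.
  have h v : 0 <= 2 * sqn v + 2 :> R by rewrite addr_ge0// mulr_ge0// sqn_ge0.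
  by apply: addr_ge0; apply: mulr_ge0 => //; rewrite divr_ge0// ltW.
have a30 : 0 < 2^-1 / (Q + 1) by rewrite divr_gt0// ltr_wpDl.
exists (Num.min a1 (Num.min a2 (2^-1 / (Q + 1)))); first by rewrite !lt_min a10 a20.
move=> s ts sd sT; have sT' : 0 <= s <= T by rewrite sT andbT (le_trans t0)// ltW.
have st : s != t by rewrite gt_eqF.
have sg0 : 0 < s - t by rewrite subr_gt0.
have : s - t < Num.min a1 (Num.min a2 (2^-1 / (Q + 1))) by rewrite ltrBlDl.
rewrite !lt_min => /and3P[sa1 sa2 sa3].
pose r1 := remainder u ut t s; pose r2 := remainder ut utt t s.
have sr1 : sqint r1 by exact: sqint_remainder (su0 sT') s1 s2.
have sr2 : sqint r2 by exact: sqint_remainder (sut sT') s2 s3.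
have /andP[q1 q1'] : (sqn r1 < 1) && (sqn r1 < d1).
  by rewrite -lt_min; apply: (ha1 _ sT' st); rewrite gtr0_norm.
have /andP[q2 q2'] : (sqn r2 < 1) && (sqn r2 < d2).
  by rewrite -lt_min; apply: (ha2 _ sT' st); rewrite gtr0_norm.
pose w x := u s x - u t x; pose z x := ut s x - ut t x.
have wE : w = (fun x => (s - t) *: (ut t x + r1 x)) by exact: increment_remainder.
have zE : z = (fun x => (s - t) *: (utt t x + r2 x)) by exact: increment_remainder.
have sw : sqint w by exact: sqintB (su0 sT') s1.
have sz : sqint z by exact: sqintB (sut sT') s2.
have gE : {ae leb, forall x, dotv (gradPD f J eps (u t) x) (w x) = dotv (g x) (w x)}.
  have [[_ _ ut0] _ _] := su tT'; have [[_ _ us0] _ _] := su sT'.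
  have := motion tT'; move: ut0 us0; apply: filterS3 => x ux vx mx.
  have [xI|xI] := pselect (interior_part D a x).
    by rewrite /g (mx xI) opprD opprK addrCA subrr addr0.
  by rewrite /w ux// vx// subrr !dotv0r.
have tang := PD_tangent hf hJ e0 n1 JM hf' s1 sw sg gE.
have usE : u s = (fun x => u t x + w x) by apply/funext => x; rewrite /w subrKC.
have utsE : ut s = (fun x => ut t x + z x) by apply/funext => x; rewrite /z subrKC.
rewrite /total_energy {1}usE {1}utsE (sqnD s2 sz).
have sA : sqint (fun x => ut t x + r1 x) by exact: sqintD.
have sB : sqint (fun x => utt t x + r2 x) by exact: sqintD.
have iw : ip g w = (s - t) * (ip g (ut t) + ip g r1) by rewrite wE (ipZr _ sg sA) (ipDr sg s2 sr1).
have iz : ip (ut t) z = (s - t) * (ip (ut t) (utt t) + ip (ut t) r2) by rewrite zE (ipZr _ s2 sB) (ipDr s2 s3 sr2).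
have gut : ip g (ut t) = ip (b t) (ut t) - rho * ip (ut t) (utt t).
  have -> : g = (fun x => b t x + (- rho) *: utt t x) by apply/funext => x; rewrite scaleNr.
  have s3' := sqintZ (- rho) s3.
  by rewrite (ipDl s4 s3' s2) [X in _ + X]ipC (ipZr _ s2 s3) mulNr.
have nw : sqn w <= (s - t) ^+ 2 * (2 * sqn (ut t) + 2).
  rewrite wE (sqnZ _ sA); apply: ler_wpM2l; first exact: sqr_ge0.
  exact: (sqnD_le2 s2 sr1 q1).
have nz : sqn z <= (s - t) ^+ 2 * (2 * sqn (utt t) + 2).
  rewrite zE (sqnZ _ sB); apply: ler_wpM2l; first exact: sqr_ge0.
  exact: (sqnD_le2 s3 sr2 q2).
have y := ip_young s4 s2 (@ltr01 R); rewrite invr1 !mul1r in y.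
have g1 := hd1 r1 sr1 q1'.
have g2 : rho * ip (ut t) r2 <= 4^-1 by rewrite -ler_pdivlMl// mulrC; exact: hd2.
have KW := ler_wpM2l K0 nw.
have rz : 0 <= rho / 2 by rewrite divr_ge0// ltW.
have RZ := ler_wpM2l rz nz.
have Bt := bB tT'.
have Qs := step_absorb Q0 sg0 sa3.
move: tang; rewrite iw iz gut -/K => tang.
exact: (step_growth sg0 KW RZ Qs y g1 g2 Bt tang).
Qed.

(** Quasi-subadditivity bounds the energy at t by (1 + tau) times the energy at an earlier s, plus a
    multiple of the squared L^2 distances, which tend to 0 as s approaches t. *)
Lemma energy_left_closed t (m : R) : 0 < t -> t <= T ->
  (forall s, 0 <= s -> s < t -> total_energy s <= m) -> total_energy t <= m.
Proof.
move=> t0 tT hm; have tT' : 0 <= t <= T by rewrite tT ltW.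
have m0 : 0 <= m by apply: le_trans (hm 0 _ t0) => //; have [] := total_energy_ge 0.
apply/ler_addgt0Pr => e ee.
(* tau m <= e/2 absorbs the factor 1 + tau; the distances are then taken below e/(2L), so that the
   terms with 1 + 1/tau add up to at most e/2. *)
pose tau := e / 2 / (m + 1).
have m1 : 0 < m + 1 by rewrite ltr_wpDl.
have tau0 : 0 < tau by rewrite !divr_gt0.
pose L := (1 + tau^-1) * (rho / 2 + K).
have L0 : 0 < L.
  apply: mulr_gt0; first by rewrite addr_gt0 ?invr_gt0.
  by apply: ltr_pwDl => //; rewrite divr_gt0.
have d0 : 0 < e / 2 / L by rewrite !divr_gt0.
have [d1 d10 hd1] := L2_derivative_continuous du su0 sut tT' d0.
have [d2 d20 hd2] := L2_derivative_continuous dut sut sutt tT' d0.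
pose s := Num.max 0 (t - Num.min d1 d2 / 2).
have dm : 0 < Num.min d1 d2 by rewrite lt_min d10.
have s0 : 0 <= s by rewrite le_max lexx.
have st : s < t by rewrite gt_max t0; lra.
have sd : t - Num.min d1 d2 / 2 <= s by rewrite le_max lexx orbT.
have : `|s - t| < Num.min d1 d2 by rewrite ltr0_norm; lra.
rewrite lt_min => /andP[sd1 sd2].
have sT' : 0 <= s <= T by rewrite s0 (le_trans (ltW st)).
have stn : s != t by rewrite lt_eqF.
have sw : sqint (fun x => u t x - u s x) by apply: sqintB; exact: su0.
have sz : sqint (fun x => ut t x - ut s x) by apply: sqintB; exact: sut.
have symm (v : R -> V -> V) : sqn (fun x => v t x - v s x) = sqn (fun x => v s x - v t x).
  exact: sqnBC.
have nw : sqn (fun x => u t x - u s x) < e / 2 / L by rewrite symm; exact: hd1.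
have nz : sqn (fun x => ut t x - ut s x) < e / 2 / L by rewrite symm; exact: hd2.
have := PD_quasi_subadditive hf hJ e0 n1 JM (su0 sT') sw tau0.
have := sqnD_le (sut sT') sz tau0.
have -> : (fun x => u s x + (u t x - u s x)) = u t by apply/funext => x; rewrite subrKC.
have -> : (fun x => ut s x + (ut t x - ut s x)) = ut t by apply/funext => x; rewrite subrKC.
rewrite -[(1 + tau^-1) * f0' * _]mulrA -/K.
have := hm s s0 st; rewrite /total_energy.
have t1 : 0 < 1 + tau^-1 by rewrite addr_gt0 ?invr_gt0.
have := K0; move: nw nz.
move: (sqn (fun x => u t x - u s x)) (sqn (fun x => ut t x - ut s x)) => nw nz.
move: (sqn (ut t)) (sqn (ut s)) (PD f J eps (u t)) (PD f J eps (u s)) => qt qs Pt Ps hnw hnz K0' hE h1 h2.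
have r0 : 0 < rho / 2 by rewrite divr_gt0.
have := ler_wpM2l (ltW r0) h1 => h1'.
have A : (1 + tau) * (rho / 2 * qs + Ps) <= (1 + tau) * m by rewrite ler_pM2l// addr_gt0.
have tm : tau * m <= e / 2.
  by rewrite /tau mulrAC ler_pdivrMr// mulrDr mulr1 lerDl ltW// divr_gt0.
have B1 : (1 + tau^-1) * (rho / 2 * nz + K * nw) <= e / 2.
  have : (1 + tau^-1) * (rho / 2 * nz + K * nw) <= (1 + tau^-1) * (rho / 2 * (e / 2 / L) + K * (e / 2 / L)).
    by rewrite ler_pM2l// lerD// ?ler_wpM2l// ltW.
  move=> /le_trans; apply; rewrite -mulrDl mulrA -/L mulrC divfK// gt_eqF//.
lra.
Qed.

(** A Gronwall argument by real induction. With E0 + 1 in place of E0 the comparison function m is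
    at least 1, so the constant part B/2 + 1 of the rate is at most (B/2 + 1) m. *)
Lemma total_energy_bound (E0 : R) : total_energy 0 <= E0 -> 0 <= B ->
  forall t, 0 <= t <= T ->
  total_energy t <= (E0 + 1) * expR ((B / 2 + 1 + rho^-1) * T).
Proof.
move=> hE0 B0; pose l := B / 2 + 1 + rho^-1.
have l0 : 0 <= l by rewrite !addr_ge0 ?divr_ge0// invr_ge0 ltW.
have E00 : 0 <= E0 by apply: le_trans hE0; have [] := total_energy_ge 0.
suff h : forall t, 0 <= t <= T -> total_energy t <= (E0 + 1) * expR (l * t).
  move=> t tT; apply: le_trans (h t tT) _; have /andP[t0 tT'] := tT.
  by rewrite ler_pM2l ?ltr_wpDl// ler_expR ler_wpM2l.
apply: real_induction; first exact: ltW.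
- by rewrite mulr0 expR0 mulr1 (le_trans hE0)// lerDl.
- move=> t t0 tT Pt; have [d d0 hd] := energy_right_growth t0 tT.
  exists d => // s ts sd sT; apply: le_trans (hd s ts sd sT) _.
  have [q _] := total_energy_ge t.
  have m1 : 1 <= (E0 + 1) * expR (l * t).
    rewrite -[leLHS]mulr1; apply: ler_pM => //; first by rewrite lerDr.
    by rewrite -expR0 ler_expR mulr_ge0.
  have -> : l * s = l * t + l * (s - t) by ring.
  rewrite expRD mulrA; have ex := expR_ge1Dx (l * (s - t)).
  have sg0 : 0 < s - t by rewrite subr_gt0.
  move: Pt m1 q; move: (_ * expR (l * t)) (total_energy t) (sqn _) => m En qu Pt m1 q.
  apply: (@le_trans _ _ (m * (1 + l * (s - t)))); last by rewrite ler_pM2l//; lra.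
  rewrite [leRHS]mulrDr mulr1; apply: lerD => //.
  rewrite mulrA [leRHS]mulrC ler_pM2l//.
  have ri : 0 <= rho^-1 by rewrite invr_ge0 ltW.
  (* Half the squared velocity is at most the energy divided by rho: the origin of 1/rho in the
     exponent. *)
  have q2 : qu / 2 <= rho^-1 * m.
    have : rho^-1 * En <= rho^-1 * m by rewrite ler_wpM2l.
    by move: q; rewrite [2 / rho]mulrC -mulrA; lra.
  rewrite /l; have : B / 2 <= m * (B / 2) by rewrite ler_peMl// divr_ge0.
  lra.
- move=> t t0 tT hlt; apply: energy_left_closed => // s s0 st.
  apply: le_trans (hlt s s0 st) _; rewrite ler_pM2l ?ltr_wpDl// ler_expR ler_wpM2l// ltW//.
Qed.

End evolution.

Transparent sqn ip PD sqint.

(** * Measure of the process zone *)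

Section influence_positivity.
Context {R : realType}.
Variables (J : R -> R) (M : R).
Hypotheses (hJ : influence_function J) (JM : forall r, 0 <= r -> J r <= M).

(** A vanishing integral would make phi, hence J on (0, 1), zero almost everywhere. The point 0 is a
    null set, and J is 0 from 1 on. *)
Lemma influence_integral_neq0 (phi : R -> R) : measurable_fun setT phi ->
  (forall r, 0 <= phi r) -> (forall r, 0 < r -> r < 1 -> phi r = 0 -> J r = 0) ->
  (\int[lebesgue_measure]_r (phi r)%:E != 0)%E.
Proof.
move=> mphi phi0 phiJ; apply/eqP => int0; apply: (influence_neq0 hJ).
have mphiE : measurable_fun setT (EFin \o phi) by exact/measurable_EFinP.
have : ae_eq lebesgue_measure setT (EFin \o phi) (cst 0%E).
  apply/(ae_eq_integral_abs _ measurableT) => //.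
  by under eq_integral do rewrite /= ger0_norm//.
have null0 : {ae lebesgue_measure, forall r : R, r != 0}.
  exists [set 0]; split => //; first exact: lebesgue_measure_set1.
  by move=> r /= /negP; rewrite negbK => /eqP.
have Fae := ae_filter_ringOfSetsType (@lebesgue_measure R).
move: null0; apply: filterS2 => r rn0 /(_ I) [] pr r0.
have [r1|r1] := ltP r 1; last exact: (influence_support hJ).
by apply: phiJ => //; rewrite lt_neqAle eq_sym rn0.
Qed.

Lemma measurable_influence_cut : measurable_fun setT (fun r : R => if 0 <= r then J r else 0).
Proof.
rewrite (_ : (fun _ => _) = J \_ `[0, +oo[).
  by apply/(measurable_restrictT _ _).1 => //; exact: influence_measurable hJ.
apply/funext => r; rewrite patchE; case: ifPn => [r0|r0].
  by rewrite mem_set//= in_itv/= r0.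
by rewrite memNset//= in_itv/= andbT; exact/negP.
Qed.

Lemma moment_gt0 n : 0 < moment n J.
Proof.
have mc := measurable_influence_cut.
have M0 : 0 <= M by exact: le_trans (influence_ge0 hJ (lexx 0)) (JM (lexx 0)).
pose phi (r : R) := (r ^+ n * (if 0 <= r then J r else 0)) * \1_`[0, 1] r.
have phiE r : 0 <= r -> r <= 1 -> phi r = r ^+ n * J r.
  by move=> r0 r1; rewrite /phi r0 indicE mem_set ?mulr1//= in_itv/= r0.
have phi_out r : ~~ (0 <= r <= 1) -> phi r = 0.
  by move=> h; rewrite /phi indicE memNset ?mulr0//=; rewrite in_itv/=; exact/negP.
have phi01 r : 0 <= phi r <= M * \1_`[0, 1] r.
  have [/andP[r0 r1]|h] := boolP (0 <= r <= 1).
    rewrite phiE// indicE mem_set/= ?in_itv/= ?r0// mulr1 mulr_ge0 ?exprn_ge0 ?(influence_ge0 hJ)//=.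
    rewrite -[leRHS]mul1r; apply: ler_pM; [exact: exprn_ge0|exact: (influence_ge0 hJ)| |exact: JM].
    by rewrite exprn_ile1.
  by rewrite phi_out// lexx mulr_ge0// indicE.
have phi0 r : 0 <= phi r by have /andP[] := phi01 r.
have mphi : measurable_fun setT phi.
  apply: measurable_funM; last exact: measurable_indic.
  by apply: measurable_funM => //; exact: exprn_measurable.
have neq0 := influence_integral_neq0 mphi phi0.
have Ephi : (\int[lebesgue_measure]_(r in `[0%R, 1%R]) (r ^+ n * J r)%:E =
    \int[lebesgue_measure]_r (phi r)%:E)%E.
  rewrite integral_mkcond; apply: eq_integral => r _; rewrite patchE; case: ifPn.
    by rewrite inE/= in_itv/= => /andP[r0 r1]; rewrite phiE.
  by move=> h; rewrite phi_out//; apply: contra h => h; rewrite inE/= in_itv.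
rewrite /moment /Rintegral Ephi; apply: fine_gt0; apply/andP; split.
  rewrite lt0e; apply/andP; split; last by apply: integral_ge0 => r _; rewrite lee_fin.
  apply: neq0 => r r0 r1; rewrite phiE ?(ltW r0) ?(ltW r1)// => /eqP.
  by rewrite mulf_eq0 expf_eq0 (gt_eqF r0) andbF/= => /eqP.
apply: (@le_lt_trans _ _ (\int[lebesgue_measure]_r (M%:E * (\1_`[0%R, 1%R] r)%:E))%E).
  apply: ge0_le_integral => //.
  - by move=> r _; rewrite lee_fin.
  - exact/measurable_EFinP.
  - by apply: measurable_funeM; apply/measurable_EFinP; exact: measurable_indic.
  - by move=> r _; rewrite -EFinM lee_fin; have /andP[] := phi01 r.
rewrite ge0_integralZl//; last by apply/measurable_EFinP; exact: measurable_indic.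
by rewrite integral_indic// setIT /= lebesgue_measure_itv/= lte_fin ltr01 oppr0 adde0 mule1 ltry.
Qed.

(** Positivity of the normalizing constant of P: the nontriviality of J on the line passes to the
    space through [ge0_integral_radial_eq0]. *)
Lemma radial_moment_gt0 n : (0 < n)%N ->
  0 < \int[lebesgueD n]_(xi in eball (0 : 'rV[R]_n) 1) (enorm xi * J (enorm xi)).
Proof.
move=> n0; pose phi (r : R) := r * (if 0 <= r then J r else 0).
have phi0 r : 0 <= phi r.
  rewrite /phi; case: ifPn => [r0|_]; last by rewrite mulr0.
  by rewrite mulr_ge0//; exact: (influence_ge0 hJ).
have mphi : measurable_fun setT phi by apply: measurable_funM => //; exact: measurable_influence_cut.
have M0 : 0 <= M by exact: le_trans (influence_ge0 hJ (lexx 0)) (JM (lexx 0)).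
have phiE (xi : 'rV[R]_n) : phi (enorm xi) = enorm xi * J (enorm xi).
  by rewrite /phi enorm_ge0.
have phi_le r : r <= 0 -> phi r = 0.
  rewrite /phi le_eqVlt => /predU1P[->|r0]; first by rewrite mul0r.
  by rewrite leNgt r0/= mulr0.
have E : (\int[lebesgueD n]_(xi in eball (0 : 'rV[R]_n) 1) (enorm xi * J (enorm xi))%:E =
    \int[lebesgueD n]_xi (phi (enorm xi))%:E)%E.
  rewrite integral_mkcond; apply: eq_integral => xi _; rewrite patchE phiE; case: ifPn => // h.
  rewrite (influence_support hJ) ?mulr0//; rewrite leNgt; apply: contra h => h.
  by rewrite inE /eball/= subr0.
rewrite /Rintegral; apply: fine_gt0; rewrite E; apply/andP; split.
  rewrite lt0e; apply/andP; split; last by apply: integral_ge0 => r _; rewrite lee_fin.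
  apply/eqP => int0.
  have := influence_integral_neq0 mphi phi0; rewrite (ge0_integral_radial_eq0 n0 mphi phi0 phi_le int0).
  rewrite eqxx => /(_ _)/negP; apply => // r r0 r1; rewrite /phi (ltW r0) => /eqP.
  by rewrite mulf_eq0 (gt_eqF r0)/= => /eqP.
rewrite -E; apply: (@le_lt_trans _ _ (\int[lebesgueD n]_(xi in eball (0 : 'rV[R]_n) 1) (cst M%:E) xi)%E).
  apply: ge0_le_integral => //; first exact: measurable_eball.
  - by move=> xi _; rewrite lee_fin -phiE.
  - under eq_fun do rewrite -phiE; apply/measurable_EFinP; apply: measurable_funTS.
    exact: measurableT_comp mphi measurable_enorm.
  - move=> xi; rewrite /eball/= subr0 => h; rewrite lee_fin -[leRHS]mul1r.
    apply: ler_pM; [exact: enorm_ge0| |exact: ltW|apply: JM; exact: enorm_ge0].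
    by apply: (influence_ge0 hJ); exact: enorm_ge0.
rewrite integral_cst; last exact: measurable_eball.
by rewrite [X in (_ * X)%E](lebesgueD_eball (0 : 'rV[R]_n) ltr01) -EFinM ltry.
Qed.

End influence_positivity.

Section process_zone_measure.
Context {R : realType} {n : nat}.
Local Notation V := 'rV[R]_n.
Local Notation leb := (lebesgueD n).
Local Notation leb2 := (lebesgueD n \x lebesgueD n)%E.
Variables (f : R -> R) (f0' finf rbar : R) (J : R -> R) (eps M kk theta alpha : R) (u : V -> V).
Hypotheses (hf : cohesive_potential f f0' finf rbar) (hJ : influence_function J)
  (e0 : 0 < eps) (e1 : eps <= 1) (n1 : (1 < n)%N) (JM : forall r, 0 <= r -> J r <= M)
  (theta0 : 0 < theta) (kk0 : 0 < kk) (al : 2^-1 <= alpha < 1) (su : sqint u).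
Implicit Types (p : V * V) (x y : V).

Let m : R := \int[leb]_(xi in eball (0 : V) 1) (enorm xi * J (enorm xi)).

Let m0 : 0 < m.
Proof. exact: (radial_moment_gt0 hJ JM (ltnW n1)). Qed.

(** The density of P before normalization. It vanishes outside the ball, so integrals over parts of
    the ball become integrals over the whole space. *)
Let wt p : R := enorm (p.2 - p.1) / eps * bond_weight J eps (p.2 - p.1).

Let wt0 p : 0 <= wt p.
Proof.
by rewrite mulr_ge0 ?divr_ge0 ?enorm_ge0 ?(ltW e0)//; exact: (bond_weight_ge0 hJ).
Qed.

Let wt_out p : eps <= enorm (p.2 - p.1) -> wt p = 0.
Proof. by move=> h; rewrite /wt (bond_weight_out hJ e0)// mulr0. Qed.

Let mwt : measurable_fun setT wt.
Proof.
apply: measurable_funM; last exact: (measurable_pair_weight hJ e0).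
by apply: measurable_funM => //; exact: measurable_pair_enorm.
Qed.

Definition large_strain : set (V * V) :=
  [set p | kk * enorm (p.2 - p.1) `^ (alpha - 1) < `|strain u p.2 p.1|].

Lemma measurable_large_strain : measurable large_strain.
Proof.
have h : measurable_fun setT
    (fun p : V * V => kk * enorm (p.2 - p.1) `^ (alpha - 1) < `|strain u p.2 p.1|).
  apply: measurable_fun_ltr.
    by apply: measurable_funM => //; exact: measurableT_comp (measurable_powR _) measurable_pair_enorm.
  by apply: measurableT_comp => //; exact: measurable_strain su.1.
by have := h measurableT [set true] I; rewrite setTI.
Qed.

Let prob_integral (A : set (V * V)) x :
  (\int[leb]_(y in [set y | eball x eps y /\ A (x, y)])
     (enorm (y - x) / eps * J (enorm (y - x) / eps))%:E =
   \int[leb]_y (wt (x, y) * \1_A (x, y))%:E)%E.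
Proof.
rewrite integral_mkcond; apply: eq_integral => y _; rewrite patchE indicE.
have [ye|ye] := ltP (enorm (y - x)) eps.
  case: (asboolP (A (x, y))) => h.
    by rewrite mem_set// mem_set// mulr1.
  by rewrite memNset ?memNset ?mulr0//= => -[].
by rewrite wt_out// mul0r; case: ifPn => //; rewrite inE/= => -[]; rewrite /eball/= ltNge ye.
Qed.

Let wt_integral x : (\int[leb]_y (wt (x, y))%:E = (eps ^+ n * m)%:E)%E.
Proof.
have mE : (\int[leb]_(xi in eball (0 : V) 1) (enorm xi * J (enorm xi))%:E = m%:E)%E.
  have := m0; rewrite /m /Rintegral.
  by case: (\int[leb]_(_ in _) _)%E => [r| |] //=; rewrite ltxx.
have mx : measurable_fun setT (fun y : V => (wt (x, y))%:E).
  by apply/measurable_EFinP; exact: measurableT_comp mwt (measurable_pair1 x).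
have mx0 y : (0 <= (wt (x, y))%:E)%E by rewrite lee_fin.
have sc := ge0_integral_affine x e0 mx mx0.
have -> : (\int[leb]_y (wt (x, y))%:E = (eps ^+ n)%:E * ((eps ^- n)%:E * \int[leb]_y (wt (x, y))%:E))%E.
  by rewrite muleA -EFinM mulfV ?mul1e// expf_neq0// gt_eqF.
rewrite -sc EFinM -mE; congr (_ * _)%E; rewrite [RHS]integral_mkcond.
apply: eq_integral => xi _; rewrite patchE /wt /bond_weight /= addrK enormZ gtr0_norm//.
have -> : eps * enorm xi / eps = enorm xi by rewrite mulrAC mulfV ?mul1r// gt_eqF.
case: ifPn => // h.
rewrite (influence_support hJ) ?mulr0//; rewrite leNgt; apply: contra h => h.
by rewrite inE /eball/= subr0.
Qed.

Let S (A : set (V * V)) x : \bar R := (\int[leb]_y (wt (x, y) * \1_A (x, y))%:E)%E.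

Let S_ge0 A x : (0 <= S A x)%E.
Proof. by apply: integral_ge0 => y _; rewrite lee_fin mulr_ge0// indicE. Qed.

Let measurable_S A : measurable A -> measurable_fun setT (S A).
Proof.
move=> mA; apply: (@measurable_fun_fubini_tonelli_F _ _ V V R leb
  (fun p => (wt p * \1_A p)%:E)).
  by apply/measurable_EFinP; apply: measurable_funM => //; exact: measurable_indic.
by move=> p; rewrite lee_fin mulr_ge0// indicE.
Qed.

Let S_fin A x : measurable A -> S A x \is a fin_num.
Proof.
move=> mA; rewrite ge0_fin_numE//; apply: (@le_lt_trans _ _ (\int[leb]_y (wt (x, y))%:E)%E).
  apply: ge0_le_integral => //.
  - by move=> y _; rewrite lee_fin mulr_ge0// indicE.
  - apply/measurable_EFinP; apply: measurable_funM.
      exact: measurableT_comp mwt (measurable_pair1 x).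
    exact: measurableT_comp (measurable_indic mA) (measurable_pair1 x).
  - by apply/measurable_EFinP; exact: measurableT_comp mwt (measurable_pair1 x).
  - by move=> y _; rewrite lee_fin ler_piMr// indicE lern1 leq_b1.
by rewrite wt_integral ltry.
Qed.

Lemma nbhd_probC x :
  nbhd_prob J eps x [set y | eball x eps y /\
      `|strain u y x| <= kk * enorm (y - x) `^ (alpha - 1)] +
  nbhd_prob J eps x [set y | eball x eps y /\
      kk * enorm (y - x) `^ (alpha - 1) < `|strain u y x|] = 1.
Proof.
have mL := measurable_large_strain; have mC := measurableC mL.
have sumS : (S (~` large_strain) x + S large_strain x = (eps ^+ n * m)%:E)%E.
  rewrite -(wt_integral x) /S -ge0_integralD//.
  - apply: eq_integral => y _; rewrite -EFinD -mulrDr !indicE in_setC; congr EFin.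
    by case: (_ \in _); rewrite ?addr0 ?add0r mulr1.
  - by move=> y _; rewrite lee_fin mulr_ge0// indicE.
  - apply/measurable_EFinP; apply: measurable_funM.
      exact: measurableT_comp mwt (measurable_pair1 x).
    exact: measurableT_comp (measurable_indic mC) (measurable_pair1 x).
  - by move=> y _; rewrite lee_fin mulr_ge0// indicE.
  - apply/measurable_EFinP; apply: measurable_funM.
      exact: measurableT_comp mwt (measurable_pair1 x).
    exact: measurableT_comp (measurable_indic mL) (measurable_pair1 x).
rewrite /nbhd_prob -mulrDr -/m /Rintegral.
have -> : [set y | eball x eps y /\ `|strain u y x| <= kk * enorm (y - x) `^ (alpha - 1)] =
    [set y | eball x eps y /\ (~` large_strain) (x, y)].
  by apply/seteqP; split => y [ye h]; split => //; move: h; rewrite /large_strain/= leNgt => /negP.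
rewrite (prob_integral (~` large_strain)) (prob_integral large_strain).
rewrite -fineD; [|exact: S_fin..].
by move: sumS; rewrite /S => ->; rewrite /= mulVf// gt_eqF// mulr_gt0// exprn_gt0.
Qed.

Lemma measurable_process_zone (D : set V) : measurable D ->
  measurable (process_zone D J eps u kk alpha theta).
Proof.
move=> mD; pose P x := (eps ^+ n * m)^-1 * fine (S large_strain x).
have mP : measurable_fun setT P.
  by apply: measurable_funM => //; apply: measurableT_comp => //; exact: measurable_S measurable_large_strain.
rewrite (_ : process_zone _ _ _ _ _ _ _ = D `&` P @^-1` `]theta, +oo[).
  by apply: measurableI => //; rewrite -[X in measurable X]setTI; exact: mP.
apply/seteqP; split => x /=; rewrite in_itv/= andbT /nbhd_prob /Rintegral /P /S.
  by move=> [Dx h]; split => //; rewrite -prob_integral.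
by move=> [Dx h]; split => //; move: h; rewrite -prob_integral.
Qed.

Let lev : R := eps `^ (2 * alpha - 1) * f (kk ^+ 2).

Let fk0 : 0 < f (kk ^+ 2).
Proof. by apply: (potential_gt0 hf); rewrite exprn_gt0. Qed.

Let lev0 : 0 < lev.
Proof. by rewrite mulr_gt0// powR_gt0. Qed.

(* At a large strain, h S^2 > k^2 h^(2 alpha - 1), and f is star-shaped. *)
Let bond_energy_large p : lev * (wt p * \1_large_strain p) <= bond_energy f J eps u p.
Proof.
have be0 := bond_energy_ge0 hf hJ e0 u p; rewrite indicE.
have [hl|] := boolP (p \in _); last by rewrite !mulr0.
rewrite inE /large_strain/= in hl; rewrite mulr1.
have [he|he] := leP eps (enorm (p.2 - p.1)); first by rewrite wt_out// mulr0.
have /andP[al1 al2] := al; set b := 2 * alpha - 1.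
have b0 : 0 <= b by rewrite /b; lra.
have b1 : b <= 1 by rewrite /b; lra.
move: hl; rewrite /wt /bond_energy; set h := enorm _; set s := strain _ _ _ => hl.
(* If h = 0, division by 0 gives strain 0, which cannot exceed the nonnegative threshold. *)
have h0 : 0 < h.
  rewrite lt_neqAle enorm_ge0 andbT eq_sym; apply/eqP => hz.
  move: hl; rewrite /s strainE -/h hz expr0n/= invr0 mulr0 normr0 ltNge mulr_ge0 ?powR_ge0 ?(ltW kk0)//.
have hb1 : 0 <= h `^ b <= 1.
  rewrite powR_ge0/=; apply: le_trans (_ : h `^ 0 <= 1); last by rewrite powRr0.
  by apply: ger_powR => //; rewrite h0 (le_trans (ltW he)).
have hs : h `^ b * kk ^+ 2 <= h * s ^+ 2.
  have -> : h `^ b = h * (h `^ (alpha - 1)) ^+ 2.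
    rewrite expr2 -powRD; last by rewrite (gt_eqF h0) implybT.
    rewrite -{2}(powRr1 (ltW h0)) -powRD; last by rewrite (gt_eqF h0) implybT.
    by congr (_ `^ _); rewrite /b; ring.
  rewrite -mulrA ler_pM2l// -exprMn mulrC -(real_normK (num_real s)).
  by apply: lerXn2r; rewrite ?nnegrE ?mulr_ge0 ?powR_ge0 ?(ltW kk0)//; exact: ltW.
have fs : h `^ b * f (kk ^+ 2) <= f (h * s ^+ 2).
  apply: le_trans (potential_star hf hb1 (sqr_ge0 kk)) _.
  by apply: (potential_mono hf) => //; rewrite mulr_ge0 ?powR_ge0 ?sqr_ge0.
(* The factor h/eps <= 1 of the weight in P is at most (h/eps)^b since b <= 1; this exchanges h^b
   for eps^b. *)
have hbe : eps `^ b * (h / eps) <= h `^ b.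
  have q0 : 0 < h / eps by rewrite divr_gt0.
  have q1 : h / eps <= 1 by rewrite ler_pdivrMr// mul1r ltW.
  have {2}-> : h = eps * (h / eps) by rewrite mulrCA mulfV ?mulr1// gt_eqF.
  rewrite powRM ?(ltW e0) ?(ltW q0)//; apply: ler_wpM2l; first exact: powR_ge0.
  by rewrite -[leLHS](powRr1 (ltW q0)); apply: ger_powR => //; rewrite q0.
rewrite [leLHS](_ : _ = bond_weight J eps (p.2 - p.1) * (eps `^ b * (h / eps) * f (kk ^+ 2))); last first.
  by rewrite /lev; ring.
apply: ler_wpM2l; first exact: (bond_weight_ge0 hJ).
by apply: le_trans fs; rewrite ler_wpM2r// ltW.
Qed.

(** Markov's inequality for the inner integral G of the bond energy. On the zone G is at least [lev]
    times theta eps^n m, while the integral of G is eps^(n+1) times the volume of the unit ball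
    times the energy. The quotient leaves the power eps^(1 - beta), with beta = 2 alpha - 1. *)
Lemma process_zone_le (D : set V) (E : R) : measurable D -> PD f J eps u <= E ->
  (leb (process_zone D J eps u kk alpha theta) <=
     (E * ball_volume R n / (f (kk ^+ 2) * theta * m) * eps `^ (1 - (2 * alpha - 1)))%:E)%E.
Proof.
move=> mD PE; have vol := @ball_volume_gt0 R n.
pose G x := (\int[leb]_y (bond_energy f J eps u (x, y))%:E)%E.
have mbe := measurable_bond_energy hf hJ e0 su.1.
have mbeE : measurable_fun setT (EFin \o bond_energy f J eps u) by exact/measurable_EFinP.
have be0E p : (0 <= (EFin \o bond_energy f J eps u) p)%E.
  by rewrite lee_fin (bond_energy_ge0 hf hJ e0).
have mG : measurable_fun setT G by exact: (@measurable_fun_fubini_tonelli_F _ _ V V R leb _ mbeE be0E).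
have IG : (\int[leb]_x G x = (eps ^+ n * ball_volume R n * eps * PD f J eps u)%:E)%E.
  have iE := integrable_bond_energy hf hJ e0 n1 JM su.
  rewrite -(@fubini_tonelli1 _ _ V V R leb leb _ mbeE be0E).
  have c0 : 0 < eps ^+ n * ball_volume R n * eps by rewrite !mulr_gt0 ?exprn_gt0.
  rewrite /PD mulrA mulfV ?gt_eqF// mul1r /Rintegral fineK//.
  exact: integrable_fin_num iE.
pose t := lev * (theta * (eps ^+ n * m)).
have t0 : 0 < t.
  by apply: mulr_gt0; [exact: lev0|apply: mulr_gt0 => //; apply: mulr_gt0; [exact: exprn_gt0|exact: m0]].
have mL := measurable_large_strain.
have sub : process_zone D J eps u kk alpha theta `<=` [set x | (t%:E <= G x)%E].
  move=> x [_]; rewrite /nbhd_prob /Rintegral (prob_integral large_strain) -/m -/(S _ _) => h /=.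
  have c0 : 0 < eps ^+ n * m by rewrite mulr_gt0 ?exprn_gt0.
  rewrite ltr_pdivlMl// mulrC in h.
  apply: (@le_trans _ _ (lev%:E * S large_strain x)%E).
    by rewrite -(fineK (S_fin x mL)) -EFinM lee_fin /t ler_pM2l// ltW.
  rewrite /S -ge0_integralZl//; last 3 first.
  - apply/measurable_EFinP; apply: measurable_funM.
      exact: measurableT_comp mwt (measurable_pair1 x).
    exact: measurableT_comp (measurable_indic mL) (measurable_pair1 x).
  - by move=> y _; rewrite lee_fin mulr_ge0// indicE.
  - by rewrite lee_fin ltW.
  apply: ge0_le_integral => //.
  - by move=> y _; rewrite mule_ge0 ?lee_fin ?(ltW lev0)// mulr_ge0// indicE.
  - apply: measurable_funeM; apply/measurable_EFinP; apply: measurable_funM.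
      exact: measurableT_comp mwt (measurable_pair1 x).
    exact: measurableT_comp (measurable_indic mL) (measurable_pair1 x).
  - exact: measurableT_comp mbeE (measurable_pair1 x).
  - by move=> y _; rewrite -EFinM lee_fin; exact: bond_energy_large.
have mA : measurable [set x | (t%:E <= G x)%E].
  by rewrite -[X in measurable X]setTI; exact: emeasurable_fun_c_infty.
have mpz := measurable_process_zone mD.
apply: (@le_trans _ _ (leb [set x | (t%:E <= G x)%E])); first by apply: le_measure; rewrite ?inE.
have G0 x : (0 <= G x)%E by apply: integral_ge0 => y _; exact: be0E.
have markov : (t%:E * leb [set x | (t%:E <= G x)%E] <= \int[leb]_x G x)%E.
  have := le_integral_abse leb measurableT mG t0.
  rewrite setTI; under eq_integral do rewrite gee0_abs//.
  by under eq_set do rewrite gee0_abs//.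
rewrite IG -lee_pdivlMl// -EFinM in markov.
apply: (le_trans markov); rewrite lee_fin.
have pw : eps `^ (1 - (2 * alpha - 1)) * eps `^ (2 * alpha - 1) = eps.
  by rewrite -powRD ?subrK ?powRr1 ?(ltW e0)// (gt_eqF e0) implybT.
have pb : 0 < eps `^ (2 * alpha - 1) by rewrite powR_gt0.
have -> : E * ball_volume R n / (f (kk ^+ 2) * theta * m) * eps `^ (1 - (2 * alpha - 1)) =
    t^-1 * (eps ^+ n * ball_volume R n * eps * E).
  rewrite -{3}pw /t /lev; field.
  by rewrite !gt_eqF// ?exprn_gt0.
rewrite ler_pM2l ?invr_gt0// ler_pM2l// !mulr_gt0 ?exprn_gt0//.
Qed.

End process_zone_measure.

(** * Unions over dyadic horizons *)

Section dyadic_union.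
Context {R : realType} {n : nat}.
Local Notation V := 'rV[R]_n.
Local Notation leb := (lebesgueD n).

Lemma horizon_gt0 k : 0 < horizon k :> R.
Proof. by rewrite /horizon invr_gt0 exprn_gt0. Qed.

Lemma horizon_powR k (p : R) : horizon k `^ p = (2^-1 `^ p) ^+ k.
Proof.
rewrite /horizon -exprVn -powR_mulrn ?invr_ge0// powRAC powR_mulrn//.
Qed.

Lemma horizon_small (delta : R) : 0 < delta -> exists k, horizon k < delta.
Proof.
move=> d0; pose k := Num.bound delta^-1; exists k.
rewrite /horizon -[ltRHS]invrK ltf_pV2 ?posrE ?invr_gt0 ?exprn_gt0//.
have h : delta^-1 < k%:R by apply: archi_boundP; rewrite invr_ge0 ltW.
apply: (lt_le_trans h); rewrite -natrX ler_nat; exact/ltnW/ltn_expl.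
Qed.

Lemma horizon_anti i j : (i <= j)%N -> horizon j <= horizon i :> R.
Proof.
move=> ij; rewrite /horizon lef_pV2 ?posrE ?exprn_gt0//.
by apply: ler_weXn2l => //; rewrite ler1n.
Qed.

(** If N is the first index with horizon below delta, only the indices N + j contribute, each at
    most K delta^p times the j-th power of 2^-p. *)
Lemma dyadic_union_le (A : set nat) (Z : nat -> set V) (K p delta : R) : 0 <= K -> 0 < p -> 0 < delta ->
  (forall k, A k -> measurable (Z k)) ->
  (forall k, A k -> (leb (Z k) <= (K * horizon k `^ p)%:E)%E) ->
  (leb (\bigcup_(k in A `&` [set k | (horizon k < delta)%R]) Z k)
    <= (K / (1 - 2^-1 `^ p) * delta `^ p)%:E)%E.
Proof.
move=> K0 p0 d0 mZ leZ; set q := 2^-1 `^ p.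
have q0 : 0 < q by rewrite powR_gt0 ?invr_gt0.
have q1 : q < 1.
  have : 2^-1 `^ p < 1 `^ p :> R by apply: gt0_ltr_powR; rewrite ?nnegrE ?invr_ge0// invf_lt1// ltr1n.
  by rewrite powR1.
have [N hN minN] := ex_minnP (horizon_small d0).
(* Indices outside A contribute the empty set, so that the sum runs over all j. *)
pose F j := if `[< A (N + j)%N >] then Z (N + j)%N else set0.
have mF j : measurable (F j) by rewrite /F; case: asboolP => // h; exact: mZ.
have sub : \bigcup_(k in A `&` [set k | (horizon k < delta)%R]) Z k `<=` \bigcup_j F j.
  move=> x [k [Ak kd] Zx]; have Nk := minN k kd.
  by exists (k - N)%N => //; rewrite /F subnKC//; case: asboolP.
have mL : measurable (\bigcup_(k in A `&` [set k | (horizon k < delta)%R]) Z k).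
  by apply: bigcup_measurable => k [Ak _]; exact: mZ.
apply: (le_trans (measure_sigma_subadditive leb mF mL sub)).
have geo := @nneseries_geometric R (K * delta `^ p) q (mulr_ge0 K0 (powR_ge0 _ _)).
have {}geo := geo ltac:(by rewrite (ltW q0) q1).
rewrite mulrAC -geo; apply: lee_nneseries => j *; first exact: measure_ge0.
have Kd : 0 <= K * delta `^ p * q ^+ j by rewrite !mulr_ge0 ?powR_ge0 ?exprn_ge0// ltW.
rewrite /F; case: asboolP => [Aj|_]; last by rewrite measure0 lee_fin.
apply: le_trans (leZ _ Aj) _; rewrite lee_fin -mulrA ler_wpM2l//.
rewrite horizon_powR -/q exprD ler_wpM2r ?exprn_ge0 ?(ltW q0)// /q -horizon_powR.
by apply: ge0_ler_powR; rewrite ?nnegrE ?(ltW p0) ?(ltW hN) ?(ltW (horizon_gt0 _)) ?(ltW d0).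
Qed.

End dyadic_union.

(** * Consequences of the initial data and conclusion *)

Section initial_data.
Context {R : realType} {n : nat}.
Local Notation V := 'rV[R]_n.
Local Notation leb := (lebesgueD n).

(** Both terms of the energy are nonnegative with positive coefficients, so each is finite by
    itself. *)
Lemma LEFM_finite (D : set V) (f0' finf : R) J (u : V -> V) (E : V -> 'M[R]_n) :
  measurable D -> (forall i j, measurable_fun D (fun x => E x i j)) ->
  0 < lame n f0' J -> 0 < fracture_toughness n finf J ->
  (LEFM D f0' finf J u E < +oo)%E ->
  (\int[leb]_(x in D) (\sum_i \sum_j E x i j ^+ 2)%:E < +oo)%E /\
  (hausdorff n.-1 (jump_set D u) < +oo)%E.
Proof.
move=> mD mE l0 g0; rewrite /LEFM; set I := (\int[_]_(_ in _) _)%E; set H := hausdorff _ _ => fin.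
have ll : 0 < 2 * lame n f0' J by rewrite mulr_gt0.
have S0 x : 0 <= \sum_i \sum_j E x i j ^+ 2.
  by do 2! (apply: sumr_ge0 => ? _); exact: sqr_ge0.
have I0 : (0 <= I)%E.
  apply: integral_ge0 => x _; rewrite lee_fin; apply: addr_ge0.
    exact: mulr_ge0 (ltW ll) (S0 x).
  exact: mulr_ge0 (ltW l0) (sqr_ge0 _).
have H0 : (0 <= H)%E by exact: (outer_measure_ge0 (hausdorff_outer R n n.-1)).
have gH0 : (0 <= (fracture_toughness n finf J)%:E * H)%E by rewrite mule_ge0// lee_fin ltW.
have Ifin : (I < +oo)%E by apply: le_lt_trans fin; rewrite leeDl.
split; last first.
  have gH : ((fracture_toughness n finf J)%:E * H < +oo)%E by apply: le_lt_trans fin; rewrite leeDr.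
  rewrite ltNge leye_eq; apply/negP => /eqP HE; move: gH.
  by rewrite HE gt0_muley ?lte_fin// ltxx.
have mS : measurable_fun D (fun x => \sum_i \sum_j E x i j ^+ 2).
  by do 2! (apply: measurable_sum => ?); exact: measurable_funX.
have le : ((2 * lame n f0' J)%:E * \int[leb]_(x in D) (\sum_i \sum_j E x i j ^+ 2)%:E <= I)%E.
  rewrite -ge0_integralZl//; last 3 first.
  - exact/measurable_EFinP.
  - by move=> x _; rewrite lee_fin.
  - by rewrite lee_fin ltW.
  apply: ge0_le_integral => //.
  - by move=> x _; rewrite -EFinM lee_fin; exact: mulr_ge0 (ltW ll) (S0 x).
  - by apply: measurable_funeM; exact/measurable_EFinP.
  - apply/measurable_EFinP; apply: measurable_funD; first exact: measurable_funM.
    apply: measurable_funM => //; apply: measurable_funX; apply: measurableT_comp => //.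
    by apply: measurable_sum => i; exact: mE.
  - by move=> x _; rewrite -EFinM lee_fin lerDl; exact: mulr_ge0 (ltW l0) (sqr_ge0 _).
rewrite -lee_pdivlMl// in le; apply: (le_lt_trans le).
by rewrite lte_mul_pinfty// lee_fin invr_ge0 ltW.
Qed.

Lemma sqn_ae0 (w : V -> V) : sqint w -> {ae leb, forall x, w x = 0} -> sqn w = 0.
Proof.
move=> sw w0; rewrite /sqn /Rintegral.
have -> : (\int[leb]_x (enorm (w x) ^+ 2)%:E = \int[leb]_(x in setT) (cst 0%E : V -> \bar R) x)%E.
  apply: ae_eq_integral => //; first by apply/measurable_EFinP; exact: measurable_sqn sw.1.
  by apply: filterS w0 => x wx _ /=; rewrite wx enorm0 expr0n.
by rewrite integral0.
Qed.

Lemma potential_derivative (f : R -> R) (f0' finf rbar : R) : cohesive_potential f f0' finf rbar ->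
  exists f' : R -> R, forall r : R, 0 <= r ->
    (s - r)^-1 * (f s - f r) @[s --> within `[0, +oo[ (r^')] --> f' r.
Proof.
move=> hf; have [g [g0 hg]] := potential_smooth hf; exists (g 1%N) => r r0.
have := hg 0%N r r0; apply: cvg_trans; apply: near_eq_cvg.
by apply: filterS (withinT _ _) => s /=; rewrite in_itv/= andbT => s0; rewrite !g0.
Qed.

End initial_data.

(** Uniformity in t and delta is inherited from the energy bound [Emax], which involves neither the
    time nor the horizon. The last claim rests on an exact identity: within D, the complement of the
    stable centers is [CPZ_0 t]. *)
Theorem theorem2 (R : realType) (d : nat) (hd : d = 2%N \/ d = 3%N)
  (D : set 'rV[R]_d) (hD : bounded_domain D) (a : R) (ha : 0 < a)
  (f : R -> R) (f0' finf rbar : R) (hf : cohesive_potential f f0' finf rbar)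
  (J : R -> R) (hJ : influence_function J)
  (rho T : R) (hrho : 0 < rho) (hT : 0 < T)
  (u0 v0 : 'rV[R]_d -> 'rV[R]_d)
  (hinit : LEFM_initial_data D a f0' finf J u0 v0)
  (b : R -> 'rV[R]_d -> 'rV[R]_d) (hb : C1_L20 D a T b)
  (u : nat -> R -> 'rV[R]_d -> 'rV[R]_d)
  (hu : forall k, admissible a k ->
    cohesive_evolution D a f J rho T (horizon k) u0 v0 b (u k))
  (theta kk alpha beta : R) (htheta : 0 < theta <= 1) (hkk : 0 < kk <= rbar)
  (halpha : 2^-1 <= alpha < 1) (hbeta : beta = 2 * alpha - 1) :
  let ut t := fun k => u k t in
  let CPZd t delta := CPZ D a J (ut t) kk alpha theta delta in
  let CPZ_0 t := CPZ0 D a J (ut t) kk alpha theta in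
  [/\ (forall t : R, 0 <= t <= T -> forall delta delta' : R, 0 < delta ->
         delta <= delta' -> CPZd t delta `<=` CPZd t delta'),
      (exists2 K : R, 0 < K &
         forall t delta : R, 0 <= t <= T -> 0 < delta ->
           (lebesgueD d (CPZd t delta) <= (K * delta `^ (1 - beta))%:E)%E),
      (forall t : R, 0 <= t <= T ->
         lebesgueD d (CPZd t delta) @[delta --> 0^'+] --> 0%E /\
         lebesgueD d (CPZ_0 t) = 0%E) &
      (forall t : R, 0 <= t <= T ->
         lebesgueD d (D `\` stable_centers D a J (ut t) kk alpha theta) = 0%E /\
         lebesgueD d D = lebesgueD d (D `\` CPZ_0 t))].
Proof.
move=> ut CPZd CPZ_0.
have n1 : (1 < d)%N by case: hd => ->.
have [oD _ _] := hD; have mD : measurable D by exact: open_measurable_rV.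
have /andP[theta0 theta1] := htheta; have /andP[kk0 _] := hkk.
have /andP[al1 al2] := halpha.
have [M JM] := influence_bounded hJ.
have M0 : 0 <= M by exact: le_trans (influence_ge0 hJ (lexx 0)) (JM _ (lexx 0)).
have [f' hf'] := potential_derivative hf.
have vol := @ball_volume_gt0 R d.
have [[Lu0 Lv0] _ [E sbd LE]] := hinit.
have su0 := L20_sqint Lu0; have sv0 := L20_sqint Lv0.
have [ui Ei _] := sbd.
have mE i j : measurable_fun D (fun x => E x i j).
  by apply/measurable_EFinP; exact: measurable_int (Ei i j).
have mom := moment_gt0 hJ JM d.
have l0 : 0 < lame d f0' J.
  rewrite /lame !mulr_gt0 ?(potential_slope_gt0 hf)//.
  by case: ifP => _; rewrite invr_gt0.
have g0 : 0 < fracture_toughness d finf J.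
  apply: mulr_gt0 => //; apply: mulr_gt0; last exact: (finf_gt0 hf).
  by apply: divr_gt0 => //; apply: mulr_gt0 => //; exact: ball_volume_gt0.
have [Efin Hfin] := LEFM_finite mD mE l0 g0 LE.
have [mu0 _ zu0] := Lu0.
have [C C0 hC] := increment_energy hf n1 oD sbd mu0 zu0 Hfin Efin.
have [b' [hbb db _]] := hb.
have sb t : 0 <= t <= T -> sqint (b t) by move=> /hbb[h _]; exact: L20_sqint h.
have sb' t : 0 <= t <= T -> sqint (b' t) by move=> /hbb[_ h]; exact: L20_sqint h.
have [B0 hB0] := L2_path_bounded (ltW hT) db sb sb'.
(* The maximum makes the bound nonnegative, as the exponential rate requires. *)
pose B := Num.max 0 B0.
have B_ge0 : 0 <= B by rewrite le_max lexx.
have hB t : 0 <= t <= T -> sqn (b t) <= B.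
  by move=> tT; rewrite le_max hB0// orbT.
(* The initial conditions hold almost everywhere only. Passing from u0 and v0 to the representatives
   at time 0 uses the quasi-additive bounds with t = 1, which double the energy and the squared
   velocity. *)
pose E0 := rho * sqn v0 + 2 * (M * C).
pose Emax := (E0 + 1) * expR ((B / 2 + 1 + rho^-1) * T).
have E0_ge0 : 0 <= E0.
  by apply: addr_ge0; rewrite ?mulr_ge0 ?sqn_ge0// ltW.
have Emax0 : 0 < Emax by rewrite mulr_gt0 ?expR_gt0// ltr_wpDl.
have T01 : 0 <= (0 : R) <= T by rewrite lexx ltW.
have sut k t : admissible a k -> 0 <= t <= T -> sqint (u k t).
  move=> /hu[ukt [uktt [h _ _ _ _]]] tT.
  by have [h1 _ _] := h t tT; exact: L20_sqint h1.
have PDmax k t : admissible a k -> 0 <= t <= T -> PD f J (horizon k) (u k t) <= Emax.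
  move=> Ak tT; have [vt [at_ [hL [d1 d2 _] i1 i2 eqm]]] := hu k Ak.
  have e0 := @horizon_gt0 R k; have [_ ea] := Ak.
  have start : total_energy f J (horizon k) rho (u k) vt 0 <= E0.
    have [h1 h2 _] := hL 0 T01.
    have s1 := L20_sqint h1; have s2 := L20_sqint h2.
    have w1 := sqintB s1 su0; have w2 := sqintB s2 sv0.
    have z1 : sqn (fun x => u k 0 x - u0 x) = 0.
      by apply: sqn_ae0 => //; apply: filterS i1 => x ->; rewrite subrr.
    have z2 : sqn (fun x => vt 0 x - v0 x) = 0.
      by apply: sqn_ae0 => //; apply: filterS i2 => x ->; rewrite subrr.
    have p1 := PD_quasi_subadditive hf hJ e0 n1 JM su0 w1 (@ltr01 R).
    have p2 := sqnD_le sv0 w2 (@ltr01 R).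
    have p3 := PD_increment_le hf hJ e0 n1 JM ea C0 su0 hC.
    rewrite z1 mulr0 addr0 in p1; rewrite z2 mulr0 addr0 in p2.
    move: p1 p2.
    have -> : (fun x => u0 x + (u k 0 x - u0 x)) = u k 0 by apply/funext => x; rewrite subrKC.
    have -> : (fun x => v0 x + (vt 0 x - v0 x)) = vt 0 by apply/funext => x; rewrite subrKC.
    move=> p1 p2; rewrite /total_energy /E0; apply: lerD.
      have : rho / 2 * sqn (vt 0) <= rho / 2 * ((1 + 1) * sqn v0) by rewrite ler_pM2l ?divr_gt0.
      by move=> /le_trans; apply; rewrite le_eqVlt; apply/orP; left; apply/eqP; field.
    by apply: (le_trans p1); rewrite -[1 + 1]/(2 : R) ler_pM2l.
  have := total_energy_bound hf hJ e0 n1 JM hf' hrho hT hL d1 d2 eqm sb hB start B_ge0 tT.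
  apply: le_trans; rewrite /total_energy lerDr; apply: mulr_ge0; last exact: sqn_ge0.
  by rewrite divr_ge0// ltW.
pose m : R := \int[lebesgueD d]_(xi in eball (0 : 'rV[R]_d) 1) (enorm xi * J (enorm xi)).
have m0 : 0 < m by exact: (radial_moment_gt0 hJ JM (ltnW n1)).
pose K0 := Emax * ball_volume R d / (f (kk ^+ 2) * theta * m).
have K00 : 0 < K0.
  apply: divr_gt0; first exact: mulr_gt0.
  apply: mulr_gt0 => //; apply: mulr_gt0 => //.
  by apply: (potential_gt0 hf); rewrite exprn_gt0.
pose Z t k := process_zone D J (horizon k) (u k t) kk alpha theta.
have mZ t k : 0 <= t <= T -> admissible a k -> measurable (Z t k).
  by move=> tT Ak; apply: measurable_process_zone => //; [exact: horizon_gt0|exact: sut].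
have e1 k : horizon k <= 1 :> R by have := @horizon_anti R 0 k isT; rewrite /horizon expr0 invr1.
have leZ t k : 0 <= t <= T -> admissible a k ->
    (lebesgueD d (Z t k) <= (K0 * horizon k `^ (1 - beta))%:E)%E.
  move=> tT Ak; rewrite hbeta.
  exact: (process_zone_le hf hJ (horizon_gt0 k) (e1 k) n1 JM theta0 kk0 halpha (sut k t Ak tT) mD (PDmax k t Ak tT)).
have p0 : 0 < 1 - beta by rewrite hbeta; lra.
have mono t (delta delta' : R) : delta <= delta' -> CPZd t delta `<=` CPZd t delta'.
  move=> dd x [k [Ak kd] xk]; exists k => //; split => //=.
  exact: lt_le_trans kd dd.
pose K := K0 / (1 - 2^-1 `^ (1 - beta)).
have q1 : 2^-1 `^ (1 - beta) < 1 :> R.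
  have : 2^-1 `^ (1 - beta) < 1 `^ (1 - beta) :> R.
    by apply: gt0_ltr_powR; rewrite ?nnegrE ?invr_ge0// invf_lt1// ltr1n.
  by rewrite powR1.
have K_gt0 : 0 < K by rewrite divr_gt0// subr_gt0.
have leK t delta : 0 <= t <= T -> 0 < delta ->
    (lebesgueD d (CPZd t delta) <= (K * delta `^ (1 - beta))%:E)%E.
  move=> tT d0; apply: (dyadic_union_le (ltW K00) p0 d0) => k Ak; [exact: mZ|exact: leZ].
have mCPZ t delta : 0 <= t <= T -> measurable (CPZd t delta).
  by move=> tT; apply: bigcup_measurable => k [Ak _]; exact: mZ.
have mCPZ0 t : 0 <= t <= T -> measurable (CPZ_0 t).
  (* By monotonicity in delta the intersection may be taken along the countable sequence of
     horizons. *)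
  move=> tT; rewrite (_ : CPZ_0 t = \bigcap_k CPZd t (horizon k)).
    by apply: bigcapT_measurable => k; exact: mCPZ.
  apply/seteqP; split => x h.
    by move=> k _; apply: h; exact: horizon_gt0.
  move=> delta /= d0; have [k kd] := horizon_small d0.
  by apply: (mono t (horizon k)); [exact: ltW|exact: h].
have cvgK : (K * delta `^ (1 - beta)) @[delta --> 0^'+] --> (0 : R).
  by rewrite -[X in _ --> X](mulr0 K); apply: cvgMr; exact: powR_cvg0.
have cvgKE : (K * delta `^ (1 - beta))%:E @[delta --> 0^'+] --> 0%E.
  by apply: cvg_comp cvgK _; exact: cvg_id.
have cvgZ t : 0 <= t <= T -> lebesgueD d (CPZd t delta) @[delta --> 0^'+] --> 0%E.
  move=> tT; apply: (squeeze_cvge _ (cvg_cst 0%E) cvgKE).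
  near=> delta; rewrite measure_ge0 leK//.
have null0 t : 0 <= t <= T -> lebesgueD d (CPZ_0 t) = 0%E.
  move=> tT; apply/eqP; rewrite eq_le measure_ge0 andbT.
  apply: (cvge_to_ge (cvgZ t tT)); near=> delta.
  apply: le_measure; rewrite ?inE; [exact: mCPZ0|exact: mCPZ|].
  by move=> x; apply => /=.
split.
- by move=> t _ delta delta' _; exact: mono.
- by exists K.
- by move=> t tT; split; [exact: cvgZ|exact: null0].
move=> t tT; split.
  (* The probabilities of small and of large strain add up to 1, so the former is at least 1 - theta
     exactly when the latter does not exceed theta. *)
  rewrite (_ : D `\` _ = CPZ_0 t); first exact: null0.
  apply/seteqP; split => x.
    move=> [Dx nst] delta /= d0; apply: contrapT => nC; apply: nst; split => //.
    exists delta => // k Ak kd.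
    have := nbhd_probC kk alpha hJ (horizon_gt0 k) n1 JM (sut k t Ak tT) x.
    set p1 := nbhd_prob _ _ _ _; set p2 := nbhd_prob _ _ _ _ => E1.
    have [p2t|tp2] := leP p2 theta; first by move: E1 p2t; move: p1 p2 => p1 p2; lra.
    by case: nC; exists k.
  (* The choice delta = 1 is arbitrary: it only serves to place x in D. *)
  move=> h; have [k [Ak kd] [Dx _]] := h 1 ltr01; split => // -[_ [delta d0 st]].
  have [j [Aj jd] [_ pj]] := h delta d0.
  have := nbhd_probC kk alpha hJ (horizon_gt0 j) n1 JM (sut j t Aj tT) x.
  have := st j Aj jd; move: pj.
  by move: (nbhd_prob _ _ _ _) (nbhd_prob _ _ _ _) => p1 p2; lra.
rewrite [LHS](measureDI _ mD (mCPZ0 t tT)).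
rewrite [X in (_ + X)%E](_ : _ = 0%E) ?adde0//.
apply/eqP; rewrite eq_le measure_ge0 andbT -(null0 t tT).
by apply: le_measure; rewrite ?inE; [apply: measurableI; [|exact: mCPZ0]|exact: mCPZ0|exact: subIsetr].
Unshelve. all: by end_near.
Qed.
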